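(* Let $G$ be an algebraic group of type $G_2$ defined over a field $k$ of characteristic not $2$. Let $t_0\in G(k)$ be an element which is not unipotent. Then $t_0$ is real in $G(k)$ if and only if $t_0$ is strongly real in $G(k)$. In addition, if the characteristic of $k$ is not $3$, then every unipotent element of $G(k)$ is strongly real in $G(k)$.
   Context: A group $G$ of type $G_2$ over $k$ is isomorphic to $\mathrm{Aut}(\mathfrak C)$ for some octonion algebra $\mathfrak C$ over $k$, and $G(k)$ is the group of $k$-algebra automorphisms of $\mathfrak C$. An element $t\in G(k)$ is real in $G(k)$ if it is conjugate to $t^{-1}$ in $G(k)$; an involution is an element $s$ with $s^2=1$ (the identity is allowed); $t$ is strongly real in $G(k)$ if it is a product of two involutions of $G(k)$. *)

(* Defs.v *)
From HB Require Import structures.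
From mathcomp Require Import all_boot all_order all_algebra.
From mathcomp Require Import boolp.

Set Implicit Arguments.
Unset Strict Implicit.
Unset Printing Implicit Defensive.

Import GRing.Theory.
Local Open Scope ring_scope.

Section QuadraticForm.
Variables (k : fieldType) (V : lmodType k) (N : V -> k).

Definition qpolar (x y : V) : k := N (x + y) - N x - N y.

Definition quadratic_form : Prop :=
  (forall a x, N (a *: x) = a ^+ 2 * N x) /\ bilinear_for *%R *%R qpolar.

Definition qform_nondegenerate : Prop :=
  forall x, (forall y, qpolar x y = 0) -> x = 0.

End QuadraticForm.

(* An octonion algebra is an 8-dimensional composition algebra: a unital, not
   necessarily associative, algebra carrying a nondegenerate quadratic form
   that permits composition. Keeping the norm as data is harmless: it is
   uniquely determined by the unital algebra. *)
HB.mixin Record Vector_isOctonion (k : fieldType) C of Vector k C := {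
  omul : {bilinear C -> C -> C};
  oone : C;
  onorm : C -> k;
  omul1x : left_id oone omul;
  omulx1 : right_id oone omul;
  onorm_quadratic : quadratic_form onorm;
  onorm_nondegenerate : qform_nondegenerate onorm;
  onormM : forall x y : C, onorm (omul x y) = onorm x * onorm y;
  odim : \dim {:C} = 8
}.

#[short(type="octonionType")]
HB.structure Definition Octonion (k : fieldType) :=
  {C of Vector_isOctonion k C & Vector k C}.

Section Automorphisms.
Variables (k : fieldType) (C : octonionType k).

Definition is_oaut (f : 'End(C)) : Prop :=
  [/\ bijective f, f oone = oone &
      forall x y : C, f (omul x y) = omul (f x) (f y)].

Record oaut := OAut { oaut_val :> 'End(C); _ : `[< is_oaut oaut_val >] }.

HB.instance Definition _ := [isSub for oaut_val].
HB.instance Definition _ := [Choice of oaut by <:].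

Lemma oautP (t : oaut) : is_oaut t.
Proof. exact: (asboolP _ (valP t)). Qed.

Lemma oaut_lker0 (t : oaut) : lker t == 0%VS.
Proof. by have [/bij_inj tI _ _] := oautP t; apply/lker0P. Qed.

Lemma oaut_one_subproof : `[< is_oaut \1%VF >].
Proof.
apply/asboolP; split=> [||x y]; rewrite ?id_lfunE //.
by exists id => x; rewrite id_lfunE.
Qed.

Lemma oaut_mul_subproof (s t : oaut) : `[< is_oaut (s \o t)%VF >].
Proof.
have [sb s1 sM] := oautP s; have [tb t1 tM] := oautP t.
apply/asboolP; split=> [||x y]; rewrite ?comp_lfunE ?t1 ?s1 ?tM ?sM //.
by apply: (eq_bij (bij_comp sb tb)) => x; rewrite comp_lfunE.
Qed.

Lemma oaut_inv_subproof (t : oaut) : `[< is_oaut (t^-1)%VF >].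
Proof.
have [_ t1 tM] := oautP t; have t0 := oaut_lker0 t.
have tK := lker0_lfunK t0; have tVK := lker0_lfunVK t0.
apply/asboolP; split=> [||x y]; first by exists t.
  by rewrite -{1}t1 tK.
by rewrite -{1}(tVK x) -{1}(tVK y) -tM tK.
Qed.

Definition oaut_one := OAut oaut_one_subproof.
Definition oaut_mul s t := OAut (oaut_mul_subproof s t).
Definition oaut_inv t := OAut (oaut_inv_subproof t).

Lemma oaut_mulA : associative oaut_mul.
Proof. by move=> r s t; apply/val_inj; rewrite /= comp_lfunA. Qed.

Lemma oaut_mul1 : left_id oaut_one oaut_mul.
Proof. by move=> t; apply/val_inj; rewrite /= comp_lfun1l. Qed.

Lemma oaut_mulr1 : right_id oaut_one oaut_mul.
Proof. by move=> t; apply/val_inj; rewrite /= comp_lfun1r. Qed.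

Lemma oaut_mulV : left_inverse oaut_one oaut_inv oaut_mul.
Proof. by move=> t; apply/val_inj; rewrite /= lker0_compVf ?oaut_lker0. Qed.

Lemma oaut_mulrV : right_inverse oaut_one oaut_inv oaut_mul.
Proof. by move=> t; apply/val_inj; rewrite /= lker0_compfV ?oaut_lker0. Qed.

HB.instance Definition _ := isGroup.Build oaut
  oaut_mulA oaut_mul1 oaut_mulr1 oaut_mulV oaut_mulrV.

(* Unipotency in the algebraic group Aut(C), tested in its defining (faithful)
   representation on C: t - 1 is a nilpotent endomorphism of C. *)
Definition unipotent (t : oaut) : Prop :=
  exists n : nat, forall x : C, iter n (fun y : C => t y - y) x = 0.

End Automorphisms.

Section Reality.
Local Open Scope group_scope.
Variable G : groupType.

Definition real_elt (t : G) : Prop := exists g : G, g * t * g^-1 = t^-1.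

(* The identity counts as an involution. *)
Definition involution (s : G) : Prop := s ^+ 2 = 1.

Definition strongly_real (t : G) : Prop :=
  exists s1 s2 : G, [/\ involution s1, involution s2 & t = s1 * s2].

End Reality.

(* Main.v *)
From HB Require Import structures.
Require Import Defs.
From mathcomp Require Import all_boot all_order all_algebra.
From mathcomp Require Import boolp ring zify.

(* Let [b] be the polar form of the norm. An automorphism that stabilizes a quaternion
   subalgebra is strongly real: by Skolem-Noether it has an explicit form on the Cayley-Dickson
   double, and two orthogonality conditions produce an inverting involution.

   Let [g] conjugate a non-unipotent [t] to its inverse, and consider the generalized
   1-eigenspace of [g ^+ 2], a composition subalgebra stable under [t] and of dimension at
   least 2. In dimension 4 the previous remark applies; in dimension 8 the semisimple part of
   [g] is an involution inverting [t]. In dimension 2, with [u] a pure element of it, the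
   complement of [1, u] is a Hermitian space of rank 3; Cayley-Hamilton there shows that [g]
   and [t] fix [u] and that [t] stabilizes a quaternion subalgebra.

   For [t] unipotent let [n = t - 1] and let [F] be the space of fixed pure octonions. If [F] has
   an anisotropic vector, [t] is a unipotent of the Hermitian space of rank 3. If [F] is
   totally isotropic with a nonzero product, [t] stabilizes a quaternion subalgebra. Otherwise
   [F] is a line and [n ^+ 6] is nonzero on the pure octonions; then the linear map sending
   [n^i v] to [- (t^-1 - 1)^i v] is an involution inverting [t], and it is an automorphism once
   [v] is normalized by [phi v (t (n v)) (n^3 v) = 0], where characteristic not 3 is used. *)

Set Implicit Arguments.
Unset Strict Implicit.
Unset Printing Implicit Defensive.

Import GRing.Theory.
Local Open Scope ring_scope.

(** Everything stays over [k]: generalized eigenspaces are formed only for 1 and -1, and are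
    nondegenerate because 1 and -1 are their own inverses. The square of [g] is used because
    [t g t = g] makes it commute with [t]. Its eigenspace exceeds the line of 1 since [g - g^-1] is
    skew for [b], hence singular on the pure octonions, whose dimension 7 is odd; the same parity
    argument makes the dimension of [F] odd.

    On the Hermitian space, an automorphism fixing [u] preserves [phi], so its determinant is 1 and
    its inverse has the conjugate trace. Reality puts the trace in [k]; the characteristic
    polynomial then has the root 1, and splitting it off leaves a quadratic relation strong enough
    to stabilize every anisotropic line.

    In the regular case the candidate involution is an isometry but not visibly multiplicative. Its
    defect on [phi] is an alternating form invariant under [t], and such forms are so rigid that
    parity and one scalar condition kill it. The 3 is the factor by which that scalar moves when [v]
    is replaced by [v + c n^3 v]; a division by 3 also occurs when [F] is totally isotropic with a
    nonzero product. *)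

(** * Composition identities *)

(* Deduce [a = b] from known equations by exhibiting a linear combination of them, checked
   by [ring]; in [lcombm1] this is done after multiplication by a nonzero [m]. *)
Lemma lcomb1 (R : comNzRingType) (t a b c d : R) :
  c = d -> a - b = t * (c - d) -> a = b.
Proof. by move=> ->; rewrite subrr mulr0 => /eqP; rewrite subr_eq0 => /eqP. Qed.
Lemma lcombm1 (R : idomainType) (m t a b c d : R) :
  m != 0 -> c = d -> m * (a - b) = t * (c - d) -> a = b.
Proof.
move=> m0 ->; rewrite subrr mulr0 => /eqP; rewrite mulf_eq0 (negPf m0) /=.
by rewrite subr_eq0 => /eqP.
Qed.
Lemma lcomb2 (R : comNzRingType) (t1 t2 a b c1 d1 c2 d2 : R) :
  c1 = d1 -> c2 = d2 -> a - b = t1 * (c1 - d1) + t2 * (c2 - d2) -> a = b.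
Proof. by move=> -> -> /eqP; rewrite !subrr !mulr0 addr0 subr_eq0 => /eqP. Qed.
Arguments lcomb2 {R} t1 t2 {a b c1 d1 c2 d2}.
Arguments lcomb1 {R} t {a b c d}.
Arguments lcombm1 {R} m t {a b c d}.

Section Identities.
Variables (k : fieldType) (C : octonionType k).

Definition bilf (x y : C) : k := qpolar (@onorm k C) x y.
(** The conjugate is locked so that rewriting by bilinearity cannot see the difference hidden in it;
    [conjoE] opens it on demand. *)
Fact conjo_key : unit. Proof. exact: tt. Qed.
Definition conjo (x : C) : C := locked_with conjo_key (bilf x oone *: oone - x).
Lemma conjoE x : conjo x = bilf x oone *: oone - x.
Proof. by rewrite /conjo unlock. Qed.

Local Notation "x ** y" := (omul x y) (at level 40, left associativity).
Local Notation N := (@onorm k C).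
Local Notation b := bilf.
Local Notation e := (@oone k C).
Implicit Types x y z w : C.

Lemma bilfPl a x y z : b (a *: x + y) z = a * b x z + b y z.
Proof. by have [_ [H _]] := @onorm_quadratic k C; apply: H. Qed.
Lemma bilfC x y : b x y = b y x.
Proof. by rewrite /bilf /qpolar [y + x]addrC; ring. Qed.
Lemma bilfPr a x y z : b z (a *: x + y) = a * b z x + b z y.
Proof. by rewrite bilfC bilfPl !(bilfC z). Qed.
Lemma bilfDl x y z : b (x + y) z = b x z + b y z.
Proof. by rewrite -{1}[x]scale1r bilfPl mul1r. Qed.
Lemma bilfDr x y z : b z (x + y) = b z x + b z y.
Proof. by rewrite bilfC bilfDl !(bilfC z). Qed.
Lemma bilf0l z : b 0 z = 0.
Proof. by have := bilfDl 0 0 z; rewrite addr0 => /esym/eqP; rewrite -subr_eq0 addrK => /eqP. Qed.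
Lemma bilf0r z : b z 0 = 0.
Proof. by rewrite bilfC bilf0l. Qed.
Lemma bilfZl a x z : b (a *: x) z = a * b x z.
Proof. by rewrite -[a *: x]addr0 bilfPl bilf0l addr0. Qed.
Lemma bilfZr a x z : b z (a *: x) = a * b z x.
Proof. by rewrite bilfC bilfZl bilfC. Qed.
Lemma bilfNl x z : b (- x) z = - b x z.
Proof. by rewrite -scaleN1r bilfZl mulN1r. Qed.
Lemma bilfNr x z : b z (- x) = - b z x.
Proof. by rewrite bilfC bilfNl bilfC. Qed.
Lemma bilf_suml I (r : seq I) P (F : I -> C) z :
  b (\sum_(i <- r | P i) F i) z = \sum_(i <- r | P i) b (F i) z.
Proof.
by apply: (big_morph (fun x => b x z)); [move=> x y; apply: bilfDl | apply: bilf0l].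
Qed.
Lemma bilf_sumr I (r : seq I) P (F : I -> C) z :
  b z (\sum_(i <- r | P i) F i) = \sum_(i <- r | P i) b z (F i).
Proof. by rewrite bilfC bilf_suml; apply: eq_bigr => i _; rewrite bilfC. Qed.

Definition bilfE := (bilfDl, bilfDr, bilfNl, bilfNr, bilfZl, bilfZr, bilf0l, bilf0r).

(** Most vector identities below are proved by pairing with an arbitrary [w], which turns them into
    scalar identities within reach of [ring]. *)
Lemma bilf_inj x y : (forall w, b x w = b y w) -> x = y.
Proof.
move=> H; apply/eqP; rewrite -subr_eq0; apply/eqP.
by apply: (@onorm_nondegenerate k C) => w; rewrite -/(b _ _) !bilfE H subrr.
Qed.

Lemma onormZ a x : N (a *: x) = a ^+ 2 * N x.
Proof. by have [H _] := @onorm_quadratic k C. Qed.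
Lemma onormD x y : N (x + y) = N x + N y + b x y.
Proof. by rewrite /bilf /qpolar; ring. Qed.
Lemma onorm0 : N 0 = 0.
Proof. by rewrite -(scale0r 0) onormZ expr0n mul0r. Qed.
Lemma onormN x : N (- x) = N x.
Proof. by rewrite -scaleN1r onormZ; ring. Qed.

Lemma bilfxx x : b x x = 2%:R * N x.
Proof.
have := onormD x x; have -> : x + x = 2%:R *: x by rewrite scaler_nat mulr2n.
by rewrite onormZ => H; apply: (addrI (N x + N x)); rewrite -H; ring.
Qed.

Lemma omulDl x y z : (x + y) ** z = x ** z + y ** z. Proof. exact: linearDl. Qed.
Lemma omulDr x y z : z ** (x + y) = z ** x + z ** y. Proof. exact: linearDr. Qed.
Lemma omulNl x z : (- x) ** z = - (x ** z). Proof. exact: linearNl. Qed.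
Lemma omulNr x z : z ** (- x) = - (z ** x). Proof. exact: linearNr. Qed.
Lemma omulZl a x z : (a *: x) ** z = a *: (x ** z). Proof. exact: linearZl_LR. Qed.
Lemma omulZr a x z : z ** (a *: x) = a *: (z ** x). Proof. exact: linearZr_LR. Qed.
Lemma omul0l z : 0 ** z = 0. Proof. exact: linear0l. Qed.
Lemma omul0r z : z ** 0 = 0. Proof. exact: linear0r. Qed.
Definition omulE := (omulDl, omulDr, omulNl, omulNr, omulZl, omulZr, omul0l, omul0r,
  @omul1x k C, @omulx1 k C).

Lemma oone_neq0 : e != 0.
Proof.
apply/eqP=> e0; have: \dim {:C} = 0%N.
  apply/eqP; rewrite dimv_eq0; apply/eqP/vspaceP=> x; rewrite memvf memv0.
  by rewrite -[x](@omul1x k C) e0 omul0l eqxx.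
by rewrite odim.
Qed.

Lemma scale1_inj (a c : k) : a *: e = c *: e -> a = c.
Proof.
move/eqP; rewrite -subr_eq0 -scalerBl scaler_eq0 (negPf oone_neq0) orbF.
by rewrite subr_eq0 => /eqP.
Qed.

Lemma onorm1 : N e = 1.
Proof.
have [x Nx] : exists x, N x != 0.
  apply/not_existsP => H; apply/negP: oone_neq0; rewrite negbK; apply/eqP.
  have N0 x : N x = 0 by apply/eqP; apply: contra_notT (H x).
  by apply: bilf_inj => w; rewrite bilf0l /bilf /qpolar !N0 !subr0.
by apply: (mulfI Nx); rewrite -onormM omulx1 mulr1.
Qed.

Lemma bilf_mull x y z : b (x ** y) (x ** z) = N x * b y z.
Proof. by rewrite /bilf /qpolar -omulDr !onormM; ring. Qed.
Lemma bilf_mulr x y z : b (y ** x) (z ** x) = b y z * N x.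
Proof. by rewrite /bilf /qpolar -omulDl !onormM; ring. Qed.
(** Full polarization of [onormM]. Setting one argument to [e] yields the adjoints of left and right
    multiplication, from which all later product rules follow. *)
Lemma bilf_mulD x y z w : b (x ** y) (z ** w) + b (z ** y) (x ** w) = b x z * b y w.
Proof.
have := bilf_mull (x + z) y w; rewrite !omulE !bilfE !bilf_mull onormD => H.
by apply: (lcomb1 1 H); ring.
Qed.

Lemma conjoD x y : conjo (x + y) = conjo x + conjo y.
Proof. by apply: bilf_inj => w; rewrite !conjoE !bilfE; ring. Qed.
Lemma conjoZ a x : conjo (a *: x) = a *: conjo x.
Proof. by apply: bilf_inj => w; rewrite !conjoE !bilfE; ring. Qed.
Lemma conjoK x : conjo (conjo x) = x.
Proof.
apply: bilf_inj => w; rewrite !conjoE !bilfE bilfxx onorm1; ring.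
Qed.

Lemma bilf_adjl x y z : b (x ** y) z = b y (conjo x ** z).
Proof.
have := bilf_mulD x y e z; rewrite !conjoE !omulE !bilfE => <-; ring.
Qed.
Lemma bilf_adjr x y z : b (x ** y) z = b x (z ** conjo y).
Proof.
have := bilf_mulD x y z e; rewrite !conjoE !omulE !bilfE => H.
by rewrite [b x (z ** y)]bilfC; apply: (lcomb1 1 H); ring.
Qed.
Lemma bilf_conj x y : b (conjo x) (conjo y) = b x y.
Proof. by rewrite !conjoE !bilfE bilfxx onorm1 ![b e _]bilfC; ring. Qed.
Lemma onorm_conj x : N (conjo x) = N x.
Proof.
rewrite !conjoE onormD onormZ onormN onorm1 !bilfE [b e x]bilfC; ring.
Qed.

Lemma omulKl x y : conjo x ** (x ** y) = N x *: y.
Proof.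
by apply: bilf_inj => w; rewrite bilf_adjl conjoK bilf_mull bilfZl.
Qed.
Lemma omulVKl x y : x ** (conjo x ** y) = N x *: y.
Proof. by rewrite -{1}[x]conjoK omulKl onorm_conj. Qed.
Lemma omulKr x y : y ** x ** conjo x = N x *: y.
Proof.
by apply: bilf_inj => w; rewrite bilf_adjr conjoK bilf_mulr bilfZl mulrC.
Qed.
Lemma omulxV x : x ** conjo x = N x *: e.
Proof. by rewrite -{1}[x]omul1x omulKr. Qed.
Lemma omulVx x : conjo x ** x = N x *: e.
Proof. by rewrite -{2}[x]omulx1 omulKl. Qed.

(** Polarization of [omulVKl]. With its mirror image it stands in for associativity: it moves
    orthogonal factors past each other. *)
Lemma omul_linl x y z : x ** (conjo y ** z) + y ** (conjo x ** z) = b x y *: z.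
Proof.
have := omulVKl (x + y) z; rewrite conjoD !omulE !omulVKl onormD !scalerDl => H.
apply: (addrI (N x *: z + N y *: z)); rewrite -H.
by apply: bilf_inj => w; rewrite !bilfE; ring.
Qed.
Lemma omul_linr x y z : z ** x ** conjo y + z ** y ** conjo x = b x y *: z.
Proof.
have := omulKr (x + y) z; rewrite conjoD !omulE !omulKr onormD !scalerDl => H.
apply: (addrI (N x *: z + N y *: z)); rewrite -H.
by apply: bilf_inj => w; rewrite !bilfE; ring.
Qed.
Lemma conjoM x y : conjo (x ** y) = conjo y ** conjo x.
Proof.
apply: bilf_inj => w.
rewrite [RHS]bilf_adjl conjoK -[w in LHS]conjoK bilf_conj bilf_adjl bilfC.
by rewrite bilf_adjr conjoK.
Qed.

Lemma bilf1M x y : b (x ** y) e = b x (conjo y).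
Proof. by rewrite bilf_adjr omul1x. Qed.

Definition pure x := b x e = 0.
Lemma pure_conj x : pure x -> conjo x = - x.
Proof. by rewrite /pure conjoE => ->; rewrite scale0r add0r. Qed.

Lemma pure_sq x : pure x -> x ** x = - N x *: e.
Proof. by move/pure_conj=> H; have := omulxV x; rewrite H omulNr scaleNr => <-; rewrite opprK. Qed.
Lemma pureKl x y : pure x -> x ** (x ** y) = - N x *: y.
Proof. by move/pure_conj=> H; have := omulVKl x y; rewrite H !omulE scaleNr => <-; rewrite opprK. Qed.
Lemma pureKr x y : pure x -> y ** x ** x = - N x *: y.
Proof. by move/pure_conj=> H; have := omulKr x y; rewrite H !omulE scaleNr => <-; rewrite opprK. Qed.
Lemma pure_linl x y z : pure x -> pure y ->
  x ** (y ** z) = - (y ** (x ** z)) - b x y *: z.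
Proof.
move=> /pure_conj Hx /pure_conj Hy; have := omul_linl x y z.
by rewrite Hx Hy !omulE => <-; apply: bilf_inj => w; rewrite !bilfE; ring.
Qed.
Lemma pure_linr x y z : pure x -> pure y ->
  z ** x ** y = - (z ** y ** x) - b x y *: z.
Proof.
move=> /pure_conj Hx /pure_conj Hy; have := omul_linr x y z.
by rewrite Hx Hy !omulE => <-; apply: bilf_inj => w; rewrite !bilfE; ring.
Qed.
Lemma pure_anti x y : pure x -> pure y -> x ** y = - (y ** x) - b x y *: e.
Proof. by move=> Hx Hy; have := pure_linl e Hx Hy; rewrite !omulx1. Qed.

(* Alternating on the pure octonions; together with the norm it determines the product. *)
Definition phi x y z := b (x ** y) z.
Lemma phi_swap12 x y z : pure x -> pure y -> pure z -> phi x y z = - phi y x z.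
Proof.
move=> Hx Hy Hz; rewrite /phi (pure_anti Hx Hy) !bilfE [b e z]bilfC Hz; ring.
Qed.
Lemma phi_swap23 x y z : pure x -> phi x y z = - phi x z y.
Proof.
by move=> Hx; rewrite /phi bilf_adjl (pure_conj Hx) !omulE bilfNr bilfC.
Qed.
Lemma phi_adj x y z : pure y -> phi x y z = - phi z y x.
Proof.
by move=> Hy; rewrite /phi bilf_adjr (pure_conj Hy) !omulE bilfNr bilfC.
Qed.

Lemma onorm_eq0_mul x y : x ** y = 0 -> N x != 0 -> y = 0.
Proof.
move=> H Nx; have := omulKl x y; rewrite H omul0r => /esym/eqP.
by rewrite scaler_eq0 (negPf Nx) => /eqP.
Qed.
Lemma onorm_eq0_mulr x y : x ** y = 0 -> N y != 0 -> x = 0.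
Proof.
move=> H Nx; have := omulKr y x; rewrite H omul0l => /esym/eqP.
by rewrite scaler_eq0 (negPf Nx) => /eqP.
Qed.

Lemma sq_eq x : x ** x = b x e *: x - N x *: e.
Proof. by have := omulxV x; rewrite !conjoE !omulE => <-; rewrite opprB addrC subrK. Qed.
End Identities.

(** * Automorphisms are isometries *)

Section Aut.
Variables (k : fieldType) (C : octonionType k).
Local Notation "x ** y" := (omul x y) (at level 40, left associativity).
Local Notation N := (@onorm k C).
Local Notation b := (@bilf k C).
Local Notation e := (@oone k C).
Implicit Types (x y z w : C) (s t g : oaut C).

Lemma oaut1 t : t e = e. Proof. by have [] := oautP t. Qed.
Lemma oautM t x y : t (x ** y) = t x ** t y. Proof. by have [] := oautP t. Qed.
Lemma oautK t x : (t^-1)%g (t x) = x.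
Proof. exact: (lker0_lfunK (oaut_lker0 t)). Qed.
Lemma oautVK t x : t ((t^-1)%g x) = x.
Proof. exact: (lker0_lfunVK (oaut_lker0 t)). Qed.
Lemma oaut_comp s t x : (s * t)%g x = s (t x). Proof. exact: comp_lfunE. Qed.
Lemma oaut_id x : (1%g : oaut C) x = x. Proof. exact: id_lfunE. Qed.
Lemma oaut_inj t : injective t.
Proof. exact: can_inj (oautK t). Qed.
Lemma oaut_eq s t : (forall x, s x = t x) -> s = t.
Proof. by move=> H; apply/val_inj/lfunP. Qed.

(** [t x] satisfies its own quadratic equation and the transported one of [x]. If the traces agree,
    so do the norms; otherwise subtracting makes [t x], hence [x], a multiple of [e]. *)
Lemma oaut_norm t x : N (t x) = N x.
Proof.
have [[a ->]|Hx] := pselect (exists a, x = a *: e).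
  by rewrite linearZ /= oaut1.
have Ht : t x ** t x = b x e *: t x - N x *: e.
  by rewrite -oautM sq_eq linearB !linearZ /= oaut1.
have := sq_eq (t x); rewrite Ht => E.
have [bE|bE] := eqVneq (b x e) (b (t x) e).
  by move: E; rewrite bE => /addrI/oppr_inj/scale1_inj.
case: Hx; exists ((b x e - b (t x) e)^-1 * (N x - N (t x))).
apply: (oaut_inj (t := t)); rewrite linearZ /= oaut1 -scalerA.
have -> : (N x - N (t x)) *: e = (b x e - b (t x) e) *: t x.
  move/eqP: E; rewrite -subr_eq0 => /eqP E; apply/eqP; rewrite -subr_eq0 -oppr_eq0 -E.
  by apply/eqP/bilf_inj => w; rewrite !bilfE; ring.
by rewrite scalerA mulVf ?scale1r // subr_eq0.
Qed.
Lemma oaut_bilf t x y : b (t x) (t y) = b x y.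
Proof. by rewrite /bilf /qpolar -linearD /= !oaut_norm. Qed.
Lemma oaut_bilfV t x y : b (t x) y = b x ((t^-1)%g y).
Proof. by rewrite -{1}[y](oautVK t) oaut_bilf. Qed.
Lemma oaut_phi t x y z : phi (t x) (t y) (t z) = phi x y z.
Proof. by rewrite /phi -oautM oaut_bilf. Qed.
Lemma oaut_pure t x : pure x -> pure (t x).
Proof. by rewrite /pure -{2}(oaut1 t) oaut_bilf. Qed.
End Aut.

(** * Linear algebra and orthogonality *)

Section LinearAlgebra.
Variables (k : fieldType) (V : vectType k).
Implicit Types (f : 'End(V)) (U : {vspace V}) (x y : V).

Lemma ex_linfun (f : V -> V) : linear f -> exists F : 'End(V), F =1 f.
Proof.
move=> lf; pose flM := GRing.isLinear.Build k V V _ f lf.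
by pose fL : {linear V -> V} := HB.pack f flM; exists (linfun fL) => x; rewrite lfunE.
Qed.

Definition lpow f n : 'End(V) := iter n (comp_lfun f) \1%VF.
Lemma lpowE f n x : lpow f n x = iter n f x.
Proof. by elim: n => [|n IH] /=; rewrite ?id_lfunE // comp_lfunE IH. Qed.
Lemma iter_lin0 f n : iter n f 0 = 0.
Proof. by rewrite -lpowE linear0. Qed.
Lemma iter_linD f n x y : iter n f (x + y) = iter n f x + iter n f y.
Proof. by rewrite -!lpowE linearD. Qed.
Lemma iter_linZ f n a x : iter n f (a *: x) = a *: iter n f x.
Proof. by rewrite -!lpowE linearZ. Qed.
Lemma iter_eq0 f m n x : (m <= n)%N -> iter m f x = 0 -> iter n f x = 0.
Proof. by move=> /subnK <- H; rewrite iterD H iter_lin0. Qed.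

(** The images of [U] under powers of [f] lose dimension at each step until they stabilize, and a
    stable image is zero by nilpotency. *)
Lemma nil_dim f U n : (forall x, x \in U -> f x \in U) ->
  (forall x, x \in U -> iter n f x = 0) ->
  forall x, x \in U -> iter (\dim U) f x = 0.
Proof.
move=> fU nU; pose W j := (lpow f j @: U)%VS.
have WS j : W j.+1 = (f @: W j)%VS by rewrite /W /= limg_comp.
have W0 : W 0%N = U by rewrite /W /= lim1g.
have sW j : (W j.+1 <= W j)%VS.
  elim: j => [|j IH]; last by rewrite (WS j.+1) {2}(WS j); apply: limgS.
  by rewrite WS W0; apply/subvP => _ /memv_imgP [x xU ->]; apply: fU.
have dW j : (\dim (W j) <= \dim U - j)%N.
  elim: j => [|j IH]; first by rewrite W0 subn0.
  have [E|E] := eqVneq (W j.+1) (W j).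
    have Wm m : W (m + j)%N = W j by elim: m => // m IHm; rewrite addSn WS IHm -WS.
    have : W j = 0%VS.
      apply/eqP; rewrite -(Wm n) -subv0; apply/subvP=> _ /memv_imgP [x xU ->].
      by rewrite lpowE addnC iterD nU // iter_lin0 mem0v.
    by rewrite E => ->; rewrite dimv0.
  have : (\dim (W j.+1) < \dim (W j))%N.
    rewrite ltn_neqAle (dimvS (sW j)) andbT.
    by apply: contraNN E => /eqP H; rewrite eqEdim sW H leqnn.
  by move=> H; rewrite subnS -ltnS; apply: leq_trans (leqSpred _); apply: leq_trans H IH.
move=> x xU; have := dW (\dim U); rewrite subnn leqn0 dimv_eq0 => /eqP E.
by have := memv_img (lpow f (\dim U)) xU; rewrite -/(W _) E memv0 lpowE => /eqP.
Qed.

(** [gker] and [gimg] are the two Fitting components; by [nil_dim] the exponent [\dim {:V}] already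
    catches every vector killed by some power of [f]. *)
Definition gker f := lker (lpow f (\dim {:V})).
Definition gimg f := limg (lpow f (\dim {:V})).

Lemma gkerP f x : (exists n, iter n f x = 0) <-> x \in gker f.
Proof.
rewrite memv_ker lpowE; split=> [[n fx]|/eqP H]; last by exists (\dim {:V}).
pose U := lker (lpow f n); apply/eqP.
apply: (@iter_eq0 _ (\dim U)); first by rewrite dimvS ?subvf.
apply: (@nil_dim _ _ n); last by rewrite memv_ker lpowE fx.
  move=> y; rewrite !memv_ker !lpowE -iterSr iterS => /eqP ->.
  by rewrite linear0.
by move=> y; rewrite memv_ker lpowE => /eqP.
Qed.

Lemma gker_cap f : (gker f :&: gimg f = 0)%VS.
Proof.
apply/eqP; rewrite -subv0; apply/subvP=> x; rewrite memv_cap => /andP [H /memv_imgP [w _ Ew]].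
have : w \in gker f.
  apply/gkerP; exists (\dim {:V} + \dim {:V})%N; move: H.
  by rewrite memv_ker Ew !lpowE -iterD => /eqP.
by rewrite memv_ker -Ew memv0.
Qed.

Lemma gker_add f : (gker f + gimg f = fullv)%VS.
Proof.
apply/eqP; rewrite eqEdim subvf /= dimv_disjoint_sum ?gker_cap //.
by rewrite -{1}(limg_ker_dim (lpow f (\dim {:V})) fullv) capfv.
Qed.

Lemma basis_lfun n (X Y : n.-tuple V) : free X -> exists s : 'End(V),
  forall i : 'I_n, s X`_i = Y`_i.
Proof.
move=> fX; have [|s Hs] := @ex_linfun (fun x => \sum_(i < n) coord X i x *: Y`_i).
  move=> a x y; rewrite scaler_sumr -big_split; apply: eq_bigr => i _ /=.
  by rewrite linearP /= scalerDl scalerA.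
exists s => i; rewrite Hs (bigD1 i) //= coord_free // eqxx scale1r big1 ?addr0 //.
by move=> j ji; rewrite coord_free // eq_sym (negPf ji) scale0r.
Qed.

Lemma span_ind (X : seq V) (P : V -> Prop) : P 0 ->
  (forall a x y, P x -> P y -> P (a *: x + y)) -> (forall x, x \in X -> P x) ->
  forall x, x \in <<X>>%VS -> P x.
Proof.
move=> P0 PD PX x /(@coord_span _ _ _ (in_tuple X)) ->.
by elim/big_rec: _ => // i y _ Py; apply: PD => //; apply: PX; rewrite mem_nth.
Qed.
End LinearAlgebra.

(** * Orthogonal complements and Cayley-Dickson doubling *)

Section Geometry.
Variables (k : fieldType) (C : octonionType k).
Local Notation "x ** y" := (omul x y) (at level 40, left associativity).
Local Notation N := (@onorm k C).
Local Notation b := (@bilf k C).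
Local Notation e := (@oone k C).
Implicit Types (x y z w u v l : C) (s t g : oaut C) (A B U : {vspace C}).

Lemma rmul_linear l : linear (fun x => x ** l).
Proof. by move=> a x y; rewrite !omulE. Qed.

(** Packs the pairings with a basis of [B] into one endomorphism, so that the orthogonal complement
    is a kernel and rank-nullity gives its dimension. *)
Definition gram_fun B x := \sum_(i < \dim B) b x (vbasis B)`_i *: (vbasis B)`_i.
Lemma gram_linear B : linear (gram_fun B).
Proof.
move=> a x y; rewrite /gram_fun scaler_sumr -big_split; apply: eq_bigr => i _ /=.
by rewrite bilfPl scalerDl scalerA.
Qed.
HB.instance Definition _ B := GRing.isLinear.Build k C C _ (gram_fun B) (@gram_linear B).

Definition orthv B := lker (linfun (gram_fun B)).

Lemma orthvP B x : reflect (forall y, y \in B -> b x y = 0) (x \in orthv B).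
Proof.
rewrite memv_ker lfunE /=; apply: (iffP eqP) => [H y yB|H].
  rewrite (coord_vbasis yB) bilf_sumr big1 // => i _; rewrite bilfZr.
  have /freeP F := basis_free (vbasisP B).
  by rewrite (F (fun i => b x (vbasis B)`_i) H i) mulr0.
rewrite /gram_fun big1 // => i _; rewrite H ?scale0r //.
by apply/vbasis_mem/mem_nth; rewrite size_tuple.
Qed.

Lemma riesz (h : C -> k) : scalar h -> exists v, forall x, b v x = h x.
Proof.
move=> hl; pose f := linfun (gram_fun {:C}).
have kf : lker f == 0%VS.
  rewrite -subv0; apply/subvP=> x /orthvP H; rewrite memv0; apply/eqP.
  by apply: bilf_inj => w; rewrite bilf0l H // memvf.
pose X := vbasis {:C}.
exists (f^-1%VF (\sum_(i < \dim {:C}) h X`_i *: X`_i)) => x; set v := f^-1%VF _.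
have : f v = \sum_(i < \dim {:C}) h X`_i *: X`_i by rewrite lker0_lfunVK.
rewrite lfunE /= /gram_fun => /eqP; rewrite -subr_eq0 -sumrB => /eqP H.
have /freeP F := basis_free (vbasisP {:C}).
have E (i : 'I_(\dim {:C})) : b v X`_i = h X`_i.
  apply/eqP; rewrite -subr_eq0; apply/eqP.
  apply: (F (fun i => b v X`_i - h X`_i)); rewrite -[RHS]H.
  by apply: eq_bigr => j _; rewrite scalerBl.
have h0 : h 0 = 0 by have := hl (-1) 0 0; rewrite scaler0 addr0 mulN1r addNr.
have : x \in <<X>>%VS by rewrite (span_basis (vbasisP _)) memvf.
move: x; apply: span_ind; first by rewrite bilf0r.
  by move=> a x y Ex Ey; rewrite bilfPr Ex Ey hl.
move=> x /(nthP 0) [i]; rewrite size_tuple => iX <-.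
exact: (E (Ordinal iX)).
Qed.

Lemma dual_vec (X : seq C) (a : nat -> k) : free X ->
  exists v, forall i, (i < size X)%N -> b v X`_i = a i.
Proof.
move=> fX; have [|v Hv] := @riesz (fun x => \sum_(i < size X) a i * coord (in_tuple X) i x).
  move=> c x y; rewrite mulr_sumr -big_split; apply: eq_bigr => i _ /=.
  by rewrite linearP /=; ring.
exists v => i iX; rewrite Hv (bigD1 (Ordinal iX)) //= big1 ?addr0.
  by rewrite (coord_free (Ordinal iX) (X := in_tuple X)) // eqxx mulr1.
move=> j ji; rewrite (coord_free (Ordinal iX) (X := in_tuple X)) // eq_sym.
by rewrite (negPf ji) mulr0.
Qed.

(** The Gram map has image exactly [B], since [dual_vec] realizes any prescribed pairings with a
    basis. [B] may be degenerate; this is applied to isotropic spaces of fixed vectors. *)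
Lemma dim_orthv B : (\dim (orthv B) + \dim B)%N = 8.
Proof.
have := limg_ker_dim (linfun (gram_fun B)) fullv; rewrite capfv odim -/(orthv B) => <-.
congr addn; apply/eqP; rewrite eqn_leq; apply/andP; split; apply: dimvS.
  rewrite -{1}(span_basis (vbasisP B)); apply/span_subvP=> x /(nthP 0) [i].
  rewrite size_tuple => iB <-.
  have [v Hv] := dual_vec (fun j => (i == j)%:R) (basis_free (vbasisP B)).
  apply/memv_imgP; exists v; rewrite ?memvf // lfunE /= /gram_fun.
  rewrite (bigD1 (Ordinal iB)) //= Hv ?size_tuple // eqxx scale1r big1 ?addr0 //.
  by move=> j /negPf; rewrite Hv ?size_tuple // eq_sym -val_eqE /= => ->; rewrite scale0r.
apply/subvP=> _ /memv_imgP [x _ ->]; rewrite lfunE /= memv_suml // => i _.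
by rewrite memvZ // vbasis_mem // mem_nth // size_tuple.
Qed.

Definition nondeg B := forall x, x \in B -> (forall y, y \in B -> b x y = 0) -> x = 0.

Lemma nondeg_split B : nondeg B -> (B + orthv B = fullv)%VS.
Proof.
move=> nB; apply/eqP; rewrite eqEdim subvf /= odim dimv_disjoint_sum.
  by rewrite addnC dim_orthv.
apply/eqP; rewrite -subv0; apply/subvP=> x; rewrite memv_cap memv0 => /andP [xB /orthvP H].
by apply/eqP/nB.
Qed.

Lemma nondeg_dec B x : nondeg B -> exists y z, [/\ y \in B, z \in orthv B & x = y + z].
Proof.
move=> nB; have := memvf x; rewrite -(nondeg_split nB) => /memv_addP [y yB [z zB ->]].
by exists y, z.
Qed.

(** If [N] vanished on the complement of [A] in [B], so would [b] by polarization; the complement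
    would then be orthogonal to all of [B], hence zero. Each doubling step takes its new generator
    from here. *)
Lemma exists_aniso A B : nondeg A -> nondeg B -> (A <= B)%VS -> (\dim A < \dim B)%N ->
  exists l, [/\ l \in B, l \in orthv A & N l != 0].
Proof.
move=> nA nB sAB dAB; apply: contrapT => H.
have H0 l : l \in B -> l \in orthv A -> N l = 0.
  by move=> lB lA; apply/eqP; apply: contra_notT H => lN; exists l.
have H1 x y : x \in B -> x \in orthv A -> y \in B -> y \in orthv A -> b x y = 0.
  move=> xB xA yB yA; have := onormD x y.
  by rewrite !H0 ?memvD // !add0r => <-.
suff : (B <= A)%VS by move/dimvS; rewrite leqNgt dAB.
apply/subvP=> x xB; have [y [z [yA zA E]]] := nondeg_dec x nA.
have zB : z \in B.
  have -> : z = x - y by rewrite E [y + z]addrC addrK.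
  by rewrite memvB //; apply: (subvP sAB).
rewrite E (_ : z = 0) ?addr0 //; apply: nB => // w wB.
have [y' [z' [yA' zA' E']]] := nondeg_dec w nA.
rewrite E' bilfDr (orthvP _ _ zA) // H1 ?addr0 //.
have -> : z' = w - y' by rewrite E' [y' + z']addrC addrK.
by rewrite memvB //; apply: (subvP sAB).
Qed.

Definition comp_sub B :=
  [/\ e \in B, forall x y, x \in B -> y \in B -> x ** y \in B & nondeg B].

Section Doubling.
Variables (B : {vspace C}) (l : C).
Hypotheses (cB : comp_sub B) (lB : l \in orthv B) (Nl : N l != 0).

Lemma comp_conj x : x \in B -> conjo x \in B.
Proof. by case: cB => [eB _ _] xB; rewrite conjoE memvB ?memvZ. Qed.
Lemma comp_mul x y : x \in B -> y \in B -> x ** y \in B.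
Proof. by case: cB => [_ H _]; apply: H. Qed.
Lemma comp_orth_pure z : z \in orthv B -> pure z.
Proof. by case: cB => [eB _ _] /orthvP; apply. Qed.
Lemma comp_orth_mull x z : x \in B -> z \in orthv B -> x ** z \in orthv B.
Proof.
move=> xB /orthvP zB; apply/orthvP=> y yB; rewrite bilf_adjl zB //.
by rewrite comp_mul ?comp_conj.
Qed.
Lemma comp_orth_comm y : y \in B -> y ** l = l ** conjo y.
Proof.
move=> yB; have := conjoM y l.
rewrite (pure_conj (comp_orth_pure (comp_orth_mull yB lB))).
by rewrite (pure_conj (comp_orth_pure lB)) omulNl => /oppr_inj.
Qed.
Lemma double_mul12 x y : x \in B -> y \in B -> x ** (y ** l) = (y ** x) ** l.
Proof.
move=> xB yB; rewrite (comp_orth_comm yB) (comp_orth_comm (comp_mul yB xB)) conjoM.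
have := omul_linl x l (conjo y); rewrite (pure_conj (comp_orth_pure lB)) !omulE.
rewrite bilfC (orthvP _ _ lB) // scale0r => /eqP; rewrite addrC subr_eq0 => /eqP.
by [].
Qed.
Lemma double_mul21 x y : x \in B -> y \in B -> (x ** l) ** y = (x ** conjo y) ** l.
Proof.
move=> xB yB; have := omul_linr l (conjo y) x.
rewrite (pure_conj (comp_orth_pure lB)) conjoK (orthvP _ _ lB) ?comp_conj // scale0r !omulE.
by move=> /eqP; rewrite subr_eq0 => /eqP.
Qed.
Lemma double_mul22 x y : x \in B -> y \in B -> (x ** l) ** (y ** l) = - N l *: (conjo y ** x).
Proof.
move=> xB yB; rewrite (comp_orth_comm yB).
have := omul_linl (x ** l) l (conjo y); rewrite (pure_conj (comp_orth_pure lB)).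
rewrite (pure_conj (comp_orth_pure (comp_orth_mull xB lB))) !omulE.
rewrite (double_mul21 xB (comp_conj yB)) conjoK (comp_orth_comm (comp_mul xB yB)).
rewrite (pureKl _ (comp_orth_pure lB)) -[l in b _ l]omul1x bilf_mulr conjoM => H.
apply: bilf_inj => w; move/(congr1 (b^~ w)): H.
rewrite !bilfE (conjoE x) !omulE !bilfE => H; apply: (lcomb1 (-1) H); ring.
Qed.

End Doubling.
End Geometry.

(** * Quaternion subalgebras *)

Section Subalgebras.
Variables (k : fieldType) (C : octonionType k).
Hypothesis two0 : (2%:R : k) != 0.
Local Notation "x ** y" := (omul x y) (at level 40, left associativity).
Local Notation N := (@onorm k C).
Local Notation b := (@bilf k C).
Local Notation e := (@oone k C).
Implicit Types (x y z w u v l : C) (t g c : oaut C) (A B D U : {vspace C}).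

Lemma span4P x a1 a2 a3 a4 : x \in <<[:: a1; a2; a3; a4]>>%VS ->
  exists p q r s, x = p *: a1 + q *: a2 + r *: a3 + s *: a4.
Proof.
rewrite !span_cons span_nil addv0 => /memv_addP [? /vlineP [p ->] [? /memv_addP []]].
move=> ? /vlineP [q ->] [? /memv_addP [? /vlineP [r ->] [? /vlineP [s ->]]]] -> -> ->.
by exists p, q, r, s; rewrite !addrA.
Qed.
Lemma mem_span4 p q r s (a1 a2 a3 a4 : C) :
  p *: a1 + q *: a2 + r *: a3 + s *: a4 \in <<[:: a1; a2; a3; a4]>>%VS.
Proof. by rewrite !memvD ?memvZ ?memv_span // !inE eqxx ?orbT. Qed.

(** [B] and [B ** l] are orthogonal, and right multiplication by [l] is injective, so the dimensions
    4 and 4 fill 8. *)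
Lemma double_exists B l x : comp_sub B -> l \in orthv B -> N l != 0 -> \dim B = 4 ->
  exists y z, [/\ y \in B, z \in B & x = y + z ** l].
Proof.
move=> cB lB Nl dB; have [f Hf] := ex_linfun (rmul_linear l).
have fB : (B :&: lker f = 0)%VS.
  apply/eqP; rewrite -subv0; apply/subvP=> y; rewrite memv_cap memv_ker Hf memv0.
  by move=> /andP [_ /eqP H]; apply/eqP/(onorm_eq0_mulr H Nl).
have : (B + f @: B)%VS = fullv.
  apply/eqP; rewrite eqEdim subvf /= odim dimv_disjoint_sum; last first.
    apply/eqP; rewrite -subv0; apply/subvP=> y; rewrite memv_cap memv0.
    move=> /andP [yB /memv_imgP [z zB E]]; apply/eqP.
    have [_ _ nB] := cB; apply: nB => // w wB; move: E; rewrite Hf => ->.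
    by apply/orthvP: wB; apply: comp_orth_mull.
  by rewrite limg_dim_eq // dB.
move=> E; have := memvf x; rewrite -E => /memv_addP [y yB [_ /memv_imgP [z zB ->] ->]].
by exists y, z; rewrite Hf.
Qed.

Definition quat z v := <<[:: e; z; v; z ** v]>>%VS.

Section Quat.
Variables z v : C.
Hypotheses (Pz : pure z) (Pv : pure v).
Hypothesis disc : 4%:R * N z * N v - b z v ^+ 2 != 0.

(** The Gram matrix splits into the block of [e], [z ** v] and the block of [z], [v]; both have
    determinant [4 N z N v - b z v ^+ 2]. Isotropic generators are thus allowed. *)
Let gram_sol p q r s : let x := p *: e + q *: z + r *: v + s *: (z ** v) in
  b x e = 0 -> b x z = 0 -> b x v = 0 -> b x (z ** v) = 0 -> [/\ p = 0, q = 0, r = 0 & s = 0].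
Proof.
have e1 : b (z ** v) e = - b z v by rewrite bilf1M (pure_conj Pv) bilfNr.
have e2 : b (z ** v) z = 0 by rewrite -{2}(omulx1 z) bilf_mull Pv mulr0.
have e3 : b (z ** v) v = 0 by rewrite -{2}(omul1x v) bilf_mulr Pz mul0r.
have Pz' : b e z = 0 by rewrite bilfC Pz.
have Pv' : b e v = 0 by rewrite bilfC Pv.
move=> x; rewrite /x !bilfE ![b _ (z ** v)]bilfC e1 e2 e3 Pz Pv Pz' Pv' [b v z]bilfC.
rewrite !bilfxx onorm1 onormM => H1 H2 H3 H4.
have [d1 d2] : (4%:R * N z * N v - b z v ^+ 2) * p = 0 /\
              (4%:R * N z * N v - b z v ^+ 2) * s = 0.
  split.
    by apply: (lcomb2 (2%:R * N z * N v) (b z v) H1 H4); ring.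
  by apply: (lcomb2 (b z v) 2%:R H1 H4); ring.
have [d3 d4] : (4%:R * N z * N v - b z v ^+ 2) * q = 0 /\
              (4%:R * N z * N v - b z v ^+ 2) * r = 0.
  split.
    by apply: (lcomb2 (2%:R * N v) (- b z v) H2 H3); ring.
  by apply: (lcomb2 (- b z v) (2%:R * N z) H2 H3); ring.
by split; apply: (mulfI disc); rewrite mulr0.
Qed.

Lemma quat_free : free [:: e; z; v; z ** v].
Proof.
suff : free [tuple e; z; v; z ** v] by []; apply/freeP => a; rewrite !big_ord_recl big_ord0 /= addr0 !addrA => H.
have G p q r s : p *: e + q *: z + r *: v + s *: (z ** v) = 0 ->
    [/\ p = 0, q = 0, r = 0 & s = 0].
  by move=> E; apply: gram_sol; rewrite E bilf0l.
have [a0 a1 a2 a3] := G _ _ _ _ H.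
by case=> [[|[|[|[|//]]]] i4]; [rewrite -[RHS]a0 | rewrite -[RHS]a1
  | rewrite -[RHS]a2 | rewrite -[RHS]a3]; congr a; apply: val_inj.
Qed.

Lemma quat_dim : \dim (quat z v) = 4.
Proof. by apply/eqP; have := quat_free; rewrite /free. Qed.

Lemma quat_table x y : x \in [:: e; z; v; z ** v] -> y \in [:: e; z; v; z ** v] ->
  x ** y \in quat z v.
Proof.
have in4 p q r s w : w = p *: e + q *: z + r *: v + s *: (z ** v) -> w \in quat z v.
  by move=> ->; apply: mem_span4.
rewrite !inE => /or4P [] /eqP -> /or4P [] /eqP ->; rewrite ?omul1x ?omulx1.
- apply: (in4 1 0 0 0); by rewrite !scale0r !addr0 scale1r.
- apply: (in4 0 1 0 0); by rewrite !scale0r !addr0 scale1r add0r.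
- apply: (in4 0 0 1 0); by rewrite !scale0r !addr0 scale1r add0r.
- apply: (in4 0 0 0 1); by rewrite !scale0r !add0r scale1r.
- apply: (in4 0 1 0 0); by rewrite !scale0r !addr0 scale1r add0r.
- apply: (in4 (- N z) 0 0 0); by rewrite !scale0r !addr0 pure_sq.
- apply: (in4 0 0 0 1); by rewrite !scale0r !add0r scale1r.
- apply: (in4 0 0 (- N z) 0); by rewrite !scale0r !addr0 add0r pureKl.
- apply: (in4 0 0 1 0); by rewrite !scale0r !addr0 scale1r add0r.
- apply: (in4 (- b z v) 0 0 (- 1)); rewrite (pure_anti Pv Pz) bilfC.
  by apply: bilf_inj => w; rewrite !bilfE; ring.
- apply: (in4 (- N v) 0 0 0); by rewrite !scale0r !addr0 pure_sq.
- apply: (in4 0 (N v) (- b z v) 0); rewrite (pure_linl _ Pv Pz) pure_sq // bilfC.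
  by apply: bilf_inj => w; rewrite !(omulE, bilfE); ring.
- apply: (in4 0 0 0 1); by rewrite !scale0r !add0r scale1r.
- apply: (in4 0 (- b z v) (N z) 0); rewrite (pure_linr _ Pv Pz) pure_sq // bilfC.
  by apply: bilf_inj => w; rewrite !(omulE, bilfE); ring.
- apply: (in4 0 (- N v) 0 0); by rewrite !scale0r !addr0 add0r pureKr.
- apply: (in4 (- (N z * N v)) 0 0 (- b z v)).
  rewrite sq_eq onormM bilf1M (pure_conj Pv).
  by apply: bilf_inj => w; rewrite !bilfE; ring.
Qed.

Lemma quat_comp : comp_sub (quat z v).
Proof.
split.
- by rewrite memv_span ?inE ?eqxx.
- move=> x y xq; move: y; apply: span_ind; first by rewrite omul0r mem0v.
    by move=> a y y' H H'; rewrite !omulE memvD // memvZ.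
  move=> y yq; move: x xq; apply: span_ind; first by rewrite omul0l mem0v.
    by move=> a x x' H H'; rewrite !omulE memvD // memvZ.
  by move=> x xq; apply: quat_table.
- move=> x /span4P [p [q [r [s ->]]]] H.
  have inq w : w \in [:: e; z; v; z ** v] -> w \in quat z v by apply: memv_span.
  have [] := @gram_sol p q r s; rewrite ?H ?inq ?inE ?eqxx ?orbT //.
  by move=> -> -> -> ->; rewrite !scale0r !addr0.
Qed.

Lemma mem_quat1 : z \in quat z v. Proof. by rewrite memv_span // !inE eqxx orbT. Qed.
Lemma mem_quat2 : v \in quat z v. Proof. by rewrite memv_span // !inE eqxx !orbT. Qed.

Lemma quat_stable t : t z \in quat z v -> t v \in quat z v ->
  forall x, x \in quat z v -> t x \in quat z v.
Proof.
have [q1 qM _] := quat_comp.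
move=> tz tv; apply: span_ind; first by rewrite linear0 mem0v.
  by move=> a x y H H'; rewrite linearP /= memvD // memvZ.
move=> x; rewrite !inE => /or4P [] /eqP -> //; first by rewrite oaut1.
by rewrite oautM qM.
Qed.
End Quat.

Lemma quat_sub B z v : comp_sub B -> z \in B -> v \in B -> (quat z v <= B)%VS.
Proof.
move=> [eB MB _] zB vB; apply/span_subvP=> x; rewrite !inE.
by case/or4P => /eqP -> //; apply: MB.
Qed.

Lemma quat_perp_disc z v : b z v = 0 -> N z != 0 -> N v != 0 ->
  4%:R * N z * N v - b z v ^+ 2 != 0.
Proof.
move=> -> Nz Nv; rewrite expr0n subr0 !mulf_neq0 //.
by rewrite (_ : 4 = 2 * 2 :> k) ?mulf_neq0 //; ring.
Qed.

Lemma nondeg_line x : N x != 0 -> nondeg <[x]>%VS.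
Proof.
move=> Nx y /vlineP [a ->] H; have := H x (memv_line x).
rewrite bilfZl bilfxx => /eqP; rewrite !mulf_eq0 (negPf Nx) (negPf two0) !orbF.
by move/eqP->; rewrite scale0r.
Qed.
Lemma nondeg_pair x y : b x y = 0 -> N x != 0 -> N y != 0 -> nondeg <<[:: x; y]>>%VS.
Proof.
move=> xy Nx Ny w.
rewrite !span_cons span_nil addv0 => /memv_addP [_ /vlineP [p ->] [_ /vlineP [q ->] ->]] H.
have {}H z : z \in [:: x; y] -> b (p *: x + q *: y) z = 0.
  by move=> zX; apply: H; have := memv_span zX; rewrite !span_cons span_nil addv0.
have [] := (H x, H y); rewrite !inE !eqxx ?orbT !bilfE !bilfxx [b y x]bilfC xy => H1 H2.
have p0 : p = 0 by apply: (lcombm1 (2%:R * N x) 1 _ (H1 isT)); rewrite ?mulf_neq0 //; ring.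
have q0 : q = 0 by apply: (lcombm1 (2%:R * N y) 1 _ (H2 isT)); rewrite ?mulf_neq0 //; ring.
by rewrite p0 q0 !scale0r addr0.
Qed.

Lemma in_orth_line x y : y \in orthv <[x]>%VS -> b y x = 0.
Proof. by move/orthvP; apply; apply: memv_line. Qed.
Lemma in_orth_span (X : seq C) x y : x \in X -> y \in orthv <<X>>%VS -> b y x = 0.
Proof. by move=> xX /orthvP; apply; apply: memv_span. Qed.
Lemma orth_spanP (X : seq C) y : (forall x, x \in X -> b y x = 0) -> y \in orthv <<X>>%VS.
Proof.
move=> H; apply/orthvP; apply: span_ind => //; first by rewrite bilf0r.
by move=> a x z Hx Hz; rewrite bilfPr Hx Hz mulr0 addr0.
Qed.

(** A nondegenerate subspace properly inside [B] leaves an anisotropic vector orthogonal to it. Two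
    such vectors generate a quaternion subalgebra, and a third one doubles it to the whole space. *)
Lemma comp_sub_cases B : comp_sub B -> (1 < \dim B)%N ->
  [\/ B = fullv, \dim B = 4 | exists u, [/\ pure u, N u != 0 & B = <<[:: e; u]>>%VS]].
Proof.
move=> cB dB; have [eB MB nB] := cB.
have N1 : N e != 0 by rewrite onorm1 oner_eq0.
have [||u [uB /in_orth_line Pu Nu]] := exists_aniso (nondeg_line N1) nB.
- by apply/subvP=> _ /vlineP [a ->]; rewrite memvZ.
- by rewrite dim_vline (leq_ltn_trans (leq_b1 _) dB).
have nL : nondeg <<[:: e; u]>>%VS by apply: nondeg_pair; rewrite // bilfC.
have sL : (<<[:: e; u]>> <= B)%VS.
  by apply/span_subvP=> x; rewrite !inE => /orP [] /eqP ->.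
have [dL|dL] := leqP (\dim B) (\dim <<[:: e; u]>>%VS).
  by apply: Or33; exists u; split=> //; apply/esym/eqP; rewrite eqEdim sL dL.
have [v [vB vL Nv]] := exists_aniso nL nB sL dL.
have Pv : pure v by apply: in_orth_span vL; rewrite !inE eqxx.
have uv : b u v = 0 by rewrite bilfC; apply: in_orth_span vL; rewrite !inE eqxx orbT.
have dsc := quat_perp_disc uv Nu Nv.
have cD := quat_comp Pu Pv dsc; have [eD MD nD] := cD.
have dD := quat_dim Pu Pv dsc; have sD := quat_sub cB uB vB.
have [dB4|dB4] := leqP (\dim B) 4.
  by apply: Or32; apply/eqP; rewrite eqn_leq dB4 -dD dimvS.
apply: Or31; have [|l [lB lD Nl]] := exists_aniso nD nB sD; first by rewrite dD.
apply/vspaceP=> x; rewrite memvf.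
have [y [z [/(subvP sD) yB /(subvP sD) zB ->]]] := double_exists x cD lD Nl dD.
by rewrite memvD // MB.
Qed.

(* A skew-symmetric matrix of odd size is singular. *)
Lemma skew_odd (S : C -> C) U : linear S -> (forall x y, b x (S y) = - b (S x) y) ->
  odd (\dim U) -> exists q, [/\ q \in U, q != 0 & forall p, p \in U -> b p (S q) = 0].
Proof.
move=> lS skS oU; have [F HF] := ex_linfun lS; pose X := vbasis U.
pose M := \matrix_(i < \dim U, j < \dim U) b X`_i (F X`_j).
have : \det M = 0.
  have MT : M^T = -1 *: M.
    by apply/matrixP=> i j; rewrite !mxE !HF skS bilfC mulN1r.
  have := det_tr M; rewrite MT detZ -signr_odd oU expr1 => /eqP.
  rewrite mulN1r eq_sym -addr_eq0 -mulr2n -mulr_natl mulf_eq0 (negPf two0) /=.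
  by move/eqP.
rewrite -det_tr => /eqP/det0P [c c0 cM].
exists (\sum_i c 0 i *: X`_i); split.
- by rewrite memv_suml // => i _; rewrite memvZ // vbasis_mem // mem_nth ?size_tuple.
- apply: contraNN c0 => /eqP H; apply/eqP/rowP=> i; rewrite mxE.
  by have /freeP := basis_free (vbasisP U); apply.
move=> p pU; rewrite -HF linear_sum bilf_sumr /= (coord_vbasis pU).
rewrite -[RHS](@mulr0 k 0); under eq_bigr => i _ do rewrite linearZ /= bilfZr bilf_suml.
under eq_bigr => i _ do rewrite mulr_sumr.
rewrite exchange_big /= big1 ?mulr0 // => j _.
have := congr1 (fun A : 'rV__ => A 0 j) cM; rewrite !mxE => H.
rewrite -[RHS](mulr0 (coord X j p)) -[X in _ = _ * X]H mulr_sumr; apply: eq_bigr => i _.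
by rewrite !mxE bilfZl; ring.
Qed.
End Subalgebras.

(** * Generalized eigenspaces *)

Section GeneralizedEigenspaces.
Variables (k : fieldType) (C : octonionType k).
Hypothesis two0 : (2%:R : k) != 0.
Local Notation "x ** y" := (omul x y) (at level 40, left associativity).
Local Notation N := (@onorm k C).
Local Notation b := (@bilf k C).
Local Notation e := (@oone k C).
Implicit Types (x y z w u v l : C) (s t g h : oaut C) (A B D U : {vspace C}).

Lemma strongly_real_of s t : (forall x, s (s x) = x) -> (forall x, s (t (s (t x))) = x) ->
  strongly_real t.
Proof.
move=> ss stst; have s2 : (s * s = 1)%g.
  by apply: oaut_eq => x; rewrite oaut_comp oaut_id.
exists s, (s * t)%g; split; rewrite /involution ?expgS ?expg1 ?expg0 ?mulg1 //.
  by apply: oaut_eq => x; rewrite !oaut_comp oaut_id.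
by rewrite mulgA s2 mul1g.
Qed.

(** Reality is used from here on in the inverse-free form [t g t = g]. *)
Lemma real_inv t g x : (g * t * g^-1 = t^-1)%g -> t (g (t x)) = g x.
Proof.
move=> /(congr1 (fun f : oaut C => f (g x))); rewrite !oaut_comp oautK => ->.
by rewrite oautVK.
Qed.
Lemma real_sq_comm t g : (forall x, t (g (t x)) = g x) ->
  forall x, t (g (g x)) = g (g (t x)).
Proof.
move=> H x; have -> : g (t x) = (t^-1)%g (g x) by rewrite -[in RHS](H x) oautK.
by rewrite -[in RHS]H oautVK.
Qed.

Definition fsh t (a : k) : 'End(C) := (t : 'End(C)) - a *: \1%VF.
Lemma fshE t a x : fsh t a x = t x - a *: x.
Proof. by rewrite add_lfunE opp_lfunE scale_lfunE id_lfunE. Qed.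
(* The generalized eigenspace of [t] for the eigenvalue [a]. *)
Definition gk t a := gker (fsh t a).
Lemma gkP t a x : (exists n, iter n (fsh t a) x = 0) <-> x \in gk t a.
Proof. exact: gkerP. Qed.

Lemma iter_comm t a s n x : (forall y, s (t y) = t (s y)) ->
  iter n (fsh t a) (s x) = s (iter n (fsh t a) x).
Proof.
by move=> st; elim: n => // n IH; rewrite !iterS IH !fshE [in RHS]linearB [in RHS]linearZ /= st.
Qed.
Lemma gk_stable t a s x : (forall y, s (t y) = t (s y)) -> x \in gk t a -> s x \in gk t a.
Proof.
by move=> st /gkP [n H]; apply/gkP; exists n; rewrite iter_comm // H linear0.
Qed.

Lemma gk_dim t a x : x \in gk t a -> iter (\dim {:C}) (fsh t a) x = 0.
Proof. by rewrite memv_ker lpowE => /eqP. Qed.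

(** A twisted Leibniz rule: [t - a c] sends [x ** y] to [(t - a) x ** t y + a (x ** (t - c) y)].
    Each term lowers one of the two nilpotency orders, so induction on their sum applies. *)
Lemma gk_mul t a c x y : x \in gk t a -> y \in gk t c -> x ** y \in gk t (a * c).
Proof.
move=> /gkP [i xi] /gkP [j yj]; apply/gkP; exists (i + j)%N.
have [n] := ubnP (i + j); elim: n => // n IH in i j x y xi yj *.
case: i xi => [|i] xi; first by have -> : x = 0 by []; rewrite omul0l iter_lin0.
case: j yj => [|j] yj; first by have -> : y = 0 by []; rewrite omul0r iter_lin0.
rewrite addSn => ijn; rewrite iterSr.
rewrite (_ : fsh t (a * c) (x ** y) = fsh t a x ** t y + a *: (x ** fsh t c y)); first rewrite iter_linD iter_linZ.
have -> : iter (i + j.+1) (fsh t (a * c)) (fsh t a x ** t y) = 0.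
  apply: IH => //; first by rewrite -iterSr.
  by rewrite iter_comm // yj linear0.
have -> : iter (i + j.+1) (fsh t (a * c)) (x ** fsh t c y) = 0.
  by rewrite addnS -addSn; apply: IH; rewrite // -?iterSr // addSn -addnS.
  by rewrite scaler0 addr0.
rewrite !fshE oautM !omulE scalerBr scalerA.
by apply: bilf_inj => w; rewrite !bilfE; ring.
Qed.

Lemma gk_cap t a c x : a != c -> x \in gk t a -> x \in gk t c -> x = 0.
Proof.
move=> ac /gkP [n]; elim: n x => // n IH x; rewrite iterSr => Hn xc.
have tx : fsh t a x = 0.
  apply: IH => //; rewrite fshE memvB ?memvZ //; exact: gk_stable.
move: xc => /gkP [m]; have -> : iter m (fsh t c) x = (a - c) ^+ m *: x.
  elim: m => [|m IHm]; first by rewrite scale1r.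
  rewrite iterS IHm linearZ /= fshE; move: tx; rewrite fshE => /eqP.
  by rewrite subr_eq0 => /eqP ->; rewrite -scalerBl scalerA exprSr.
by move/eqP; rewrite scaler_eq0 expf_eq0 subr_eq0 (negPf ac) andbF => /eqP.
Qed.

(** As [a] is its own inverse, the adjoint [t^-1 - a] of [t - a] equals [- a t^-1 (t - a)]; powers
    of [t - a] therefore cross the pairing and kill [x]. *)
Lemma gk_orth t a x w : a ^+ 2 = 1 -> x \in gk t a -> w \in gimg (fsh t a) -> b w x = 0.
Proof.
move=> a2 /gkP [n Hn] /memv_imgP [w' _ ->]; rewrite lpowE.
have H m y z : iter m (fsh t a) y = 0 -> b (iter m (fsh t a) z) y = 0.
  elim: m y z => [|m IH] y z; first by move=> /= ->; rewrite bilf0r.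
  move=> H; rewrite iterS {1}fshE bilfDl bilfNl bilfZl oaut_bilfV -bilfZr -bilfNr -bilfDr.
  apply: IH; have -> : (t^-1)%g y + - (a *: y) = - a *: (t^-1)%g (fsh t a y).
    rewrite fshE [in RHS]linearB [in RHS]linearZ /= oautK.
    apply: bilf_inj => v; rewrite !bilfE.
    by apply: (lcomb1 (- b ((t^-1)%g y) v) a2); ring.
  rewrite iter_linZ iter_comm -?iterSr ?H ?linear0 ?scaler0 //.
  by move=> v; rewrite oautK oautVK.
by apply: H; apply/eqP; rewrite -lpowE -memv_ker; apply/gkP; exists n.
Qed.

Lemma gk_nondeg t a : a ^+ 2 = 1 -> nondeg (gk t a).
Proof.
move=> a2 x xB H; apply: bilf_inj => w; rewrite bilf0l.
have := memvf w; rewrite -(gker_add (fsh t a)) => /memv_addP [y yB [z zB ->]].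
by rewrite bilfDr H // add0r bilfC (gk_orth a2 xB zB).
Qed.

Lemma gk_comp t : comp_sub (gk t 1).
Proof.
split; last by apply: gk_nondeg; rewrite expr1n.
  by apply/gkP; exists 1%N; rewrite /= fshE oaut1 scale1r subrr.
by move=> x y xB yB; have := gk_mul xB yB; rewrite mulr1.
Qed.

Lemma gk_fix t x : t x = x -> x \in gk t 1.
Proof. by move=> tx; apply/gkP; exists 1%N; rewrite /= fshE tx scale1r subrr. Qed.

Lemma unipotentP t : unipotent t <-> gk t 1 = fullv.
Proof.
have E n x : iter n (fun y => t y - y) x = iter n (fsh t 1) x.
  by elim: n => //= n ->; rewrite fshE scale1r.
split=> [[n H]|H].
  by apply/vspaceP=> x; rewrite memvf; apply/gkP; exists n; rewrite -E.
exists (\dim {:C}) => x; rewrite E; apply/eqP; rewrite -lpowE -memv_ker.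
by rewrite -/(gker _) -/(gk _ _) H memvf.
Qed.

(** * The case where [g ^+ 2] is unipotent *)

Section SquareUnipotent.
Variable g : oaut C.
Hypothesis g2 : gk (g * g)%g 1 = fullv.

Let V := gk g 1.
Let W := gimg (fsh g 1).

Let N1neq : (1 : k) != -1.
Proof. by rewrite -addr_eq0. Qed.

(** [(g + 1)^n (g - 1)^n = (g^2 - 1)^n], which vanishes for large [n]: the Fitting complement of the
    eigenspace for 1 is the one for -1. *)
Let W_sub w : w \in W -> w \in gk g (-1).
Proof.
move=> /memv_imgP [x _ ->]; apply/gkP; exists (\dim {:C}); rewrite lpowE.
have E n : iter n (fsh g (-1)) (iter n (fsh g 1) x) = iter n (fsh (g * g)%g 1) x.
  elim: n => // n IH; rewrite !iterS.
  have cm y : fsh g (-1) (fsh g 1 y) = fsh (g * g)%g 1 y.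
    rewrite !fshE oaut_comp linearB /= linearZ /= !scale1r scaleN1r.
    by apply: bilf_inj => w'; rewrite !bilfE; ring.
  have cm2 m y : iter m (fsh g (-1)) (fsh g 1 y) = fsh g 1 (iter m (fsh g (-1)) y).
    elim: m => // m IHm; rewrite !iterS IHm !fshE !linearD /= !linearN /= !linearZ /=.
    by apply: bilf_inj => w'; rewrite !bilfE; ring.
  by rewrite cm2 IH cm.
by rewrite E; apply/eqP; rewrite -lpowE -memv_ker -/(gker _) -/(gk _ _) g2 memvf.
Qed.
Let W_eq x : x \in W <-> x \in gk g (-1).
Proof.
split; first exact: W_sub.
move=> xg; have := memvf x; rewrite -(gker_add (fsh g 1)) => /memv_addP [v vV [w wW E]].
suff v0 : v = 0 by rewrite E v0 add0r.
apply: (gk_cap N1neq vV); have -> : v = x - w by rewrite E addrK.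
by rewrite memvB // W_sub.
Qed.

Let s := (2%:R *: daddv_pi V W - \1)%VF.
Let sV v : v \in V -> s v = v.
Proof.
move=> vV; rewrite add_lfunE opp_lfunE scale_lfunE id_lfunE daddv_pi_id ?gker_cap //.
by rewrite scaler_nat mulr2n addrK.
Qed.
Let sW w : w \in W -> s w = - w.
Proof.
move=> wW; rewrite add_lfunE opp_lfunE scale_lfunE id_lfunE.
suff -> : daddv_pi V W w = 0 by rewrite scaler0 add0r.
have := @daddv_pi_add _ _ V W w (gker_cap _); rewrite (gker_add (fsh g 1)) memvf => /(_ isT).
rewrite (daddv_pi_id (U := W)) //; last by rewrite capvC gker_cap.
by rewrite -[RHS]add0r => /addIr.
Qed.
Let dec x : exists v w, [/\ v \in V, w \in W & x = v + w].
Proof.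
have := memvf x; rewrite -(gker_add (fsh g 1)) => /memv_addP [v vV [w wW E]].
by exists v, w.
Qed.
Let ss x : s (s x) = x.
Proof.
have [v [w [vV wW ->]]] := dec x.
by rewrite linearD /= (sV vV) (sW wW) linearB /= (sV vV) (sW wW) opprK.
Qed.

(** By [gk_mul] the eigenspaces [V] and [W] form a grading of the algebra by signs, and [s] is the
    sign of that grading. *)
Let s_oaut : is_oaut s.
Proof.
have sg w : w \in gk g (-1) -> s w = - w by move/W_eq/sW.
split; first by exists s => x; apply: ss.
  by rewrite sV //; apply: gk_fix; apply: oaut1.
move=> x y; have [v [w [vV wW ->]]] := dec x; have [v' [w' [vV' wW' ->]]] := dec y.
have [/W_sub wg /W_sub wg'] := (wW, wW').
rewrite !omulE !linearD /= (sV vV) (sV vV') (sW wW) (sW wW') !omulE.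
rewrite (sV (_ : v ** v' \in V)); last by have := gk_mul vV vV'; rewrite mulr1.
rewrite (sV (_ : w ** w' \in V)); last by have := gk_mul wg wg'; rewrite mulrNN mulr1.
rewrite (sg (v ** w')); last by have := gk_mul vV wg'; rewrite mul1r.
rewrite (sg (w ** v')); last by have := gk_mul wg vV'; rewrite mulr1.
by apply: bilf_inj => x0; rewrite !bilfE; ring.
Qed.

(* The semisimple part of [g] is an involution inverting [t]: its unipotent part [h]
   commutes with [t] because [t] commutes with [h ^+ 2 = g ^+ 2]. *)
Lemma square_unipotent_inverts t : (forall x, t (g (t x)) = g x) -> strongly_real t.
Proof.
move=> rev; pose S := OAut (introT (asboolP _) s_oaut).
have SE x : S x = s x by [].
have gs x : g (s x) = s (g x).
  have [v [w [vV wW ->]]] := dec x.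
  rewrite !linearD /= (sV vV) (sW wW) (sV (gk_stable _ vV)) // sW ?linearN //.
  by apply/W_eq/gk_stable => //; apply/W_eq.
pose h := (S * g)%g; have hE x : h x = s (g x) by rewrite oaut_comp.
have h1 x : x \in gk h 1.
  have [v [w [vV wW ->]]] := dec x; apply: memvD.
    have /gkP [n Hn] := vV; apply/gkP; exists n.
    rewrite -[RHS]Hn; have : iter 0 (fsh g 1) v \in V by [].
    elim: (n) => // m IH _; rewrite !iterS IH // !fshE hE sV //.
    have mV : iter m (fsh g 1) v \in V by elim: (m) => //= i IHi; rewrite fshE memvB ?memvZ // gk_stable.
    exact: gk_stable.
  have /W_sub/gkP [n Hn] := wW; apply/gkP; exists n.
  have E m : iter m (fsh h 1) w = (-1) ^+ m *: iter m (fsh g (-1)) w /\ iter m (fsh g (-1)) w \in W.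
    elim: m => [|m [IH IHW]]; first by rewrite scale1r.
    have IHg : g (iter m (fsh g (-1)) w) \in W by apply/W_eq/gk_stable => //; apply/W_eq.
    split; last by rewrite iterS fshE memvB ?memvZ.
    rewrite !iterS IH linearZ /= exprS -scalerA scaleN1r -scalerN; congr (_ *: _).
    by rewrite !fshE hE sW //; apply: bilf_inj => x0; rewrite !bilfE; ring.
  by rewrite (E n).1 Hn scaler0.
have hp x : h x = - x -> x = 0.
  by move=> hx; apply: (gk_cap N1neq (h1 x)); apply/gkP; exists 1%N; rewrite /= fshE hx scaleN1r opprK addNr.
have h2 x : h (h x) = g (g x) by rewrite !hE -gs ss.
have th2 x : t (h (h x)) = h (h (t x)) by rewrite !h2 real_sq_comm.
(* The commutator [D] of [t] and [h] satisfies [h D = - D h], so [(h - 1)^n D = (-1)^n D (h + 1)^n].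
   The left side vanishes for large [n], and [h + 1] is invertible because -1 is not an eigenvalue
   of the unipotent [h]. *)
have [D HD] : exists D : 'End(C), forall x, D x = t (h x) - h (t x).
  apply: ex_linfun => a x y; rewrite !linearP /=.
  by apply: bilf_inj => w; rewrite !bilfE; ring.
have hD x : h (D x) = - D (h x) by rewrite !HD linearB /= th2 opprB.
pose H1 : 'End(C) := (h : 'End(C)) + \1%VF.
have H1E x : H1 x = h x + x by rewrite add_lfunE id_lfunE.
have kH : lker H1 == 0%VS.
  rewrite -subv0; apply/subvP=> x; rewrite memv_ker memv0 H1E addr_eq0 => /eqP /hp ->.
  by rewrite eqxx.
have D0 x : D x = 0.
  have shift y : fsh h 1 (D y) = - D (H1 y) by rewrite fshE hD H1E linearD scale1r opprD.
  have cm n y : iter n (fsh h 1) (D y) = (-1) ^+ n *: D (iter n H1 y).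
    elim: n => [|n IH]; first by rewrite scale1r.
    by rewrite iterS IH linearZ /= shift exprS -scalerA scaleN1r scalerN.
  pose n := \dim {:C}; pose y := iter n (H1^-1)%VF x.
  have yx : iter n H1 y = x.
    rewrite /y; elim: (n) => // m IH; rewrite iterSr iterS lker0_lfunVK //.
  have /eqP := cm n y; rewrite yx gk_dim // eq_sym scaler_eq0 signr_eq0 => /eqP.
  by [].
have th x : t (h x) = h (t x) by apply/eqP; rewrite -subr_eq0 -HD D0.
have gE x : g x = s (h x) by rewrite hE ss.
have hI := oaut_inj (t := h).
apply: (@strongly_real_of S) => x; rewrite !SE ?ss //.
have [y ->] : exists y, x = h y by exists ((h^-1)%g x); rewrite oautVK.
by rewrite th -gE rev gE ss.
Qed.
End SquareUnipotent.
End GeneralizedEigenspaces.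

(** * Automorphisms stabilizing a quaternion subalgebra *)

Section StableQuaternion.
Variables (k : fieldType) (C : octonionType k).
Hypothesis two0 : (2%:R : k) != 0.
Local Notation "x ** y" := (omul x y) (at level 40, left associativity).
Local Notation N := (@onorm k C).
Local Notation b := (@bilf k C).
Local Notation e := (@oone k C).
Variables (D : {vspace C}).
Hypotheses (cD : comp_sub D) (dD : \dim D = 4).

Lemma exists_orth : exists2 a, a \in orthv D & N a != 0.
Proof.
have [_ _ nD] := cD.
have nf : nondeg (C := C) fullv.
  by move=> x _ H; apply: bilf_inj => w; rewrite bilf0l H ?memvf.
by have [||a [_ aD Na]] := exists_aniso nD nf; rewrite ?subvf ?odim ?dD //; exists a.
Qed.

(* Both sides are read off from [x ** (y ** (z ** a))], as [a] and [z ** a] lie in [orthv D]. *)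
Lemma comp_assoc x y z : x \in D -> y \in D -> z \in D -> (z ** y) ** x = z ** (y ** x).
Proof.
move=> xD yD zD; have [a aD Na] := exists_orth.
have MD u v : u \in D -> v \in D -> u ** v \in D by case: cD => _ + _ ; apply.
have := double_mul12 cD (comp_orth_mull cD zD aD) xD yD.
rewrite (double_mul12 cD aD yD zD) (double_mul12 cD aD xD (MD _ _ zD yD)).
rewrite (double_mul12 cD aD (MD _ _ yD xD) zD) => /eqP.
rewrite -subr_eq0 -omulNl -omulDl => /eqP H; apply/eqP; rewrite -subr_eq0.
by apply/eqP/(onorm_eq0_mulr H Na).
Qed.

(** [D] is associative, unlike the ambient algebra; giving it its own algebra type makes the ring
    lemmas available. *)
Definition quatH := subvs_of D.
HB.instance Definition _ := Vector.on quatH.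
Definition hmul (x y : quatH) : quatH := vsproj D (vsval x ** vsval y).
Definition hone : quatH := vsproj D e.
Lemma val_hmul (x y : quatH) : vsval (hmul x y) = vsval x ** vsval y.
Proof. by rewrite vsprojK //; case: cD => _ H _; apply: H; apply: subvsP. Qed.
Lemma val_hone : vsval hone = e.
Proof. by rewrite vsprojK //; case: cD. Qed.
Lemma hmulA : associative hmul.
Proof.
by move=> x y z; apply: subvs_inj; rewrite !val_hmul comp_assoc //; apply: subvsP.
Qed.
Lemma hmul1 : left_id hone hmul.
Proof. by move=> x; apply: subvs_inj; rewrite val_hmul val_hone omul1x. Qed.
Lemma hmulr1 : right_id hone hmul.
Proof. by move=> x; apply: subvs_inj; rewrite val_hmul val_hone omulx1. Qed.
Lemma hvalD (x y : quatH) : vsval (x + y) = vsval x + vsval y. Proof. by []. Qed.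
Lemma hvalZ a (x : quatH) : vsval (a *: x) = a *: vsval x. Proof. by []. Qed.
Lemma hvalN (x : quatH) : vsval (- x) = - vsval x. Proof. by []. Qed.
Lemma hval0 : vsval (0 : quatH) = 0. Proof. by []. Qed.
Lemma hmulDl : left_distributive hmul +%R.
Proof. by move=> x y z; apply: subvs_inj; rewrite hvalD !val_hmul hvalD omulDl. Qed.
Lemma hmulDr : right_distributive hmul +%R.
Proof. by move=> x y z; apply: subvs_inj; rewrite hvalD !val_hmul hvalD omulDr. Qed.
Lemma hone_neq0 : hone != 0.
Proof.
by apply: contraNneq (oone_neq0 C) => /(congr1 vsval); rewrite val_hone linear0 => ->.
Qed.
HB.instance Definition _ := GRing.Zmodule_isNzRing.Build quatH hmulA hmul1 hmulr1 hmulDl hmulDr hone_neq0.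
Lemma hscaleAl (a : k) (u v : quatH) : a *: (u * v) = (a *: u) * v.
Proof. by apply: subvs_inj; rewrite hvalZ !val_hmul hvalZ omulZl. Qed.
HB.instance Definition _ := GRing.Lmodule_isLalgebra.Build k quatH hscaleAl.
Lemma hscaleAr (a : k) (u v : quatH) : a *: (u * v) = u * (a *: v).
Proof. by apply: subvs_inj; rewrite hvalZ !val_hmul hvalZ omulZr. Qed.
HB.instance Definition _ := GRing.Lalgebra_isAlgebra.Build k quatH hscaleAr.

Implicit Types x y z c q al be : quatH.
Definition hN x := N (vsval x).
Definition hb x y := b (vsval x) (vsval y).
Definition hconj x : quatH := vsproj D (conjo (vsval x)).
Lemma val_hconj x : vsval (hconj x) = conjo (vsval x).
Proof. by rewrite vsprojK // comp_conj // subvsP. Qed.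
Lemma valM x y : vsval (x * y) = vsval x ** vsval y. Proof. exact: val_hmul. Qed.
Lemma val1 : vsval (1 : quatH) = e. Proof. exact: val_hone. Qed.
Lemma hmulV x : x * hconj x = hN x *: 1.
Proof. by apply: subvs_inj; rewrite valM val_hconj omulxV hvalZ val1. Qed.
Lemma hVmul x : hconj x * x = hN x *: 1.
Proof. by apply: subvs_inj; rewrite valM val_hconj omulVx hvalZ val1. Qed.
Lemma hNM x y : hN (x * y) = hN x * hN y.
Proof. by rewrite /hN valM onormM. Qed.
Lemma hconjM x y : hconj (x * y) = hconj y * hconj x.
Proof. by apply: subvs_inj; rewrite valM !val_hconj valM conjoM. Qed.
Lemma hconj_pure x : pure (vsval x) -> hconj x = - x.
Proof. by move=> H; apply: subvs_inj; rewrite val_hconj hvalN pure_conj. Qed.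
Lemma hpure_sq x : pure (vsval x) -> x * x = - hN x *: 1.
Proof. by move=> H; apply: subvs_inj; rewrite valM pure_sq // hvalZ val1. Qed.
Lemma hb_conj x y : hconj x * y + hconj y * x = hb x y *: 1.
Proof.
apply: subvs_inj; rewrite hvalD hvalZ !valM !val_hconj val1.
have := omul_linl (conjo (vsval x)) (conjo (vsval y)) e.
by rewrite !conjoK !omulx1 bilf_conj.
Qed.
Lemma hpure_comm al c : pure (vsval al) -> hb al c = 0 -> al * c = hconj c * al.
Proof.
move=> P H; have := hb_conj al c; rewrite H scale0r hconj_pure // mulNr => /eqP.
by rewrite addrC subr_eq0 => /eqP.
Qed.

Lemma exists_ij : exists i j : quatH, [/\ pure (vsval i), pure (vsval j), hb i j = 0, hN i != 0 &
  hN j != 0] /\ D = quat (vsval i) (vsval j).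
Proof.
have [eB MB nB] := cD.
have N1 : N e != 0 by rewrite onorm1 oner_eq0.
have [||u [uB /in_orth_line Pu Nu]] := exists_aniso (nondeg_line two0 N1) nB.
- by apply/subvP=> _ /vlineP [a ->]; rewrite memvZ.
- by rewrite dim_vline dD ltnS (leq_trans (leq_b1 _)).
have nL : nondeg <<[:: e; u]>>%VS by apply: nondeg_pair; rewrite // bilfC.
have sL : (<<[:: e; u]>> <= D)%VS.
  by apply/span_subvP=> x; rewrite !inE => /orP [] /eqP ->.
have [|v [vB vL Nv]] := exists_aniso nL nB sL.
  by rewrite dD ltnS (leq_trans (dim_span _)).
have Pv : pure v by apply: in_orth_span vL; rewrite !inE eqxx.
have uv : b u v = 0 by rewrite bilfC; apply: in_orth_span vL; rewrite !inE eqxx orbT.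
have dsc := quat_perp_disc two0 uv Nu Nv.
exists (vsproj D u), (vsproj D v); rewrite /hb /hN !vsprojK //; split=> //.
apply/esym/eqP; rewrite eqEdim (quat_sub cD uB vB) dD.
by rewrite (quat_dim Pu Pv dsc).
Qed.

(** * Skolem-Noether for the restriction of [t] to [D] *)

Section Stable.
Variable t : oaut C.
Hypothesis tD : forall x : C, x \in D -> t x \in D.

Definition tau x : quatH := vsproj D (t (vsval x)).
Lemma val_tau x : vsval (tau x) = t (vsval x).
Proof. by rewrite vsprojK // tD // subvsP. Qed.
Lemma tauM x y : tau (x * y) = tau x * tau y.
Proof. by apply: subvs_inj; rewrite valM !val_tau valM oautM. Qed.
Lemma tauN x : tau (- x) = - tau x.
Proof. by apply: subvs_inj; rewrite val_tau !hvalN linearN val_tau. Qed.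
Lemma hN_tau x : hN (tau x) = hN x.
Proof. by rewrite /hN val_tau oaut_norm. Qed.
Lemma pure_tau x : pure (vsval x) -> pure (vsval (tau x)).
Proof. by rewrite val_tau; apply: oaut_pure. Qed.
Lemma tau_surj y : exists x, y = tau x.
Proof.
pose f := (t : 'End(C)); have fD : (f @: D)%VS = D.
  apply/eqP; rewrite eqEdim limg_dim_eq ?leqnn ?andbT; last first.
    by apply/eqP; rewrite -subv0 (eqP (oaut_lker0 t)) capvSr.
  by apply/subvP=> _ /memv_imgP [x xD ->]; apply: tD.
have : vsval y \in (f @: D)%VS by rewrite fD subvsP.
move=> /memv_imgP [x xD E].
by exists (vsproj D x); apply: subvs_inj; rewrite val_tau vsprojK.
Qed.

(** An explicit Skolem-Noether argument. For an orthogonal pair [i], [j], the map sending [z] to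
    [N i z - tau i z i] lands in the solutions of [tau i z = z i], and its analogue for [j]
    preserves them because [tau i] and [tau j] anticommute. *)
Lemma intertwiner : exists2 c, c != 0 & forall x, tau x * c = c * x.
Proof.
have [i [j [[Pi Pj ij Ni Nj] ED]]] := exists_ij.
have ii := hpure_sq Pi; have jj := hpure_sq Pj.
have ji : j * i = - (i * j) by rewrite (hpure_comm Pj) ?hconj_pure ?mulNr // /hb bilfC.
have ti := hpure_sq (pure_tau Pi); have tj := hpure_sq (pure_tau Pj).
rewrite !hN_tau in ti tj.
have tji : tau j * tau i = - (tau i * tau j).
  by rewrite -!tauM ji tauN.
have cancel x : x * i = 0 -> x = 0.
  move=> H; have : x * i * i = 0 by rewrite H mul0r.
  rewrite -mulrA ii -scalerAr mulr1 => /eqP; rewrite scaler_eq0 oppr_eq0 (negPf Ni).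
  by move/eqP.
have [z1 z10 z1i] : exists2 z, z != 0 & tau i * z = z * i.
  pose A z := hN i *: z - tau i * z * i.
  have Ai z : tau i * A z = A z * i.
    rewrite /A mulrBr mulrBl -scalerAr -scalerAl -(mulrA _ i i) ii !mulrA ti.
    by rewrite -!scalerAl -!scalerAr mul1r mulr1 !scaleNr !opprK addrC.
  (* If the image of 1 is zero then [tau i = - i], and the image of [j] is [2 N i j], which is
     nonzero. *)
  have [A1|A1] := eqVneq (A 1) 0; last by exists (A 1).
  have tij : tau i = - i.
    move/eqP: A1; rewrite /A mulr1 subr_eq0 => /eqP /(congr1 ( *%R^~ i)).
    rewrite -scalerAl mul1r -mulrA ii -scalerAr mulr1 scaleNr => /eqP.
    rewrite -scalerN => /eqP /(scalerI Ni) E.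
    by rewrite [in RHS]E opprK.
  exists (A j) => //; have -> : A j = 2%:R *: (hN i *: j).
    rewrite /A tij !mulNr opprK -mulrA ji mulrN mulrA ii -scalerAl mul1r scaleNr opprK.
    by rewrite scaler_nat mulr2n.
  rewrite !scaler_eq0 (negPf two0) (negPf Ni) /=.
  by apply: contraNneq Nj => ->; rewrite /hN hval0 onorm0.
pose B z := hN j *: z - tau j * z * j.
have Bj z : tau j * B z = B z * j.
  rewrite /B mulrBr mulrBl -scalerAr -scalerAl -(mulrA _ j j) jj !mulrA tj.
  by rewrite -!scalerAl -!scalerAr mul1r mulr1 !scaleNr !opprK addrC.
have Bi : tau i * B z1 = B z1 * i.
  rewrite /B mulrBr mulrBl -scalerAr -scalerAl z1i.
  have -> : tau i * (tau j * z1 * j) = - (tau j * (tau i * z1) * j).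
    by rewrite !mulrA tji !mulNr opprK.
  by rewrite z1i -!mulrA ji !mulrN opprK.
have gen c : tau i * c = c * i -> tau j * c = c * j -> forall x, tau x * c = c * x.
  move=> ci cj x; have : vsval x \in quat (vsval i) (vsval j) by rewrite -ED subvsP.
  move=> /span4P [p [q [r [s E]]]].
  have -> : x = p *: 1 + q *: i + r *: j + s *: (i * j).
    by apply: subvs_inj; rewrite !hvalD !hvalZ val1 valM.
  have t1 : tau 1 = 1 by apply: subvs_inj; rewrite val_tau val1 oaut1.
  have tZ a y : tau (a *: y) = a *: tau y.
    by apply: subvs_inj; rewrite val_tau !hvalZ linearZ val_tau.
  have tD' y y' : tau (y + y') = tau y + tau y'.
    by apply: subvs_inj; rewrite val_tau !hvalD linearD !val_tau.
  rewrite !tD' !tZ t1 tauM !mulrDl !mulrDr -!scalerAl -!scalerAr mul1r mulr1 ci cj.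
  by rewrite -(mulrA (tau i)) cj !mulrA ci.
have [B0|B0] := eqVneq (B z1) 0; last first.
  by exists (B z1) => //; apply: gen.
have tjz : tau j * z1 = - (z1 * j).
  move/eqP: B0; rewrite subr_eq0 => /eqP /(congr1 ( *%R^~ j)).
  rewrite -scalerAl -mulrA jj -scalerAr mulr1 scaleNr => /eqP.
  by rewrite -scalerN => /eqP /(scalerI Nj) ->; rewrite opprK.
(* When the second projection kills [z1], it solves the [j] equation with the wrong sign; a factor
   [i] commutes with [i], anticommutes with [j], and repairs the sign. *)
exists (z1 * i); first by apply: contraNneq z10 => /cancel ->.
apply: gen; first by rewrite mulrA z1i.
by rewrite mulrA tjz mulNr -!mulrA ji mulrN opprK.
Qed.
(** Needed because [D] may be split. If [N c = 0], surjectivity of [tau] gives [hconj c * y * c = 0]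
    for all [y]. Trace 0 then puts [c] in the radical of [b] on [D]; otherwise all pure elements act
    on [c] by scalars, impossible for the anticommuting invertible [i] and [j]. *)
Lemma intertwiner_unit c : c != 0 -> (forall x, tau x * c = c * x) -> hN c != 0.
Proof.
move=> c0 Hc; apply/eqP => Nc.
have cyc y : hconj c * y * c = 0.
  have [x ->] := tau_surj y.
  by rewrite -mulrA Hc mulrA hVmul Nc scale0r mul0r.
have cc : c * c = b (vsval c) e *: c.
  by apply: subvs_inj; rewrite valM hvalZ sq_eq -/(hN c) Nc scale0r subr0.
have key y : hb c y *: c = b (vsval c) e *: (hconj y * c).
  have := hb_conj c y => /(congr1 ( *%R^~ c)); rewrite mulrDl cyc add0r -mulrA cc.
  by rewrite -scalerAr -scalerAl mul1r.
have [tr0|tr0] := eqVneq (b (vsval c) e) 0.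
  have [_ _ nD] := cD; have : vsval c = 0.
    apply: nD; rewrite ?subvsP // => y yD; have := key (vsproj D y).
    rewrite tr0 scale0r => /eqP; rewrite scaler_eq0 (negPf c0) orbF /hb vsprojK //.
    by move/eqP.
  by move/eqP; rewrite -hval0 => /eqP/subvs_inj/eqP; rewrite (negPf c0).
have [i [j [[Pi Pj ij Ni Nj] _]]] := exists_ij.
have sc y : pure (vsval y) -> exists l : k, y * c = l *: c.
  move=> Py; exists (- ((b (vsval c) e)^-1 * hb c y)).
  have := key y; rewrite hconj_pure // mulNr scalerN => /(congr1 -%R); rewrite opprK.
  by move=> H; rewrite scaleNr -scalerA -scalerN H scalerA mulVf // scale1r.
have [l Hl] := sc _ Pi; have [m Hm] := sc _ Pj.
have nz y l' : pure (vsval y) -> hN y != 0 -> y * c = l' *: c -> l' != 0.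
  move=> Py Ny Hy; apply: contraNneq Ny => l0.
  have : y * y * c = 0 by rewrite -mulrA Hy l0 scale0r mulr0.
  rewrite hpure_sq // -scalerAl mul1r => /eqP; rewrite scaler_eq0 (negPf c0) orbF oppr_eq0.
  by [].
have : i * (j * c) + j * (i * c) = 0.
  rewrite !mulrA -mulrDl (hpure_comm Pj); last by rewrite /hb bilfC.
  by rewrite hconj_pure // mulNr subrr mul0r.
rewrite Hl Hm -!scalerAr Hl Hm !scalerA (mulrC m) -mulr2n -scaler_nat scalerA => /eqP.
rewrite !scaler_eq0 (negPf c0) !mulf_eq0 (negPf two0) (negPf (nz _ _ Pi Ni Hl)).
by rewrite (negPf (nz _ _ Pj Nj Hm)).
Qed.
End Stable.

Lemma orth_vector c q : exists n, [/\ n != 0, pure (vsval n), hb n c = 0 & hb n q = 0].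
Proof.
pose X := [:: e; vsval c; vsval q].
have d : (0 < \dim (D :&: orthv <<X>>))%N.
  have := dimv_sum_cap D (orthv <<X>>%VS); have := dim_orthv <<X>>%VS.
  have := dim_span X; have := dimvS (subvf (D + orthv <<X>>)%VS).
  rewrite odim dD /= => H1 H2 H3 H4; move: H1 H2 H3 H4.
  by case: (\dim (D :&: _)) => //; rewrite addn0; lia.
have : vpick (D :&: orthv <<X>>)%VS != 0 by rewrite vpick0 -dimv_eq0 -lt0n.
have := memv_pick (D :&: orthv <<X>>)%VS; rewrite memv_cap => /andP [].
set n := vpick _ => nD nX n0; exists (vsproj D n); rewrite /hb vsprojK //; split.
- by apply: contraNneq n0 => H; rewrite -(vsprojK nD) H hval0.
- by apply: in_orth_span nX; rewrite !inE eqxx.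
- by apply: in_orth_span nX; rewrite !inE eqxx orbT.
- by apply: in_orth_span nX; rewrite !inE eqxx !orbT.
Qed.

(* An isotropic pure [n] spans, together with some pure [m], a hyperbolic plane, whose
   orthogonal complement among the pure elements is spanned by [v0] of norm [-1]. *)
Lemma orth_norm_m1 n c : n != 0 -> pure (vsval n) -> hN n = 0 -> hb n c = 0 ->
  exists al, [/\ pure (vsval al), hb al c = 0 & hN al = -1].
Proof.
move=> n0 Pn Nn nc; have [eD _ nD] := cD.
pose n' := vsval n.
have [m [mD Pm nm]] : exists m : C, [/\ m \in D, pure m & b n' m = 1].
  have [m mD nm] : exists2 m : C, m \in D & b n' m != 0.
    apply: contrapT => H; case/eqP: n0; apply: subvs_inj; rewrite hval0.
    apply: nD; rewrite ?subvsP // => y yD; apply/eqP; apply: contra_notT H => H.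
    by exists y.
  pose m' := m - (2%:R^-1 * b m e) *: e.
  have nm' : b n' m' = b n' m by rewrite /m' !bilfE Pn mulr0 oppr0 addr0.
  have Pm' : pure m'.
    by rewrite /pure /m' !bilfE bilfxx onorm1 mulr1 mulrAC mulVf // mul1r subrr.
  exists ((b n' m)^-1 *: m'); split; rewrite ?memvZ ?memvB ?memvZ //.
    by rewrite /pure bilfZl Pm' mulr0.
  by rewrite bilfZr nm' mulVf.
pose v0 := 2%:R *: (n' ** m) + e.
have tr : b (n' ** m) e = -1 by rewrite bilf1M pure_conj // bilfNr nm.
have Pv : pure v0.
  by rewrite /pure /v0 !bilfE tr bilfxx onorm1; ring.
have Nv : N v0 = -1.
  by rewrite /v0 onormD onormZ onormM onorm1 bilfZl tr -/(hN n) Nn; ring.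
have vn : b v0 n' = 0.
  by rewrite /v0 !bilfE -{2}[n']omulx1 bilf_mull [b e n']bilfC Pn -/(hN n) Nn; ring.
have vm : b v0 m = 0.
  by rewrite /v0 !bilfE -{2}[m]omul1x bilf_mulr [b e m]bilfC Pn Pm; ring.
have v0D : v0 \in D.
  by rewrite memvD // memvZ //; have [_ MD _] := cD; apply: MD; rewrite ?subvsP.
clearbody v0.
have [vc|vc] := eqVneq (b v0 (vsval c)) 0.
  by exists (vsproj D v0); rewrite /hb /hN vsprojK.
pose s := - b m (vsval c) / b v0 (vsval c); pose p := s ^+ 2 - 1 - N m.
pose al := p *: n' + m + s *: v0.
have alD : al \in D by rewrite !memvD ?memvZ ?subvsP.
exists (vsproj D al); rewrite /hb /hN vsprojK // /al; split.
- by rewrite /pure !bilfE Pn Pm Pv; ring.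
- by rewrite !bilfE -/(hb n c) nc /s; field.
- rewrite !onormD !onormZ !bilfE [b n' v0]bilfC [b m v0]bilfC vm vn nm Nv -/(hN n) Nn /p; ring.
Qed.

(** Dimension 4 leaves a nonzero [n] orthogonal to 1, [c] and [q]. If it is anisotropic it serves
    twice; if not, the norm -1 is available on both sides. Equal norms are required so that the map
    built from [al] and [be] is multiplicative. *)
Lemma exists_al_be c q : exists al be, [/\ pure (vsval al), pure (vsval be), hb al c = 0,
  hb be q = 0 & hN al = hN be /\ hN al != 0].
Proof.
have [n [n0 Pn nc nq]] := orth_vector c q.
have [Nn|Nn] := eqVneq (hN n) 0; last by exists n, n.
have [al [Pal alc Nal]] := orth_norm_m1 n0 Pn Nn nc.
have [be [Pbe beq Nbe]] := orth_norm_m1 n0 Pn Nn nq.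
by exists al, be; rewrite Nal Nbe oppr_eq0 oner_eq0.
Qed.

Lemma h_sq al c : pure (vsval al) -> hb al c = 0 -> al * c * (al * c) = - (hN al * hN c) *: 1.
Proof.
move=> P H; rewrite {2}(hpure_comm P H) mulrA -(mulrA al) hmulV -scalerAr mulr1 -scalerAl.
by rewrite hpure_sq // scalerA mulrN mulrC.
Qed.

(** * An involution of the double built from [al] and [be] *)

Section Construction.
Variables (a : C) (al be : quatH).
Hypotheses (aD : a \in orthv D) (Na : N a != 0) (Pal : pure (vsval al)) (Pbe : pure (vsval be)).
Hypotheses (Nab : hN al = hN be) (Nal : hN al != 0).

Let nu := hN al.
(** Since [al * al = - nu *: 1], the factor [- nu^-1 *: al] is the inverse of [al]: [sD] is
    conjugation by [al], and [sO] sends [x] to [be * x * al^-1]. This is the shape of any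
    automorphism stabilizing [D], with [be = p * al] and [p] of norm 1. *)
Let sD x : quatH := - nu^-1 *: (al * x * al).
Let sO x : quatH := - nu^-1 *: (be * x * al).

Lemma hdec (w : C) : exists x y : quatH, w = vsval x + vsval y ** a.
Proof.
have [x [y [xD yD ->]]] := double_exists w cD aD Na dD.
by exists (vsproj D x), (vsproj D y); rewrite !vsprojK.
Qed.

Lemma hdouble_mul x y x' y' :
  (vsval x + vsval y ** a) ** (vsval x' + vsval y' ** a) =
  vsval (x * x' - N a *: (hconj y' * y)) + vsval (y' * x + y * hconj x') ** a.
Proof.
rewrite !hvalD hvalN hvalZ !valM !val_hconj !omulE.
rewrite (double_mul12 cD aD) ?subvsP // (double_mul21 cD aD) ?subvsP //.
rewrite (double_mul22 cD aD) ?subvsP //.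
by apply: bilf_inj => w; rewrite !bilfE; ring.
Qed.

Lemma hpair_eq x y x' y' : x = x' -> y = y' ->
  vsval x + vsval y ** a = vsval x' + vsval y' ** a.
Proof. by move=> -> ->. Qed.

Lemma ex_s : exists s : 'End(C), forall x y,
  s (vsval x + vsval y ** a) = vsval (sD x) + vsval (sO y) ** a.
Proof.
have [_ _ nD] := cD; have cap : (D :&: orthv D = 0)%VS.
  apply/eqP; rewrite -subv0; apply/subvP=> w; rewrite memv_cap memv0.
  by move=> /andP [wD /orthvP H]; apply/eqP/nD.
pose pr := daddv_pi D (orthv D).
have prE x y : pr (vsval x + vsval y ** a) = vsval x.
  rewrite linearD /= (daddv_pi_id cap) ?subvsP //.
  have := @daddv_pi_add _ _ D (orthv D) (vsval y ** a) cap.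
  have yo := comp_orth_mull cD (subvsP y) aD.
  rewrite nondeg_split // memvf => /(_ isT).
  rewrite (daddv_pi_id (U := orthv D)) // 1?capvC // -[RHS]add0r => /addIr ->.
  by rewrite addr0.
(* The coefficient [y] of [y ** a] is recovered from the component orthogonal to [D] by multiplying
   with [conjo a] and dividing by [N a]. *)
pose f w := - nu^-1 *: (vsval al ** pr w ** vsval al) +
  - nu^-1 *: (vsval be ** ((N a)^-1 *: ((w - pr w) ** conjo a)) ** vsval al ** a).
have [|s Hs] := @ex_linfun _ _ f.
  move=> c x y; rewrite /f linearP /=; apply: bilf_inj => w.
  by rewrite !(omulE, bilfE); ring.
exists s => x y; rewrite Hs /f prE addrC (addrC _ (_ ** a)) addrK omulKr scalerA mulVf //.
by rewrite scale1r /sD /sO !hvalZ !valM omulZl addrC.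
Qed.

Let nuV : - nu^-1 * - nu^-1 * (- nu) = - nu^-1.
Proof. by rewrite /nu; field. Qed.

Let sq_al : al * al = - nu *: 1. Proof. exact: hpure_sq. Qed.
Let sq_be : be * be = - nu *: 1. Proof. by rewrite hpure_sq // /nu Nab. Qed.

Let sDM x y : sD (x * y) = sD x * sD y.
Proof.
rewrite /sD -scalerAl -scalerAr scalerA !mulrA -(mulrA _ al al) sq_al.
by rewrite -scalerAr mulr1 -!scalerAl scalerA nuV.
Qed.
Let sD_conj x : hconj (sD x) = sD (hconj x).
Proof.
have cZ d y : hconj (d *: y) = d *: hconj y.
  by apply: subvs_inj; rewrite hvalZ !val_hconj hvalZ conjoZ.
by rewrite /sD cZ !hconjM hconj_pure // !mulNr !mulrN opprK mulrA.
Qed.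
Let sO_sq x y : hconj (sO x) * sO y = sD (hconj x * y).
Proof.
have cZ d z : hconj (d *: z) = d *: hconj z.
  by apply: subvs_inj; rewrite hvalZ !val_hconj hvalZ conjoZ.
have -> : hconj (sO x) = - nu^-1 *: (al * hconj x * be).
  by rewrite /sO cZ !hconjM (hconj_pure Pal) (hconj_pure Pbe) mulrN mulrNN mulrA.
rewrite /sO /sD -scalerAl -scalerAr scalerA !mulrA -(mulrA _ be be) sq_be.
by rewrite -scalerAr mulr1 -!scalerAl scalerA nuV.
Qed.
Let sO_mul x y : sO x * sD y = sO (x * y).
Proof.
rewrite /sO /sD -scalerAl -scalerAr scalerA !mulrA -(mulrA _ al al) sq_al.
by rewrite -scalerAr mulr1 -!scalerAl scalerA nuV.
Qed.

Let nu2 : - nu^-1 * (- nu^-1 * (- nu * - nu)) = 1.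
Proof. by rewrite /nu; field. Qed.

Lemma ex_involution : exists s : oaut C, (forall x : C, s (s x) = x) /\
  forall x y, s (vsval x + vsval y ** a) = vsval (sD x) + vsval (sO y) ** a.
Proof.
have [s Hs] := ex_s.
have ss w : s (s w) = w.
  have [x [y ->]] := hdec w; rewrite !Hs; apply: hpair_eq.
    rewrite /sD -!scalerAr -!scalerAl !mulrA sq_al -!scalerAl mul1r -!mulrA sq_al.
    by rewrite -!scalerAr mulr1 !scalerA -!mulrA nu2 scale1r.
  rewrite /sO -!scalerAr -!scalerAl !mulrA sq_be -!scalerAl mul1r -!mulrA sq_al.
  by rewrite -!scalerAr mulr1 !scalerA -!mulrA nu2 scale1r.
have so : is_oaut s.
  split; first by exists s.
    have -> : e = vsval (1 : quatH) + vsval (0 : quatH) ** a.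
      by rewrite val1 hval0 omul0l addr0.
    rewrite Hs; apply: hpair_eq.
      by rewrite /sD mulr1 sq_al scalerA mulrNN mulVf // scale1r.
    by rewrite /sO mulr0 mul0r scaler0.
  move=> w w'; have [x [y ->]] := hdec w; have [x' [y' ->]] := hdec w'.
  rewrite hdouble_mul !Hs hdouble_mul; apply: hpair_eq.
    rewrite -sDM sO_sq /sD mulrBr mulrBl scalerBr; congr (_ - _).
    by rewrite -scalerAr -scalerAl !scalerA mulrC.
  by rewrite sD_conj !sO_mul /sO mulrDr mulrDl scalerDr.
by exists (OAut (introT (asboolP _) so)).
Qed.
End Construction.

(** On [D], [t] is conjugation by [c], and on [D ** a] it is [y] to [q * y * c^-1]. Applying [s t]
    twice multiplies on the left by [(al * c)^2] or [(be * q)^2] and on the right by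
    [(hconj c * al)^2], up to a scalar. The orthogonality conditions make all three squares the same
    scalar, and the factors cancel. *)
Theorem stable_quaternion_strongly_real (t : oaut C) :
  (forall x : C, x \in D -> t x \in D) -> strongly_real t.
Proof.
move=> tD; have [c c0 Hc] := intertwiner tD; have Nc := intertwiner_unit tD c0 Hc.
have [a aD Na] := exists_orth; have [_ _ nD] := cD.
have taD : t a \in orthv D.
  apply/orthvP=> y yD; have [x Hx] := tau_surj tD (vsproj D y).
  by rewrite -(vsprojK yD) Hx val_tau // oaut_bilf (orthvP _ _ aD) ?subvsP.
have [p tap] : exists p : quatH, t a = vsval p ** a.
  have [y [p E]] := hdec aD Na (t a); exists p; rewrite E.
  suff -> : vsval y = 0 by rewrite add0r.
  apply: nD; rewrite ?subvsP // => z zD.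
  have -> : vsval y = t a - vsval p ** a by rewrite E addrK.
  by rewrite bilfDl bilfNl (orthvP _ _ taD) // (orthvP _ _ (comp_orth_mull cD (subvsP p) aD)) // subr0.
have Np : hN p = 1 by apply: (mulIf Na); rewrite mul1r -onormM -tap oaut_norm.
pose q := p * c; have [al [be [Pal Pbe alc beq [Nab Nal]]]] := exists_al_be c q.
have [s [ss Hs]] := ex_involution aD Na Pal Pbe Nab Nal.
apply: (@strongly_real_of k C s) => // w.
have tauE x : tau t x = (hN c)^-1 *: (c * x * hconj c).
  by rewrite -Hc -mulrA hmulV -scalerAr mulr1 scalerA mulVf // scale1r.
have tE x y : t (vsval x + vsval y ** a) =
    vsval ((hN c)^-1 *: (c * x * hconj c)) + vsval ((hN c)^-1 *: (q * y * hconj c)) ** a.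
  have -> : (hN c)^-1 *: (q * y * hconj c) = p * tau t y.
    by rewrite tauE -scalerAr /q !mulrA.
  rewrite -tauE valM !(val_tau tD); have -> : forall u v : C, t (u + v) = t u + t v.
    by move=> u v; rewrite linearD.
  rewrite oautM tap; congr (_ + _).
  by rewrite (double_mul12 cD aD) ?subvsP // tD // subvsP.
have ca : hconj c * al * (hconj c * al) = - (hN al * hN c) *: 1.
  by rewrite -(hpure_comm Pal alc) h_sq.
have Nq : hN q = hN c by rewrite hNM Np mul1r.
have nn : (- (hN al)^-1 * (hN c)^-1 * (- (hN al)^-1 * (hN c)^-1)) *
    (- (hN al * hN c) * - (hN al * hN c)) = 1 by field; rewrite Nal Nc.
have [x [y ->]] := hdec aD Na w; rewrite !(tE, Hs); apply: hpair_eq.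
  rewrite !(=^~ scalerAr, =^~ scalerAl) !scalerA.
  have -> : al * (c * (al * (c * x * hconj c) * al) * hconj c) * al =
     (al * c * (al * c)) * x * (hconj c * al * (hconj c * al)) by rewrite !mulrA.
  rewrite h_sq // ca -!scalerAr -!scalerAl !mulr1 !mul1r !scalerA.
  rewrite -[RHS]scale1r -nn; congr (_ *: _); ring.
rewrite !(=^~ scalerAr, =^~ scalerAl) !scalerA.
have -> : be * (q * (be * (q * y * hconj c) * al) * hconj c) * al =
   (be * q * (be * q)) * y * (hconj c * al * (hconj c * al)) by rewrite !mulrA.
rewrite h_sq // ca -!scalerAr -!scalerAl !mulr1 !mul1r !scalerA -Nab Nq.
rewrite -[RHS]scale1r -nn; congr (_ *: _); ring.
Qed.
End StableQuaternion.

(** * The Hermitian structure orthogonal to an anisotropic pure vector *)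

Section Hermitian.
Variables (k : fieldType) (C : octonionType k).
Hypothesis two0 : (2%:R : k) != 0.
Local Notation "x ** y" := (omul x y) (at level 40, left associativity).
Local Notation N := (@onorm k C).
Local Notation b := (@bilf k C).
Local Notation e := (@oone k C).
Variable u : C.
Hypotheses (Pu : pure u) (Nu : N u != 0).
Implicit Types (x y z w v : C) (t g c : oaut C).

(** With [L] spanned by [e] and [u], left multiplication by [u] makes this space an [L]-module of
    rank 3. As [u] acts by a skew map, [b x y] and [b (u ** x) y] are, up to factors, the two
    components of a Hermitian form. *)
Definition inW x := pure x /\ b x u = 0.

Lemma uu x : u ** (u ** x) = - N u *: x. Proof. exact: pureKl. Qed.
Lemma bu x y : b (u ** x) y = - b x (u ** y).
Proof. by rewrite bilf_adjl pure_conj // omulNl bilfNr. Qed.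
Lemma inW_u x : inW x -> inW (u ** x).
Proof.
move=> [Px xu]; split; first by rewrite /pure bilf1M pure_conj // bilfNr bilfC xu oppr0.
by rewrite -{2}(omulx1 u) bilf_mull Px mulr0.
Qed.
Lemma inW_lin a x y : inW x -> inW y -> inW (a *: x + y).
Proof.
by move=> [Px xu] [Py yu]; split; rewrite /pure bilfPl ?Px ?Py ?xu ?yu; ring.
Qed.
Lemma inWD x y : inW x -> inW y -> inW (x + y).
Proof. by move=> Hx Hy; rewrite -(scale1r x); apply: inW_lin. Qed.
Lemma inW0 : inW 0. Proof. by split; rewrite /pure bilf0l. Qed.
Lemma inWZ a x : inW x -> inW (a *: x).
Proof. by move=> Hx; rewrite -[_ *: _]addr0; apply: inW_lin => //; apply: inW0. Qed.
Lemma inWN x : inW x -> inW (- x).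
Proof. by rewrite -scaleN1r; apply: inWZ. Qed.
Lemma inWB x y : inW x -> inW y -> inW (x - y).
Proof. by move=> Hx Hy; apply: inWD => //; apply: inWN. Qed.

Lemma W_dec x : exists p q w, inW w /\ x = p *: e + q *: u + w.
Proof.
pose p := b x e / 2%:R; pose q := b x u / (2%:R * N u).
exists p, q, (x - p *: e - q *: u); split; last first.
  by apply: bilf_inj => w; rewrite !bilfE; ring.
split; rewrite /pure !bilfE !bilfxx ?onorm1 ?[b e u]bilfC Pu /p /q; field; rewrite ?two0 ?Nu //.
Qed.
Lemma W_inj x y : inW x -> inW y -> (forall w, inW w -> b x w = b y w) -> x = y.
Proof.
move=> [Px xu] [Py yu] H; apply: bilf_inj => w; have [p [q [w' [Hw ->]]]] := W_dec w.
by rewrite !bilfE Px Py xu yu H.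
Qed.

Lemma W_anti x y : inW x -> inW y -> x ** y = - (y ** x) - b x y *: e.
Proof. by move=> [Px _] [Py _]; apply: pure_anti. Qed.
Lemma W_right x : inW x -> x ** u = - (u ** x).
Proof. by move=> [Px xu]; rewrite pure_anti // xu scale0r subr0. Qed.
Lemma W_mulr x y : inW x -> x ** (u ** y) = - (u ** (x ** y)).
Proof. by move=> [Px xu]; rewrite pure_linl // xu scale0r subr0. Qed.
Lemma W_mull x y : inW x -> inW y -> (u ** x) ** y = (x ** y) ** u.
Proof.
move=> Hx [Py yu]; have [Px xu] := Hx.
have := pure_linr x Pu Py; rewrite bilfC yu scale0r subr0 (W_right Hx) omulNl.
by move/oppr_inj.
Qed.
(** The factor [u] may be carried by any argument: [phi] restricted to [inW] is the trace of an
    [L]-trilinear alternating form. *)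
Lemma phi_bal3 x y z : inW x -> inW y -> inW z -> phi (u ** x) y z = phi x y (u ** z).
Proof.
move=> Hx Hy Hz; rewrite /phi W_mull // bilf_adjr (pure_conj Pu) omulNr (W_right Hz).
by rewrite opprK.
Qed.
Lemma phi_bal x y z : inW x -> inW y -> inW z -> phi (u ** x) y z = phi x (u ** y) z.
Proof.
by move=> Hx Hy Hz; rewrite phi_bal3 // /phi W_mulr // bilfNl bu opprK.
Qed.

Definition Lbasis e1 e2 e3 := [/\ inW e1, inW e2, inW e3 & forall w, inW w ->
  exists a1 a2 a3 b1 b2 b3, w = a1 *: e1 + a2 *: e2 + a3 *: e3 +
    b1 *: (u ** e1) + b2 *: (u ** e2) + b3 *: (u ** e3)].

Definition trilin (F : C -> C -> C -> k) :=
  [/\ forall a x x' y z, F (a *: x + x') y z = a * F x y z + F x' y z,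
      forall a x y y' z, F x (a *: y + y') z = a * F x y z + F x y' z &
      forall a x y z z', F x y (a *: z + z') = a * F x y z + F x y z'].

(* [F] is the [k]-valued trace of an alternating [L]-trilinear form on the rank-3 [L]-module [inW],
   where [L] is spanned by [e] and [u]; its values on a basis determine it. *)
Lemma alt3_zero (F : C -> C -> C -> k) e1 e2 e3 : trilin F ->
  (forall x y z, inW x -> inW y -> inW z -> F x y z = - F y x z) ->
  (forall x y z, inW x -> inW y -> inW z -> F x y z = - F x z y) ->
  (forall x y z, inW x -> inW y -> inW z -> F (u ** x) y z = F x (u ** y) z) ->
  Lbasis e1 e2 e3 -> F e1 e2 e3 = 0 -> F (u ** e1) e2 e3 = 0 ->
  forall x y z, inW x -> inW y -> inW z -> F x y z = 0.
Proof.
move=> [F1 F2 F3] A12 A23 bal [H1 H2 H3 span] Z1 Z2.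
pose Z x y z := F x y z = 0 /\ F (u ** x) y z = 0.
have S12 x y z : inW x -> inW y -> inW z -> Z x y z -> Z y x z.
  move=> Hx Hy Hz [Za Zb]; split; first by rewrite A12 // Za oppr0.
  by rewrite A12 ?bal -?bal ?Zb ?oppr0 //; apply: inW_u.
have S23 x y z : inW x -> inW y -> inW z -> Z x y z -> Z x z y.
  move=> Hx Hy Hz [Za Zb]; split; first by rewrite A23 // Za oppr0.
  by rewrite A23 ?Zb ?oppr0 //; apply: inW_u.
have two_inj a : a = - a -> a = 0 :> k.
  by move=> H; apply: (lcombm1 2%:R 1 two0 H); ring.
have Zxx x z : inW x -> inW z -> Z x x z.
  move=> Hx Hz; split; apply: two_inj; first exact: A12.
  by rewrite {1}bal // A12 //; apply: inW_u.
have lin y z x : (forall w, w \in [:: e1; e2; e3] -> Z w y z) -> inW x -> Z x y z.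
  move=> H /span [a1 [a2 [a3 [b1 [b2 [b3 ->]]]]]].
  have ZD w w' : Z w y z -> Z w' y z -> Z (w + w') y z.
    move=> [Z3 Z4] [Z5 Z6]; rewrite -(scale1r w); split; rewrite ?omulE ?scale1r.
      by rewrite -(scale1r w) F1 Z3 Z5; ring.
    by rewrite -(scale1r (u ** w)) F1 Z4 Z6; ring.
  have F0 : F 0 y z = 0.
    by have := F1 (-1) 0 0 y z; rewrite scaler0 addr0 => ->; ring.
  have ZZ a w : Z w y z -> Z (a *: w) y z.
    move=> [Z3 Z4]; split; rewrite ?omulE.
      by rewrite -[_ *: _]addr0 F1 Z3 F0; ring.
    by rewrite -[_ *: _]addr0 F1 Z4 F0; ring.
  have Zu w : Z w y z -> Z (u ** w) y z.
    move=> Zw; have [Z3 Z4] := Zw; split=> //; rewrite uu.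
    by have [] := ZZ (- N u) _ Zw.
  have I1 : Z e1 y z by apply: H; rewrite !inE eqxx.
  have I2 : Z e2 y z by apply: H; rewrite !inE eqxx orbT.
  have I3 : Z e3 y z by apply: H; rewrite !inE eqxx !orbT.
  do 3![apply: (ZD); last by apply: ZZ; apply: Zu].
  by do 2![apply: (ZD); last by apply: ZZ]; apply: ZZ.
have inWe w : w \in [:: e1; e2; e3] -> inW w.
  by rewrite !inE => /or3P [] /eqP ->.
have Z0 : Z e1 e2 e3 by [].
have Zb : forall w1 w2 w3, w1 \in [:: e1; e2; e3] -> w2 \in [:: e1; e2; e3] ->
    w3 \in [:: e1; e2; e3] -> Z w1 w2 w3.
  have Zxyx x y : inW x -> inW y -> Z x y x by move=> Hx Hy; apply: (S23) => //; apply: Zxx.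
  have Zyxx x y : inW x -> inW y -> Z y x x by move=> Hx Hy; apply: (S12) => //; apply: Zxyx.
  move=> w1 w2 w3; rewrite !inE => /or3P [] /eqP -> /or3P [] /eqP -> /or3P [] /eqP ->;
    try (by apply: Zxx); try (by apply: Zxyx); try (by apply: Zyxx).
  - by [].
  - exact: S23.
  - exact: S12.
  - by apply: (S23) => //; apply: (S12).
  - by apply: (S12) => //; apply: (S23).
  - by apply: (S12) => //; apply: (S23) => //; apply: (S12).
have Zc x w2 w3 : inW x -> w2 \in [:: e1; e2; e3] -> w3 \in [:: e1; e2; e3] -> Z x w2 w3.
  by move=> Hx H2' H3'; apply: lin => // w Hw; apply: Zb.
have Zd x y w3 : inW x -> inW y -> w3 \in [:: e1; e2; e3] -> Z x y w3.
  move=> Hx Hy H3'; apply: (S12) => //; first exact: inWe.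
  by apply: lin => // w Hw; apply: (S12) => //; try exact: inWe; apply: Zc.
move=> x y z Hx Hy Hz; suff [] : Z z x y; last first.
  by apply: lin => // w Hw; apply: (S12) => //; try exact: inWe; apply: (S23) => //; try exact: inWe; apply: Zd.
by move=> H _; rewrite A23 // A12 // H !oppr0.
Qed.

(** Doubling the quaternion algebra of [u] and [w1] by [w2] gives the basis; the coordinate [- s']
    in the witness is the sign in [(u ** w1) ** w2 = - (u ** (w1 ** w2))]. *)
Lemma exists_Lbasis : exists w1 w2, [/\ Lbasis w1 w2 (w1 ** w2), N w1 != 0, N w2 != 0,
  b w1 w2 = 0 & b (u ** w1) w2 = 0 ] /\ w2 \in orthv (quat u w1).
Proof.
have N1 : N e != 0 by rewrite onorm1 oner_eq0.
have nL : nondeg <<[:: e; u]>>%VS by apply: nondeg_pair; rewrite // bilfC.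
have nf : nondeg (C := C) fullv.
  by move=> x _ H; apply: bilf_inj => w; rewrite bilf0l H ?memvf.
have [||w1 [_ w1L Nw1]] := exists_aniso nL nf; rewrite ?subvf ?odim //.
  by rewrite (leq_ltn_trans (dim_span _)).
have P1 : pure w1 by apply: in_orth_span w1L; rewrite !inE eqxx.
have uw1 : b u w1 = 0 by rewrite bilfC; apply: in_orth_span w1L; rewrite !inE eqxx orbT.
have dsc := quat_perp_disc two0 uw1 Nu Nw1.
have cD := quat_comp Pu P1 dsc; have dD := quat_dim Pu P1 dsc.
have [_ _ nD] := cD.
have [||w2 [_ w2D Nw2]] := exists_aniso nD nf; rewrite ?subvf ?odim ?dD //.
have inD x : x \in [:: e; u; w1; u ** w1] -> b w2 x = 0.
  by move=> H; apply: in_orth_span w2D.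
exists w1, w2; split=> //; split=> //; last 2 first.
- by rewrite bilfC inD // !inE eqxx !orbT.
- by rewrite bilfC inD // !inE eqxx !orbT.
have W1 : inW w1 by split; rewrite // bilfC.
have W2 : inW w2 by split; rewrite /pure inD // !inE eqxx ?orbT.
have w12D : w1 ** w2 \in orthv (quat u w1) by apply: comp_orth_mull => //; apply: mem_quat2.
have W3 : inW (w1 ** w2).
  split; first by apply: (in_orth_span _ w12D); rewrite !inE eqxx.
  by apply: (in_orth_span _ w12D); rewrite !inE eqxx orbT.
split=> // w [Pw wu].
have [y [z [/span4P [p [q [r [s ->]]]] /span4P [p' [q' [r' [s' ->]]]] E]]] := double_exists w cD w2D Nw2 dD.
have E3 : (u ** w1) ** w2 = - (u ** (w1 ** w2)) by rewrite W_mull // W_right.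
have W4 := inW_u W1; have W5 := inW_u W2; have W6 := inW_u W3.
have p0 : p = 0.
  move: Pw; rewrite /pure E !omulE E3 !bilfE bilfxx onorm1 Pu.
  rewrite (proj1 W1) (proj1 W2) (proj1 W3) (proj1 W4) (proj1 W5) (proj1 W6) => H.
  by apply: (lcombm1 2%:R 1 two0 H); ring.
have q0 : q = 0.
  move: wu; rewrite /pure E !omulE E3 !bilfE bilfxx [b e u]bilfC Pu.
  rewrite (proj2 W1) (proj2 W2) (proj2 W3) (proj2 W4) (proj2 W5) (proj2 W6) => H.
  by apply: (lcombm1 (2%:R * N u) 1 _ H); rewrite ?mulf_neq0 //; ring.
exists r, p', r', s, q', (- s'); rewrite E p0 q0 !omulE E3.
by apply: bilf_inj => v; rewrite !bilfE; ring.
Qed.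

(** On a top-degree alternating form this operation is multiplication by the trace of [c] over [L];
    below, [al + be u] is that trace. *)
Definition ttr c x y z := phi (c x) y z + phi x (c y) z + phi x y (c z).

Lemma inW_aut c x : c u = u -> inW x -> inW (c x).
Proof. by move=> cu [Px xu]; split; [apply: oaut_pure | rewrite -cu oaut_bilf]. Qed.
Lemma aut_u c x : c u = u -> c (u ** x) = u ** c x.
Proof. by move=> cu; rewrite oautM cu. Qed.
Lemma aut_uV c : c u = u -> (c^-1)%g u = u.
Proof. by move=> cu; rewrite -{1}cu oautK. Qed.

Lemma phi_trilin : trilin (@phi k C).
Proof. by split=> *; rewrite /phi ?omulE !bilfE. Qed.

Lemma trace_eq c al be w1 w2 w3 : c u = u -> Lbasis w1 w2 w3 ->
  ttr c w1 w2 w3 = al * phi w1 w2 w3 + be * phi (u ** w1) w2 w3 ->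
  ttr c (u ** w1) w2 w3 = al * phi (u ** w1) w2 w3 - be * N u * phi w1 w2 w3 ->
  forall x y z, inW x -> inW y -> inW z ->
  ttr c x y z = al * phi x y z + be * phi (u ** x) y z.
Proof.
move=> cu Lb T1 T2 x y z Hx Hy Hz.
pose F x y z := ttr c x y z - al * phi x y z - be * phi (u ** x) y z.
suff : F x y z = 0 by move=> H; apply: (lcomb1 1 H); rewrite /F; ring.
have Wc v : inW v -> inW (c v) by apply: inW_aut.
have Wu v : inW v -> inW (u ** v) by apply: inW_u.
have p12 v v' w : inW v -> inW v' -> inW w -> phi v v' w = - phi v' v w.
  by move=> [? _] [? _] [? _]; apply: phi_swap12.
have p23 v v' w : inW v -> phi v v' w = - phi v w v' by move=> [? _]; apply: phi_swap23.
apply: (alt3_zero _ _ _ _ Lb) => //; rewrite /F /ttr.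
- have cP a v w : c (a *: v + w) = a *: c v + c w by rewrite linearP.
  by split=> *; rewrite /phi ?cP ?omulE !bilfE; ring.
- move=> v v' w Hv Hv' Hw; rewrite (p12 (c v)) ?(p12 v (c v')) ?(p12 v v') ?(p12 (u ** v) v') //; try by auto.
  by rewrite (phi_bal Hv' Hv Hw); ring.
- move=> v v' w Hv Hv' Hw; rewrite (p23 (c v)) ?(p23 v (c v')) ?(p23 v v') ?(p23 (u ** v) v') //; try by auto.
  ring.
- move=> v v' w Hv Hv' Hw; rewrite !(aut_u _ cu) !phi_bal; auto.
- by move: T1; rewrite /ttr => ->; ring.
- by move: T2; rewrite /ttr => ->; rewrite uu /phi omulZl bilfZl; ring.
Qed.

(** The trace is read off on a basis where [phi w1 w2 w3 = 2 N w1 N w2] and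
    [phi (u ** w1) w2 w3 = 0]. The inverse of [c] is its Hermitian adjoint, whence the conjugate
    trace and the sign of [be]. *)
Lemma trace_exists c : c u = u -> exists al be,
  (forall x y z, inW x -> inW y -> inW z ->
     ttr c x y z = al * phi x y z + be * phi (u ** x) y z) /\
  (forall x y z, inW x -> inW y -> inW z ->
     ttr (c^-1)%g x y z = al * phi x y z - be * phi (u ** x) y z).
Proof.
move=> cu; have [w1 [w2 [[Lb N1 N2 w12 uw12] _]]] := exists_Lbasis.
have [W1 W2 W3 _] := Lb; set w3 := w1 ** w2 in Lb W3.
have cVu := aut_uV cu.
have W1u := inW_u W1; have W2u := inW_u W2.
have f1 : phi w1 w2 w3 = 2%:R * (N w1 * N w2) by rewrite /phi -/w3 bilfxx onormM.
have f2 : phi (u ** w1) w2 w3 = 0.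
  by rewrite /phi bilf_mulr -{2}[w1]omul1x bilf_mulr Pu mul0r mul0r.
have T1 (d : oaut C) : d u = u -> ttr d w1 w2 w3 = N w2 * b (d w1) w1 + N w1 * b (d w2) w2 + b w3 (d w3).
  move=> du; rewrite /ttr /phi bilf_mulr bilf_mull -/w3; ring.
have T2 (d : oaut C) : d u = u -> ttr d (u ** w1) w2 w3 =
    N w2 * b (d (u ** w1)) w1 + N w1 * b (u ** d w2) w2 + b w3 (u ** d w3).
  move=> du; rewrite /ttr (phi_bal W1 (inW_aut du W2) W3) (phi_bal3 W1 W2 (inW_aut du W3)).
  by rewrite /phi bilf_mulr bilf_mull -/w3; ring.
have nz : N w1 * N w2 != 0 by rewrite mulf_neq0.
have adj x y : b ((c^-1)%g x) y = b x (c y) by rewrite -{1}(oautK c y) oaut_bilf.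
pose al := ttr c w1 w2 w3 / (2%:R * (N w1 * N w2)).
pose be := - ttr c (u ** w1) w2 w3 / (N u * (2%:R * (N w1 * N w2))).
have eal : ttr c w1 w2 w3 = al * (2%:R * (N w1 * N w2)).
  by rewrite /al mulfVK // mulf_neq0.
have ebe : ttr c (u ** w1) w2 w3 = - be * N u * (2%:R * (N w1 * N w2)).
  by rewrite /be -mulNr opprK -mulrA mulfVK // !mulf_neq0.
exists al, be; split=> x y z Hx Hy Hz.
  apply: (trace_eq cu Lb) => //; first by rewrite eal f1 f2; ring.
  by rewrite ebe f1 f2; ring.
rewrite -mulNr; apply: (trace_eq cVu Lb) => //.
  rewrite f1 f2 (T1 _ cVu) mulr0 addr0 -eal (T1 _ cu) !adj [b w3 _]bilfC adj.
  by rewrite ![b (c _) _]bilfC.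
rewrite f1 f2 (T2 _ cVu) mulr0 add0r; apply: (lcomb1 (-1) ebe); rewrite (T2 _ cu).
rewrite adj !bu [b w3 (u ** (c^-1)%g _)]bilfC bu.
rewrite !adj !aut_u //.
rewrite (bilfC (u ** c w1)) (bilfC (c w2)) bu.
ring.
Qed.

(** Products of two basis vectors give back, up to nonzero scalars, the three basis vectors, so [v]
    is orthogonal to all of [inW]. *)
Lemma phi_nondeg v : inW v -> (forall y z, inW y -> inW z -> phi v y z = 0) -> v = 0.
Proof.
move=> Hv H; have [w1 [w2 [[[W1 W2 W3 span] N1 N2 w12 _] _]]] := exists_Lbasis.
have rot x y z : inW x -> inW y -> inW z -> phi x y z = phi y z x.
  by move=> [Px _] [Py _] [Pz _]; rewrite (phi_swap12 Px Py Pz) (phi_swap23 _ _ Py) opprK.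
have vE y z : inW y -> inW z -> b (y ** z) v = 0.
  by move=> Hy Hz; rewrite -/(phi _ _ _) -rot // H.
have v3 : b (w1 ** w2) v = 0 by apply: vE.
have E1 : w2 ** (w1 ** w2) = N w2 *: w1.
  by rewrite (W_anti W1 W2) w12 scale0r subr0 omulNr pureKl ?scaleNr ?opprK //; case: W2.
have E2 : w1 ** (w1 ** w2) = - N w1 *: w2 by rewrite pureKl //; case: W1.
have v1 : b w1 v = 0.
  have := vE _ _ W2 W3; rewrite E1 bilfZl => /eqP; rewrite mulf_eq0 (negPf N2).
  by move/eqP.
have v2 : b w2 v = 0.
  have := vE _ _ W1 W3; rewrite E2 bilfZl => /eqP; rewrite mulf_eq0 oppr_eq0 (negPf N1).
  by move/eqP.
have uvE y z : inW y -> inW z -> b (u ** (y ** z)) v = 0.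
  move=> Hy Hz; have -> : u ** (y ** z) = - (y ** (u ** z)) by rewrite W_mulr // opprK.
  by rewrite bilfNl vE ?oppr0 //; apply: inW_u.
have uv1 : b (u ** w1) v = 0.
  have := uvE _ _ W2 W3; rewrite E1 omulZr bilfZl => /eqP; rewrite mulf_eq0 (negPf N2).
  by move/eqP.
have uv2 : b (u ** w2) v = 0.
  have := uvE _ _ W1 W3; rewrite E2 omulZr bilfZl => /eqP; rewrite mulf_eq0 oppr_eq0 (negPf N1).
  by move/eqP.
have uv3 := uvE _ _ W1 W2.
apply: W_inj => //; first exact: inW0.
move=> w /span [a1 [a2 [a3 [b1 [b2 [b3 ->]]]]]]; rewrite bilf0l bilfC.
by rewrite !bilfE v1 v2 v3 uv1 uv2 uv3; ring.
Qed.

(** Subtract the trace identity of [c^-1] at [x] from that of [c] at [c x]: the mixed terms agree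
    because [c] preserves [phi], and nondegeneracy of [phi] leaves the polynomial relation
    multiplied by [c^-1]. *)
Lemma cayley_hamilton c al be : c u = u ->
  (forall x y z, inW x -> inW y -> inW z ->
     ttr c x y z = al * phi x y z + be * phi (u ** x) y z) ->
  (forall x y z, inW x -> inW y -> inW z ->
     ttr (c^-1)%g x y z = al * phi x y z - be * phi (u ** x) y z) ->
  forall x, inW x ->
    c (c (c x)) - al *: c (c x) - be *: (u ** c (c x)) + al *: c x - be *: (u ** c x) - x = 0.
Proof.
move=> cu T T' x Hx; have cVu := aut_uV cu.
pose v := c (c x) - al *: c x - be *: (u ** c x) + al *: x - be *: (u ** x) - (c^-1)%g x.
have Hcx := inW_aut cu Hx; have Hccx := inW_aut cu Hcx; have Hux := inW_u Hx.
have Hucx := inW_u Hcx; have HVx := inW_aut cVu Hx.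
suff v0 : v = 0.
  have := congr1 c v0; rewrite /v linear0 => E; rewrite -[RHS]E.
  by rewrite !(linearB, linearD) /= !linearZ /= !oautM cu oautVK.
apply: phi_nondeg.
  by do ![apply: inWB => // || apply: inWD => // || apply: inWZ => //].
move=> y z Hy Hz; have := T _ _ _ Hcx Hy Hz; have := T' _ _ _ Hx Hy Hz.
rewrite /ttr.
have -> : phi (c x) (c y) z = phi x y ((c^-1)%g z).
  by rewrite -{1}(oautVK c z) oaut_phi.
have -> : phi (c x) y (c z) = phi x ((c^-1)%g y) z.
  by rewrite -{1}(oautVK c y) oaut_phi.
move=> H1 H2; rewrite /v /phi !(omulE, bilfE).
by apply: (lcomb2 (-1) 1 H1 H2); rewrite /phi; ring.
Qed.

Lemma phi_u_neq0 : exists x y z, [/\ inW x, inW y, inW z & phi (u ** x) y z != 0].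
Proof.
have [w1 [w2 [[[W1 W2 W3 span] N1 N2 w12 _] _]]] := exists_Lbasis.
exists (u ** w1), w2, (w1 ** w2); split=> //; first exact: inW_u.
rewrite uu /phi omulZl bilfZl bilfxx onormM !mulf_neq0 ?oppr_eq0 //.
Qed.

(** The characteristic polynomial over [L] has its coefficients in [k]. In this form it has the root
    1, which is what [quadratic] exploits. *)
Definition real_char c := exists al, forall x, inW x ->
  c (c (c x)) = al *: c (c x) - al *: c x + x.

Lemma real_char_be c al : c u = u ->
  (forall x y z, inW x -> inW y -> inW z ->
     ttr c x y z = al * phi x y z + 0 * phi (u ** x) y z) ->
  (forall x y z, inW x -> inW y -> inW z ->
     ttr (c^-1)%g x y z = al * phi x y z - 0 * phi (u ** x) y z) -> real_char c.
Proof.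
move=> cu T T'; exists al => x Hx; have := cayley_hamilton cu T T' Hx.
rewrite !scale0r !subr0 => H; apply: bilf_inj => w; have := congr1 (b^~ w) H.
by rewrite !bilfE => H'; apply: (lcomb1 1 H'); ring.
Qed.

(** An [L]-linear [g] carries [c] to its inverse, so the trace equals its own conjugate. *)
Lemma real_char_linear c g : c u = u -> g u = u -> (forall x, c (g (c x)) = g x) -> real_char c.
Proof.
move=> cu gu rev; have [al [be [T T']]] := trace_exists cu.
have be0 : be = 0.
  have [x [y [z [Hx Hy Hz nz]]]] := phi_u_neq0.
  have cg x' : c (g x') = g ((c^-1)%g x') by rewrite -[in RHS]rev oautVK.
  have := T _ _ _ (inW_aut gu Hx) (inW_aut gu Hy) (inW_aut gu Hz); have := T' _ _ _ Hx Hy Hz.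
  rewrite -(aut_u _ gu) /ttr !cg !oaut_phi => -> H.
  apply: (lcombm1 (2%:R * phi (u ** x) y z) (-1) _ H); rewrite ?mulf_neq0 //; ring.
by subst be; apply: (real_char_be cu T T').
Qed.

(** Here [g] conjugates scalars of [L] but commutes with [c], so again the trace equals its
    conjugate. *)
Lemma real_char_semilinear c g : c u = u -> g u = - u -> (forall x, c (g x) = g (c x)) ->
  real_char c.
Proof.
move=> cu gu cg; have [al [be [T T']]] := trace_exists cu.
have be0 : be = 0.
  have [x [y [z [Hx Hy Hz nz]]]] := phi_u_neq0.
  have gW v : inW v -> inW (g v).
    move=> [Pv vu]; split; first exact: oaut_pure.
    by rewrite -[u]opprK -gu bilfNr oaut_bilf vu oppr0.
  have gu' v : u ** g v = - g (u ** v) by rewrite oautM gu omulNl opprK.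
  have := T _ _ _ (gW _ Hx) (gW _ Hy) (gW _ Hz); have := T _ _ _ Hx Hy Hz.
  rewrite gu' /ttr !cg /phi omulNl bilfNl -!/(phi _ _ _) !oaut_phi => -> H.
  apply: (lcombm1 (2%:R * phi (u ** x) y z) 1 _ H); rewrite ?mulf_neq0 //; ring.
by subst be; apply: (real_char_be cu T T').
Qed.

Lemma real_char_fixed c x : c u = u -> inW x -> x != 0 -> c x = x -> real_char c.
Proof.
move=> cu Hx x0 cx; have [al [be [T T']]] := trace_exists cu.
have be0 : be = 0.
  have := cayley_hamilton cu T T' Hx; rewrite !cx => H.
  have : (2%:R * be) *: (u ** x) = 0.
    rewrite -[RHS]oppr0 -[in RHS]H; apply: bilf_inj => w; rewrite !bilfE; ring.
  move/eqP; rewrite scaler_eq0 mulf_eq0 (negPf two0) /= => /orP [/eqP //|/eqP ux].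
  by case/eqP: x0; apply: onorm_eq0_mul ux Nu.
by subst be; apply: (real_char_be cu T T').
Qed.

(** * Automorphisms whose only fixed vectors lie in [L] *)

Section FixedL.
Variable c : oaut C.
Hypotheses (cu : c u = u) (rc : real_char c).
Hypothesis fixL : forall x, c x = x -> exists p q, x = p *: e + q *: u.

Lemma fixL_W x : inW x -> c x = x -> x = 0.
Proof.
move=> [Px xu] /fixL [p [q E]]; move: Px xu.
rewrite E /pure !bilfE !bilfxx onorm1 Pu [b e u]bilfC Pu => H1 H2.
have -> : p = 0 by apply: (lcombm1 2%:R 1 two0 H1); ring.
have -> : q = 0 by apply: (lcombm1 (2%:R * N u) 1 _ H2); rewrite ?mulf_neq0 //; ring.
by rewrite !scale0r addr0.
Qed.

(** [X^3 - al X^2 + al X - 1 = (X - 1)(X^2 + (1 - al) X + 1)], and [c - 1] is injective on [inW]. *)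
Lemma quadratic : exists sg, forall x, inW x -> c (c x) = sg *: c x - x.
Proof.
have [al H] := rc; exists (al - 1) => x Hx.
have Hcx := inW_aut cu Hx; have Hccx := inW_aut cu Hcx.
have : c (c x) + (1 - al) *: c x + x = 0.
  apply: fixL_W; first by do ![apply: inWD => // || apply: inWZ => //].
  rewrite !linearD linearZ /= (H x Hx).
  by apply: bilf_inj => w; rewrite !bilfE; ring.
move=> E; apply: bilf_inj => w; have := congr1 (b^~ w) E.
by rewrite !bilfE => H'; apply: (lcomb1 1 H'); ring.
Qed.

(** By the quadratic relation, [c] fixes [x ** c z - c x ** z]. *)
Lemma exchange x z : inW x -> inW z -> exists p q, x ** c z - c x ** z = p *: e + q *: u.
Proof.
move=> Hx Hz; have [sg H] := quadratic; apply: fixL.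
rewrite linearB /= !oautM (H x Hx) (H z Hz) !omulE.
by apply: bilf_inj => w; rewrite !bilfE; ring.
Qed.

(** For [z = x], anticommutation turns [exchange] into the membership of [x ** c x] in [L];
    multiplying by [x] on the left recovers [c x]. *)
Lemma Lscalar x : inW x -> N x != 0 -> exists a d, c x = a *: x + d *: (u ** x).
Proof.
move=> Hx Nx; have [p [q E]] := exchange Hx Hx; have Hcx := inW_aut cu Hx.
have xx : x ** (x ** c x) = - N x *: c x by apply: pureKl; case: Hx.
have E2 : 2%:R *: (x ** c x) = (p - b (c x) x) *: e + q *: u.
  move: E; rewrite (W_anti Hcx Hx) => E; apply: bilf_inj => w; have := congr1 (b^~ w) E.
  by rewrite !bilfE => H'; apply: (lcomb1 1 H'); ring.
exists (- (p - b (c x) x) / (2%:R * N x)), (q / (2%:R * N x)).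
have := congr1 (omul x) E2; rewrite !omulE xx (W_right Hx) => E3.
apply: bilf_inj => w; have := congr1 (b^~ w) E3; rewrite !bilfE => E4.
by apply: (lcombm1 (2%:R * N x) (-1) _ E4); rewrite ?mulf_neq0 //; field; rewrite Nx.
Qed.
End FixedL.
End Hermitian.

(** * Elements that are not unipotent *)

Section NonUnipotent.
Variables (k : fieldType) (C : octonionType k).
Hypothesis two0 : (2%:R : k) != 0.
Local Notation "x ** y" := (omul x y) (at level 40, left associativity).
Local Notation N := (@onorm k C).
Local Notation b := (@bilf k C).
Local Notation e := (@oone k C).
Implicit Types (x y z w v u : C) (t g c s : oaut C).

Lemma oautN t x : t (- x) = - t x. Proof. exact: linearN. Qed.
Lemma oautD t x y : t (x + y) = t x + t y. Proof. exact: linearD. Qed.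
Lemma oautB t x y : t (x - y) = t x - t y. Proof. exact: linearB. Qed.
Lemma oautZ t a x : t (a *: x) = a *: t x. Proof. exact: linearZ. Qed.

(** Were only [L] fixed, [g ^+ 2] would act on an orthogonal basis by a single scalar [a1 + d1 u] of
    [L]. Commuting with the semilinear [g] forces [d1 = 0], the norm gives [a1 ^+ 2 = 1], and the
    product [w1 ** w2] gives [a1 = a1 ^+ 2]; so [w1] is fixed, a contradiction. *)
Lemma semilinear_square_fixed u g : pure u -> N u != 0 -> g u = - u ->
  ~ (forall x, g (g x) = x -> exists p q, x = p *: e + q *: u).
Proof.
move=> Pu Nu gu fixL; pose c := (g * g)%g; have cE x : c x = g (g x) by rewrite oaut_comp.
have cu : c u = u by rewrite cE gu oautN gu opprK.
have rc : real_char u c by apply: (real_char_semilinear two0 Pu Nu cu gu) => x; rewrite !cE.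
have fixc x : c x = x -> exists p q, x = p *: e + q *: u by rewrite cE; apply: fixL.
have [w1 [w2 [[[W1 W2 W3 span] N1 N2 w12 uw12] w2D]]] := exists_Lbasis two0 Pu Nu.
set w3 := w1 ** w2 in W3 span.
have N3 : N w3 != 0 by rewrite onormM mulf_neq0.
have [a1 [d1 E1]] := Lscalar two0 Pu Nu cu rc fixc W1 N1.
have [a2 [d2 E2]] := Lscalar two0 Pu Nu cu rc fixc W2 N2.
have [a3 [d3 E3]] := Lscalar two0 Pu Nu cu rc fixc W3 N3.
(* The [L]-scalars by which [c] acts on two orthogonal vectors agree by [exchange]. *)
have same x z a d a' d' : inW u x -> inW u z -> N x != 0 -> N z != 0 ->
    c x = a *: x + d *: (u ** x) -> c z = a' *: z + d' *: (u ** z) ->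
    inW u (x ** z) -> a = a' /\ d = d'.
  move=> Hx Hz Nx Nz Ex Ez Hxz.
  have [p [q E]] := exchange two0 Pu Nu cu rc fixc Hx Hz.
  have uxz : (u ** x) ** z = - (u ** (x ** z)) by rewrite (W_mull Pu) // (W_right Pu).
  have E' : (a' - a) *: (x ** z) + (d - d') *: (u ** (x ** z)) = p *: e + q *: u.
    rewrite -E Ex Ez !omulE (W_mulr Pu _ Hx) uxz.
    by apply: bilf_inj => w; rewrite !bilfE; ring.
  have [Px xu] := Hxz; have [Pux uxu] := inW_u Hxz.
  have Nxz : N (x ** z) != 0 by rewrite onormM mulf_neq0.
  have uxx : b (u ** (x ** z)) (x ** z) = 0.
    by rewrite -{2}[x ** z]omul1x bilf_mulr Pu mul0r.
  have := congr1 (b^~ (x ** z)) E'; have := congr1 (b^~ (u ** (x ** z))) E'.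
  rewrite !bilfE [b (x ** z) (u ** _)]bilfC uxx !bilfxx ![b e _]bilfC ![b u _]bilfC.
  rewrite Px xu Pux uxu onormM => H1 H2.
  have dd : d = d' by apply: (lcombm1 (2%:R * (N u * N (x ** z))) 1 _ H1); rewrite ?mulf_neq0 //; ring.
  have aa : a = a' by apply: (lcombm1 (2%:R * N (x ** z)) (-1) _ H2); rewrite ?mulf_neq0 //; ring.
  by [].
have [a12 d12] := same _ _ _ _ _ _ W1 W2 N1 N2 E1 E2 W3.
have W13 : inW u (w1 ** w3).
  by rewrite pureKl; [apply: inWZ | case: W1].
have [a13 d13] := same _ _ _ _ _ _ W1 W3 N1 N3 E1 E3 W13.
subst a2 d2 a3 d3.
have cW x : inW u x -> c x = a1 *: x + d1 *: (u ** x).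
  move=> /span [p1 [p2 [p3 [q1 [q2 [q3 ->]]]]]].
  rewrite !(oautD, oautZ) !(oautM c u) cu E1 E2 E3 !omulE.
  by apply: bilf_inj => w; rewrite !bilfE; ring.
have d0 : d1 = 0.
  have gW : inW u (g w1).
    have [P1 u1] := W1; split; first exact: oaut_pure.
    by rewrite -[u]opprK -gu bilfNr oaut_bilf u1 oppr0.
  have : c (g w1) = g (c w1) by rewrite !cE.
  rewrite (cW _ gW) E1 oautD !oautZ oautM gu omulNl scalerN => /addrI H.
  have : (2%:R * d1) *: (u ** g w1) = 0.
    apply: bilf_inj => w; have := congr1 (b^~ w) H; rewrite !bilfE => H'.
    by apply: (lcomb1 1 H'); ring.
  move/eqP; rewrite scaler_eq0 mulf_eq0 (negPf two0) /= => /orP [/eqP //|/eqP H0].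
  have := onorm_eq0_mul H0 Nu => g0; case/eqP: N1.
  by rewrite -(oaut_norm g) g0 onorm0.
move: E1 E2 E3; rewrite d0 !scale0r !addr0 => E1 E2 E3.
have a1sq : a1 ^+ 2 = 1.
  by apply: (mulIf N1); rewrite mul1r -onormZ -E1 oaut_norm.
have a1E : a1 = 1.
  have := E3; rewrite /w3 oautM E1 E2 !omulE scalerA -expr2 a1sq scale1r -/w3 => H.
  apply: (mulIf (_ : 2%:R * N w3 != 0)); first by rewrite mulf_neq0.
  by have := congr1 (b^~ w3) H; rewrite bilfZl bilfxx mul1r.
have := fixL_W two0 Pu Nu fixc W1; rewrite E1 a1E scale1r => /(_ erefl) w10.
by case/eqP: N1; rewrite w10 onorm0.
Qed.

Lemma pure_dim2 (B : {vspace C}) x : e \in B -> x \in B -> pure x -> x != 0 -> (1 < \dim B)%N.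
Proof.
move=> eB xB Px x0; rewrite ltnNge; apply/negP => dB.
have sB : (<[e]> <= B)%VS by rewrite -memvE.
have : x \in <[e]>%VS.
  suff <- : B = <[e]>%VS by [].
  by apply/esym/eqP; rewrite eqEdim sB dim_vline oone_neq0.
case/vlineP=> a E; move: Px; rewrite E /pure bilfZl bilfxx onorm1 mulr1 => /eqP.
by rewrite mulf_eq0 (negPf two0) orbF => /eqP a0; case/eqP: x0; rewrite E a0 scale0r.
Qed.

Lemma dim_pure : \dim (orthv <[e]>%VS : {vspace C}) = 7.
Proof. by have := dim_orthv (<[e]>%VS : {vspace C}); rewrite dim_vline oone_neq0; lia. Qed.

Lemma pureP x : pure x <-> x \in orthv <[e]>%VS.
Proof.
split=> [Px|/in_orth_line //]; apply/orthvP=> _ /vlineP [a ->].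
by rewrite bilfZr Px mulr0.
Qed.

(** The skew map [g - g^-1] has a kernel on a space of dimension 7, and [g x = g^-1 x] means that
    [g ^+ 2] fixes [x]. *)
Lemma square_fixes_pure g : exists x, [/\ pure x, x != 0 & g (g x) = x].
Proof.
have [||| x [/pureP Px x0 H]] := @skew_odd k C two0 (fun x => g x - (g^-1)%g x) (orthv <[e]>%VS).
- move=> a x y; rewrite !linearP /=.
  by apply: bilf_inj => w; rewrite !bilfE; ring.
- move=> x y; rewrite !bilfE oaut_bilfV -[b ((g^-1)%g x) y](oaut_bilf g) oautVK; ring.
- by rewrite dim_pure.
exists x; split=> //; suff /eqP : g x - (g^-1)%g x = 0.
  by rewrite subr_eq0 => /eqP ->; rewrite oautVK.
apply: bilf_inj => w; rewrite bilf0l.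
have -> : w = (2%:R^-1 * b w e) *: e + (w - (2%:R^-1 * b w e) *: e).
  by rewrite addrC subrK.
rewrite bilfDr bilfZr [b _ (w - _)]bilfC H; last first.
  by apply/pureP; rewrite /pure !bilfE bilfxx onorm1; field.
have [Pg Pg'] := (oaut_pure g Px, oaut_pure (g^-1)%g Px).
by rewrite !bilfE Pg Pg'; ring.
Qed.

Lemma stable_line u s : pure u -> N u != 0 -> s u \in <<[:: e; u]>>%VS -> s u = u \/ s u = - u.
Proof.
move=> Pu Nu; rewrite !span_cons span_nil addv0.
move=> /memv_addP [_ /vlineP [p ->] [_ /vlineP [q ->] E]].
have p0 : p = 0.
  have := oaut_pure s Pu; rewrite /pure E !bilfE bilfxx onorm1 Pu => H.
  by apply: (lcombm1 2%:R 1 two0 H); ring.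
move: E; rewrite p0 scale0r add0r => E.
have : q ^+ 2 = 1 by apply: (mulIf Nu); rewrite mul1r -onormZ -E oaut_norm.
rewrite E => /eqP; rewrite sqrf_eq1 => /orP [] /eqP ->; first by left; rewrite scale1r.
by right; rewrite scaleN1r.
Qed.

Lemma span2P u x : x \in <<[:: e; u]>>%VS -> exists p q, x = p *: e + q *: u.
Proof.
rewrite !span_cons span_nil addv0.
by move=> /memv_addP [_ /vlineP [p ->] [_ /vlineP [q ->] E]]; exists p, q.
Qed.

Theorem real_strongly_real t g : ~ unipotent t -> (forall x, t (g (t x)) = g x) ->
  strongly_real t.
Proof.
move=> nu rev; pose c := (g * g)%g; have cE x : c x = g (g x) by rewrite oaut_comp.
have tc x : t (c x) = c (t x) by rewrite !cE (real_sq_comm rev).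
have eB : e \in gk c 1 by apply/gk_fix/oaut1.
have [x0 [Px0 x00 gx0]] := square_fixes_pure g.
have x0B : x0 \in gk c 1 by apply: gk_fix; rewrite cE.
have := comp_sub_cases two0 (gk_comp c) (pure_dim2 eB x0B Px0 x00).
case=> [full|d4|[u [Pu Nu EB]]].
- exact: square_unipotent_inverts full _ rev.
- by apply: (stable_quaternion_strongly_real two0 (gk_comp c) d4) => x; apply: gk_stable.
have uB : u \in gk c 1 by rewrite EB memv_span // !inE eqxx orbT.
have fixc x : g (g x) = x -> exists p q, x = p *: e + q *: u.
  by move=> gx; apply: span2P; rewrite -EB; apply: gk_fix; rewrite cE.
have gu : g u = u.
  have [|//|gu] := @stable_line u g Pu Nu; first by rewrite -EB; apply: gk_stable => // y; rewrite !cE.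
  by case: (semilinear_square_fixed Pu Nu gu fixc).
(* If [t u = - u], then [g * t] sends [u] to [- u] and has the same square as [g], because
   [t g t = g]; the argument that excluded [g u = - u] applies to it. *)
have tu : t u = u.
  have [|//|tu] := @stable_line u t Pu Nu; first by rewrite -EB; apply: gk_stable.
  have gtE x : (g * t)%g x = g (t x) by rewrite oaut_comp.
  case: (@semilinear_square_fixed u (g * t)%g Pu Nu); first by rewrite gtE tu oautN gu.
  by move=> x; rewrite !gtE rev; apply: fixc.
have eT : e \in gk t 1 by apply/gk_fix/oaut1.
have uT : u \in gk t 1 by apply: gk_fix.
have u0 : u != 0 by apply: contraNneq Nu => ->; rewrite onorm0.
(* The same trichotomy, now for [t]: only here is the hypothesis that [t] is not unipotent used, to
   exclude the full space. *)
have := comp_sub_cases two0 (gk_comp t) (pure_dim2 eT uT Pu u0).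
case=> [full|d4|[u' [Pu' Nu' ET]]].
- by case: nu; apply/unipotentP.
- by apply: (stable_quaternion_strongly_real two0 (gk_comp t) d4) => x; apply: gk_stable.
have fixt x : t x = x -> exists p q, x = p *: e + q *: u.
  move=> /gk_fix; rewrite ET => /span2P [p [q ->]].
  have := uT; rewrite ET => /span2P [p' [q' E]].
  have p0 : p' = 0.
    move: Pu; rewrite E /pure !bilfE bilfxx onorm1 Pu' => H.
    by apply: (lcombm1 2%:R 1 two0 H); ring.
  move: E; rewrite p0 scale0r add0r => E.
  have q0 : q' != 0 by apply: contraNneq u0 => q0; rewrite E q0 scale0r.
  by exists p, (q / q'); rewrite E scalerA mulfVK.
have rc := real_char_linear two0 Pu Nu tu gu rev.
have [w1 [w2 [[[W1 W2 W3 span] N1 N2 w12 uw12] w2D]]] := exists_Lbasis two0 Pu Nu.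
have [a [d E]] := Lscalar two0 Pu Nu tu rc fixt W1 N1.
have [P1 uw1] := W1; have uw1' : b u w1 = 0 by rewrite bilfC.
have dsc := quat_perp_disc two0 uw1' Nu N1.
apply: (stable_quaternion_strongly_real two0 (quat_comp Pu P1 dsc) (quat_dim Pu P1 dsc)).
apply: quat_stable => //; first by rewrite tu mem_quat1.
have [_ qM _] := quat_comp Pu P1 dsc.
by rewrite E memvD // memvZ ?qM ?mem_quat1 ?mem_quat2.
Qed.

Lemma strongly_real_real t : strongly_real t -> real_elt t.
Proof.
move=> [s1 [s2 [h1 h2 ->]]]; exists s1.
have i1 : (s1 * s1 = 1)%g by rewrite -expg2.
have i2 : (s2 * s2 = 1)%g by rewrite -expg2.
have V1 : (s1^-1 = s1)%g by apply: (mulgI s1); rewrite i1 mulgV.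
have V2 : (s2^-1 = s2)%g by apply: (mulgI s2); rewrite i2 mulgV.
by rewrite invgM V1 V2 !mulgA i1 mul1g.
Qed.

Theorem nonunipotent_real_iff t : ~ unipotent t -> (real_elt t <-> strongly_real t).
Proof.
move=> nu; split=> [[g H]|]; last exact: strongly_real_real.
by apply: (real_strongly_real nu) => x; apply: real_inv H.
Qed.
End NonUnipotent.

(** * Unipotent elements fixing an anisotropic pure vector *)

Section UnipotentHermitian.
Variables (k : fieldType) (C : octonionType k).
Hypothesis two0 : (2%:R : k) != 0.
Local Notation "x ** y" := (omul x y) (at level 40, left associativity).
Local Notation N := (@onorm k C).
Local Notation b := (@bilf k C).
Local Notation e := (@oone k C).
Implicit Types (x y z w v u : C) (t g : oaut C).

(** For pure [x] and [y], the product is determined by its pairing with [e], which [b] gives, and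
    its pairings with pure vectors, which [phi] gives. *)
Lemma oaut_of_form (s : 'End(C)) : s e = e -> (forall x y, b (s x) (s y) = b x y) ->
  (forall x y z, pure x -> pure y -> pure z -> phi (s x) (s y) (s z) = phi x y z) ->
  is_oaut s.
Proof.
move=> s1 sb sphi; have s0 : lker s == 0%VS.
  rewrite -subv0; apply/subvP=> x; rewrite memv_ker memv0 => /eqP sx; apply/eqP.
  by apply: bilf_inj => w; rewrite -sb sx !bilf0l.
have sK := lker0_lfunK s0; have sVK := lker0_lfunVK s0.
split=> //; first by exists (s^-1)%VF.
have dec x : exists p x', pure x' /\ x = p *: e + x'.
  exists (2%:R^-1 * b x e), (x - (2%:R^-1 * b x e) *: e); split; last by rewrite addrC subrK.
  by rewrite /pure !bilfE bilfxx onorm1; field.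
have sP x : pure x -> pure (s x) by rewrite /pure -{2}s1 sb.
have sM x y : pure x -> pure y -> s (x ** y) = s x ** s y.
  move=> Px Py; apply: bilf_inj => w; rewrite -(sVK w).
  have [p [w' [Pw ->]]] := dec ((s^-1)%VF w); rewrite linearD linearZ /= s1 !bilfDr !bilfZr.
  rewrite -{1}s1 !sb -/(phi (s x) (s y) (s w')) sphi //; congr (_ + _); congr (_ * _).
  by rewrite !bilf1M (pure_conj Py) (pure_conj (sP _ Py)) !bilfNr sb.
move=> x y; have [p [x' [Px ->]]] := dec x; have [q [y' [Py ->]]] := dec y.
rewrite !linearD !linearZ /= s1 !omulE !linearD !linearZ /= s1 sM //.
Qed.

Lemma unipotent_ind t (P : C -> Prop) : unipotent t -> P 0 ->
  (forall x, P (t x - x) -> P x) -> forall x, P x.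
Proof.
move=> [m H] P0 Pn x; have := H x; elim: m {H} x => [|m IH] x; first by move=> /= ->.
by rewrite iterSr => /IH/Pn.
Qed.

Section FixedAnisotropic.
Variables (t : oaut C) (u : C).
Hypotheses (tU : unipotent t) (tu : t u = u) (Pu : pure u) (Nu : N u != 0).
Local Notation W := (inW u).

Fact nn_key : unit. Proof. exact: tt. Qed.
Definition nn x := locked_with nn_key (t x - x).
Lemma nnE x : nn x = t x - x. Proof. by rewrite /nn unlock. Qed.
Lemma nnD x y : nn (x + y) = nn x + nn y.
Proof. by rewrite !nnE oautD; apply: bilf_inj => w; rewrite !bilfE; ring. Qed.
Lemma nnZ a x : nn (a *: x) = a *: nn x.
Proof. by rewrite !nnE oautZ; apply: bilf_inj => w; rewrite !bilfE; ring. Qed.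
Lemma nn0 : nn 0 = 0. Proof. by rewrite -(scale0r 0) nnZ !scale0r. Qed.
Lemma tE x : t x = x + nn x. Proof. by rewrite nnE addrC subrK. Qed.
Lemma nnW x : W x -> W (nn x).
Proof. by move=> Hx; rewrite nnE; apply: inWB => //; apply: inW_aut. Qed.
Lemma nnu x : nn (u ** x) = u ** nn x.
Proof. by rewrite !nnE (aut_u _ tu) !omulE. Qed.

(** A unipotent map has a fixed vector in [inW], so its trace is in [k]. In terms of [n = t - 1],
    Cayley-Hamilton reads [n^3 = (al - 3) t n]; if [al] is not 3, nilpotency forces [n] to vanish on
    [inW]. *)
Lemma nilpotent3 x : W x -> nn (nn (nn x)) = 0.
Proof.
have [w1 [w2 [[[W1 W2 W3 span] N1 N2 w12 uw12] w2D]]] := exists_Lbasis two0 Pu Nu.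
have [x0 [Wx0 x00 tx0]] : exists x, [/\ W x, x != 0 & t x = x].
  have : w1 != 0 by apply: contraNneq N1 => ->; rewrite onorm0.
  move: W1; move: w1 {w2 W2 W3 span N1 N2 w12 uw12 w2D}.
  apply: (unipotent_ind tU); first by rewrite eqxx.
  move=> z IH Hz z0; have [E|E] := eqVneq (t z - z) 0; last by apply: (IH _ E); rewrite -nnE; apply: nnW.
  by exists z; split=> //; apply/eqP; rewrite -subr_eq0 E.
have [al H] := real_char_fixed two0 Pu Nu tu Wx0 x00 tx0.
have H3 y : W y -> nn (nn (nn y)) = (al - 3%:R) *: t (nn y).
  move=> Hy; rewrite !nnE !oautB H //.
  by apply: bilf_inj => w; rewrite !bilfE; ring.
move=> Wx; have [a3|a3] := eqVneq (al - 3%:R) 0; first by rewrite H3 // a3 scale0r.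
suff -> : nn x = 0 by rewrite !nn0.
have : nn (nn (nn x)) = (al - 3%:R) *: t (nn x) by apply: H3.
move: (nn x); apply: (unipotent_ind tU) => // y IH Hy.
have ny : nn y = 0.
  rewrite nnE; apply: IH; rewrite -nnE Hy nnZ; congr (_ *: _).
  by rewrite !nnE oautB.
move: Hy; rewrite ny nn0 => /esym/eqP; rewrite scaler_eq0 (negPf a3) /= => /eqP ty.
by apply: (oaut_inj (t := t)); rewrite ty linear0.
Qed.

Lemma tV y : W y -> (t^-1)%g y = y - nn y + nn (nn y).
Proof.
move=> Wy; apply: (oaut_inj (t := t)); rewrite oautVK oautD oautB !tE nilpotent3 //.
by apply: bilf_inj => w; rewrite !bilfE; ring.
Qed.
Lemma nn_adj x y : W y -> b (nn x) y = - b x (nn y) + b x (nn (nn y)).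
Proof.
by move=> Wy; rewrite {1}nnE bilfDl bilfNl oaut_bilfV tV // !bilfE; ring.
Qed.

(** The product [x ** nn x] is fixed because [nn x] squares to zero. Removing its component along
    [u] leaves a fixed anisotropic vector orthogonal to [u], and the two generate a stable
    quaternion subalgebra. *)
Lemma square_zero_case : (forall x, W x -> nn (nn x) = 0) -> (exists2 x, W x & nn x != 0) ->
  strongly_real t.
Proof.
move=> n2 [y0 Wy0 ny0]; have adj x y : W y -> b (nn x) y = - b x (nn y).
  by move=> Wy; rewrite nn_adj // n2 // bilf0r addr0.
have [x Wx Bx] : exists2 x, W x & b x (u ** nn x) != 0.
  apply: contrapT => H; case/eqP: ny0.
  have H0 x : W x -> b x (u ** nn x) = 0.
    by move=> Wx; apply/eqP; apply: contra_notT H => H; exists x.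
  apply: (onorm_eq0_mul _ Nu); apply: (W_inj two0 Pu Nu); [exact/inW_u/nnW | exact: inW0 |].
  move=> w Ww; rewrite bilf0l.
  have := H0 _ (inWD Ww Wy0); rewrite nnD !omulE !bilfE !H0 // !add0r addr0.
  have -> : b y0 (u ** nn w) = b w (u ** nn y0).
    by rewrite [LHS]bilfC -nnu adj // (bu Pu) opprK.
  by move=> H1; rewrite bilfC; apply: (lcombm1 2%:R 1 two0 H1); ring.
have Wn := nnW Wx; pose B := b (x ** nn x) u.
have NB : B != 0.
  apply: contraNneq Bx => B0; rewrite -[b x _]opprK -(bu Pu) bilfC oppr_eq0.
  move: B0; rewrite /B bilf_adjl; case: (Wx) => Px _; rewrite (pure_conj Px) omulNl.
  by rewrite (W_right Pu Wx) opprK => ->.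
have Nn : N (nn x) = 0.
  have := bilfxx (nn x); rewrite adj // n2 // bilf0r oppr0 => /esym/eqP.
  by rewrite mulf_eq0 (negPf two0) => /eqP.
pose y := x ** nn x - (B / (2%:R * N u)) *: u.
have ty : t y = y.
  rewrite /y oautB oautZ tu oautM [t x]tE [t (nn x)]tE n2 // addr0 omulDl.
  by rewrite pure_sq ?Nn ?oppr0 ?scale0r ?addr0 //; case: Wn.
have Pxn : b (x ** nn x) e = 0.
  rewrite bilf1M; case: (Wn) => Pn _; rewrite (pure_conj Pn) bilfNr.
  have := adj x _ Wx; rewrite bilfC => H1.
  by apply: (lcombm1 2%:R (-1) two0 H1); ring.
have Py : pure y by rewrite /pure /y !bilfE Pxn Pu; ring.
have yu : b u y = 0 by rewrite bilfC /y !bilfE bilfxx -/B; field; rewrite ?Nu ?two0.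
have Ny : N y != 0.
  have -> : N y = - (B ^+ 2 / (4%:R * N u)).
    rewrite /y onormD onormN onormZ onormM Nn !bilfE -/B; field.
    by rewrite Nu (_ : 4 = 2 * 2 :> k) ?mulf_neq0 //; ring.
  by rewrite oppr_eq0 !mulf_neq0 ?invr_eq0 ?expf_neq0 ?mulf_neq0 // (_ : 4 = 2 * 2 :> k) ?mulf_neq0 //; ring.
have dsc := quat_perp_disc two0 yu Nu Ny.
apply: (stable_quaternion_strongly_real two0 (quat_comp Pu Py dsc) (quat_dim Pu Py dsc)).
by apply: quat_stable; rewrite // ?tu ?ty ?mem_quat1 ?mem_quat2.
Qed.

Lemma exists_cyclic_vector : (exists2 x, W x & nn (nn x) != 0) ->
  exists v, [/\ W v, b (nn v) (nn v) != 0 & b v (u ** nn v) = 0].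
Proof.
move=> [y0 Wy0 ny0].
have [v Wv Bv] : exists2 v, W v & b (nn v) (nn v) != 0.
  apply: contrapT => H; case/eqP: ny0.
  have H0 x : W x -> b (nn x) (nn x) = 0.
    by move=> Wx; apply/eqP; apply: contra_notT H => H; exists x.
  apply: (W_inj two0 Pu Nu); [exact/nnW/nnW | exact: inW0 |].
  move=> w Ww; rewrite bilf0l.
  have := H0 _ (inWD Ww Wy0); rewrite nnD !bilfE !H0 // !add0r addr0 [b (nn y0) _]bilfC => H1.
  have H2 : b (nn w) (nn y0) = 0 by apply: (lcombm1 2%:R 1 two0 H1); ring.
  move: H2; rewrite nn_adj ?nilpotent3 //; last exact: nnW.
  by rewrite bilf0r addr0 bilfC => /eqP; rewrite oppr_eq0 => /eqP.
(* Replacing [v] by [v + d (u ** nn v)] changes [b v (u ** nn v)] by [2 d N u eta]; [d] is chosen to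
   cancel it. *)
pose eta := b (nn v) (nn v); pose d := - b v (u ** nn v) / (2%:R * (N u * eta)).
have Wn := nnW Wv; have Wnn := nnW Wn; have Wun := inW_u Wn.
have n3 := nilpotent3 Wv.
have E2 : b v (nn (nn v)) = - eta.
  by have := nn_adj v Wn; rewrite n3 bilf0r addr0 -/eta => ->; rewrite opprK.
have E22 : b (nn (nn v)) (nn (nn v)) = 0 by rewrite nn_adj // n3 nn0 !bilf0r oppr0 addr0.
have E12 : b (nn v) (u ** nn (nn v)) = 0.
  by rewrite -nnu nn_adj ?nnu ?n3 ?nn0 ?omul0r ?bilf0r ?oppr0 ?addr0 //; apply: inW_u.
have E12' : b (nn v) (nn (nn v)) = 0.
  by rewrite nn_adj // n3 nn0 !bilf0r oppr0 addr0.
have uu' x y : b (u ** x) (u ** y) = N u * b x y by exact: bilf_mull.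
exists (v + d *: (u ** nn v)); split.
- by apply: inWD => //; apply: inWZ.
- rewrite nnD nnZ nnu !bilfE uu' E12 E22 [b (u ** _) (nn v)]bilfC E12.
  by rewrite (_ : _ + _ = eta) //; rewrite /eta; ring.
rewrite nnD nnZ nnu !(omulE, bilfE) !(uu Pu) !bilfE uu' (bu Pu) E2 E12 -/eta /d; field.
by rewrite Nu Bv two0.
Qed.

(** The [L]-linear map sending [n^i v] to [- (t^-1 - 1)^i v] inverts [t]. Its matrix on the chain
    [v], [e1], [e2] is triangular with diagonal -1, 1, -1, hence of determinant 1, which is why it
    preserves [phi]. *)
Lemma cyclic_case : (exists2 x, W x & nn (nn x) != 0) -> strongly_real t.
Proof.
move=> /exists_cyclic_vector [v [W0 eta0 E01]].
set eta := b (nn v) (nn v) in eta0.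
have W1 := nnW W0; have W2 := nnW W1; have n3 := nilpotent3 W0.
set e1 := nn v in W1 W2 n3 E01 *; set e2 := nn e1 in W2 n3.
have t0 : t v = v + e1 by rewrite tE.
have t1 : t e1 = e1 + e2 by rewrite tE.
have t2 : t e2 = e2 by rewrite tE n3 addr0.
have B11 : b e1 e1 = eta by [].
have B02 : b v e2 = - eta.
  by have := nn_adj v W1; rewrite -/e1 -/e2 n3 bilf0r addr0 B11 => ->; rewrite opprK.
have B22 : b e2 e2 = 0 by rewrite {1}/e2 nn_adj // n3 nn0 !bilf0r oppr0 addr0.
have B12 : b e1 e2 = 0 by rewrite {1}/e1 nn_adj // n3 nn0 !bilf0r oppr0 addr0.
have B01 : b v e1 = - (eta / 2%:R).
  have := nn_adj v W0; rewrite -/e1 -/e2 B02 bilfC => H.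
  by apply: (lcombm1 2%:R 1 two0 H); field.
have D0 : b (u ** v) v = 0 by rewrite -{2}[v]omul1x bilf_mulr Pu mul0r.
have D1 : b (u ** e1) e1 = 0 by rewrite -{2}[e1]omul1x bilf_mulr Pu mul0r.
have D2 : b (u ** e2) e2 = 0 by rewrite -{2}[e2]omul1x bilf_mulr Pu mul0r.
have anti x y : b (u ** x) y = - b (u ** y) x by rewrite (bu Pu) bilfC.
have D01 : b (u ** v) e1 = 0 by rewrite (bu Pu) E01 oppr0.
have D02 : b (u ** v) e2 = 0.
  have := nn_adj (u ** v) W1; rewrite nnu -/e1 D1 -/e2 n3 bilf0r addr0 => /esym/eqP.
  by rewrite oppr_eq0 => /eqP.
have D12 : b (u ** e1) e2 = 0.
  by have := nn_adj (u ** v) W2; rewrite nnu -/e1 n3 nn0 !bilf0r oppr0 addr0.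
have D10 : b (u ** e1) v = 0 by rewrite anti D01 oppr0.
have D20 : b (u ** e2) v = 0 by rewrite anti D02 oppr0.
have D21 : b (u ** e2) e1 = 0 by rewrite anti D12 oppr0.
have Bu x y : b (u ** x) (u ** y) = N u * b x y by exact: bilf_mull.
clearbody e2; clearbody eta; clearbody e1.
have B10 : b e1 v = - (eta / 2%:R) by rewrite bilfC.
have B20 : b e2 v = - eta by rewrite bilfC.
have B21 : b e2 e1 = 0 by rewrite bilfC.
have Bee : b e e = 2%:R by rewrite bilfxx onorm1 mulr1.
have Buu : b u u = 2%:R * N u by rewrite bilfxx.
have Beu : b e u = 0 by rewrite bilfC Pu.
have Bue : b u e = 0 by [].
have Q00 : b v (u ** v) = 0 by rewrite bilfC.
have Q01 : b v (u ** e1) = 0 by rewrite bilfC.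
have Q02 : b v (u ** e2) = 0 by rewrite bilfC.
have Q10 : b e1 (u ** v) = 0 by rewrite bilfC.
have Q11 : b e1 (u ** e1) = 0 by rewrite bilfC.
have Q12 : b e1 (u ** e2) = 0 by rewrite bilfC.
have Q20 : b e2 (u ** v) = 0 by rewrite bilfC.
have Q21 : b e2 (u ** e1) = 0 by rewrite bilfC.
have Q22 : b e2 (u ** e2) = 0 by rewrite bilfC.
have L1a : b v e = 0 by have [] := W0.
have L1b : b v u = 0 by have [] := W0.
have L1c : b e v = 0 by rewrite bilfC.
have L1d : b u v = 0 by rewrite bilfC.
have L2a : b (u ** v) e = 0 by have [] := (inW_u W0).
have L2b : b (u ** v) u = 0 by have [] := (inW_u W0).
have L2c : b e (u ** v) = 0 by rewrite bilfC.
have L2d : b u (u ** v) = 0 by rewrite bilfC.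
have L3a : b e1 e = 0 by have [] := W1.
have L3b : b e1 u = 0 by have [] := W1.
have L3c : b e e1 = 0 by rewrite bilfC.
have L3d : b u e1 = 0 by rewrite bilfC.
have L4a : b (u ** e1) e = 0 by have [] := (inW_u W1).
have L4b : b (u ** e1) u = 0 by have [] := (inW_u W1).
have L4c : b e (u ** e1) = 0 by rewrite bilfC.
have L4d : b u (u ** e1) = 0 by rewrite bilfC.
have L5a : b e2 e = 0 by have [] := W2.
have L5b : b e2 u = 0 by have [] := W2.
have L5c : b e e2 = 0 by rewrite bilfC.
have L5d : b u e2 = 0 by rewrite bilfC.
have L6a : b (u ** e2) e = 0 by have [] := (inW_u W2).
have L6b : b (u ** e2) u = 0 by have [] := (inW_u W2).
have L6c : b e (u ** e2) = 0 by rewrite bilfC.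
have L6d : b u (u ** e2) = 0 by rewrite bilfC.
pose X := [tuple e; u; v; e1; e2; u ** v; u ** e1; u ** e2].
have Nu2 : 2%:R * N u != 0 by rewrite mulf_neq0.
have Nue : N u * eta != 0 by rewrite mulf_neq0.
have sol p q a0 a1 a2 c0 c1 c2 : p *: e + q *: u + a0 *: v + a1 *: e1 + a2 *: e2 +
    c0 *: (u ** v) + c1 *: (u ** e1) + c2 *: (u ** e2) = 0 ->
    [/\ p = 0, q = 0, a0 = 0 & a1 = 0] /\ [/\ a2 = 0, c0 = 0, c1 = 0 & c2 = 0].
  move=> H; have F w : b (p *: e + q *: u + a0 *: v + a1 *: e1 + a2 *: e2 +
    c0 *: (u ** v) + c1 *: (u ** e1) + c2 *: (u ** e2)) w = 0 by rewrite H bilf0l.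
  have p0 : p = 0 by have := F e; rewrite !bilfE !(Bee, Bue, L1a, L3a, L5a, L2a, L4a, L6a) => H1; apply: (lcombm1 2%:R 1 two0 H1); ring.
  have q0 : q = 0 by have := F u; rewrite !bilfE !(Beu, Buu, L1b, L3b, L5b, L2b, L4b, L6b) => H1; apply: (lcombm1 (2%:R * N u) 1 _ H1); rewrite //; ring.
  have a00 : a0 = 0 by have := F e2; rewrite !bilfE !(L5c, L5d, B02, B12, B22, D02, D12, D2) => H1; apply: (lcombm1 eta (-1) _ H1); rewrite //; ring.
  have c00 : c0 = 0 by have := F (u ** e2); rewrite !bilfE !(L6c, L6d, Q02, Q12, Q22, Bu, B02, B12, B22) => H1; apply: (lcombm1 (N u * eta) (-1) _ H1); rewrite //; ring.
  subst a0 c0.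
  have a10 : a1 = 0 by have := F e1; rewrite !bilfE !(L3c, L3d, B11, B21, D1, D21, B01, D01) => H1; apply: (lcombm1 eta 1 _ H1); rewrite //; ring.
  have c10 : c1 = 0 by have := F (u ** e1); rewrite !bilfE !(L4c, L4d, Q11, Q21, Q01, Bu, B11, B21, B01) => H1; apply: (lcombm1 (N u * eta) 1 _ H1); rewrite //; ring.
  subst a1 c1.
  have a20 : a2 = 0 by have := F v; rewrite !bilfE !(L1c, L1d, B20, D20, D0, B10, D10) => H1; apply: (lcombm1 eta (-1) _ H1); rewrite //; ring.
  have c20 : c2 = 0 by have := F (u ** v); rewrite !bilfE !(L2c, L2d, Q20, Q10, Q00, Bu, B20, B10) => H1; apply: (lcombm1 (N u * eta) (-1) _ H1); rewrite //; ring.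
  by split; split.
have fX : free X.
  apply/freeP => a; rewrite !big_ord_recl big_ord0 /= addr0 !addrA => /sol [].
  move=> [h0 h1 h2 h3] [h4 h5 h6 h7].
  case=> [[|[|[|[|[|[|[|[|//]]]]]]]] i8]; [rewrite -[RHS]h0 | rewrite -[RHS]h1
    | rewrite -[RHS]h2 | rewrite -[RHS]h3 | rewrite -[RHS]h4 | rewrite -[RHS]h5
    | rewrite -[RHS]h6 | rewrite -[RHS]h7]; congr a; exact: val_inj.
have dec x : exists p q a0 a1 a2 c0 c1 c2, x = p *: e + q *: u + a0 *: v + a1 *: e1 + a2 *: e2 +
    c0 *: (u ** v) + c1 *: (u ** e1) + c2 *: (u ** e2).
  have : x \in <<X>>%VS.
    have -> : <<X>>%VS = fullv; last exact: memvf.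
    by apply/eqP; rewrite eqEdim subvf odim; move: fX; rewrite /free => /eqP ->.
  move/coord_span => ->; rewrite !big_ord_recl big_ord0 /= addr0 !addrA.
  by do 8!eexists.
(* Here [t^-1 - 1 = - n + n^2], so the images of [v], [e1], [e2] are [- v], [e1 - e2], [- e2]. *)
have [s Hs] := @basis_lfun k C 8 X [tuple e; u; - v; e1 - e2; - e2; - (u ** v); u ** e1 - u ** e2; - (u ** e2)] fX.
have s_e : s e = e by have := Hs (@Ordinal 8 0 isT).
have s_u : s u = u by have := Hs (@Ordinal 8 1 isT).
have s_0 : s v = - v by have := Hs (@Ordinal 8 2 isT).
have s_1 : s e1 = e1 - e2 by have := Hs (@Ordinal 8 3 isT).
have s_2 : s e2 = - e2 by have := Hs (@Ordinal 8 4 isT).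
have s_3 : s (u ** v) = - (u ** v) by have := Hs (@Ordinal 8 5 isT).
have s_4 : s (u ** e1) = u ** e1 - u ** e2 by have := Hs (@Ordinal 8 6 isT).
have s_5 : s (u ** e2) = - (u ** e2) by have := Hs (@Ordinal 8 7 isT).
clear Hs.
have sD x y : s (x + y) = s x + s y by rewrite linearD.
have sZ a x : s (a *: x) = a *: s x by rewrite linearZ.
have sN x : s (- x) = - s x by rewrite linearN.
have sE := (sD, sZ, sN, s_e, s_u, s_0, s_1, s_2, s_3, s_4, s_5).
pose inV A := exists a0 a1 a2, A = a0 *: v + a1 *: e1 + a2 *: e2.
have dec' x : exists p q A B, [/\ inV A, inV B & x = p *: e + q *: u + A + u ** B].
  have [p [q [a0 [a1 [a2 [c0 [c1 [c2 ->]]]]]]]] := dec x.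
  exists p, q, (a0 *: v + a1 *: e1 + a2 *: e2), (c0 *: v + c1 *: e1 + c2 *: e2).
  by split; [exists a0, a1, a2 | exists c0, c1, c2 | rewrite !(omulDr, omulZr) !addrA].
have VW A : inV A -> W A.
  by move=> [a0 [a1 [a2 ->]]]; apply: inWD; [apply: inWD|]; apply: inWZ.
have sV A : inV A -> inV (s A).
  move=> [a0 [a1 [a2 ->]]]; exists (- a0), a1, (- a1 - a2).
  rewrite !(sD, sZ) s_0 s_1 s_2.
  by apply: bilf_inj => w; rewrite !bilfE; ring.
have suV A : inV A -> s (u ** A) = u ** s A.
  move=> [a0 [a1 [a2 ->]]]; rewrite !(omulDr, omulZr) !(sD, sZ) s_0 s_1 s_2 s_3 s_4 s_5.
  by rewrite !(omulDr, omulZr, omulNr).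
have ssV A : inV A -> s (s A) = A.
  move=> [a0 [a1 [a2 ->]]]; rewrite !(sD, sZ) s_0 s_1 s_2 !(sD, sZ, sN) s_0 s_1 s_2.
  by apply: bilf_inj => w; rewrite !bilfE; ring.
have stsV A : inV A -> t (s (t A)) = s A.
  move=> [a0 [a1 [a2 ->]]]; rewrite !(oautD, oautZ) t0 t1 t2 !(sD, sZ, sN) s_0 s_1 s_2.
  rewrite !(oautD, oautZ, oautN) t0 t1 t2.
  by apply: bilf_inj => w; rewrite !bilfE; ring.
have tV3 A : inV A -> inV (t A).
  move=> [a0 [a1 [a2 ->]]]; exists a0, (a0 + a1), (a1 + a2).
  rewrite !(oautD, oautZ) t0 t1 t2.
  by apply: bilf_inj => w; rewrite !bilfE; ring.
(* The choice of [v] with [b v (u ** n v) = 0] makes the second Hermitian component vanish on the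
   [k]-span of the chain, so only the symmetric form there has to be checked for [s]. *)
have EV A B : inV A -> inV B -> b (u ** A) B = 0.
  move=> [a0 [a1 [a2 ->]]] [c0 [c1 [c2 ->]]].
  rewrite !(omulDr, omulZr) !bilfE D0 D1 D2 D01 D02 D10 D12 D20 D21; ring.
have bV A B : inV A -> inV B -> b (s A) (s B) = b A B.
  move=> [a0 [a1 [a2 ->]]] [c0 [c1 [c2 ->]]].
  rewrite !(sD, sZ) s_0 s_1 s_2 !bilfE B01 B02 B10 B12 B20 B21 B11 B22.
  by field.
have ss x : s (s x) = x.
  have [p [q [A [B [VA VB ->]]]]] := dec' x.
  rewrite !(sD, sZ) !s_e !s_u (suV _ VB) (suV _ (sV _ VB)).
  by rewrite (ssV _ VA) (ssV _ VB).
have su x : s (u ** x) = u ** s x.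
  have [p [q [A [B [VA VB ->]]]]] := dec' x.
  rewrite !(omulDr, omulZr) !(sD, sZ) s_e s_u (suV _ VB).
  rewrite !(omulDr, omulZr) omulx1 !(uu Pu) pure_sq // !(sD, sZ) (suV _ VA) s_u s_e.
  by [].
have tuE y : t (u ** y) = u ** t y by rewrite oautM tu.
have sts x : t (s (t x)) = s x.
  have [p [q [A [B [VA VB ->]]]]] := dec' x.
  rewrite !(oautD, oautZ) oaut1 tu tuE !(sD, sZ) s_e s_u (suV _ VB) (suV _ (tV3 _ VB)).
  by rewrite !(oautD, oautZ) oaut1 tu tuE (stsV _ VA) (stsV _ VB).
have sb x y : b (s x) (s y) = b x y.
  have [p [q [A [B [VA VB ->]]]]] := dec' x; have [p' [q' [A' [B' [VA' VB' ->]]]]] := dec' y.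
  rewrite !(sD, sZ) s_e s_u (suV _ VB) (suV _ VB').
  have Ws := VW _ (sV _ VA); have Ws' := VW _ (sV _ VA').
  have Wt := VW _ (sV _ VB); have Wt' := VW _ (sV _ VB').
  have gen A1 B1 A2 B2 : inV A1 -> inV B1 -> inV A2 -> inV B2 ->
      b (p *: e + q *: u + A1 + u ** B1) (p' *: e + q' *: u + A2 + u ** B2) =
      p * p' * 2%:R + q * q' * (2%:R * N u) + b A1 A2 + N u * b B1 B2.
    move=> V1 V2 V3 V4; have [a1 a2] := VW _ V1; have [a3 a4] := inW_u (VW _ V2).
    have [a5 a6] := VW _ V3; have [a7 a8] := inW_u (VW _ V4).
    rewrite !bilfE Bee Bue Beu Buu a1 a2 a3 a4 ![b e _]bilfC ![b u _]bilfC a5 a6 a7 a8.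
    rewrite Bu (EV _ _ V2 V3) [b A1 (u ** B2)]bilfC (EV _ _ V4 V1); ring.
  by rewrite !gen ?bV //; apply: sV.
have sW x : W x -> W (s x).
  by move=> [Px xu]; split; rewrite /pure; [rewrite -[X in b _ X]s_e | rewrite -[X in b _ X]s_u]; rewrite sb.
have sP x : pure x -> pure (s x) by rewrite /pure -{2}s_e sb.
have so : is_oaut s.
  have Lb : Lbasis u v e1 e2.
    split=> // w [Pw wu]; have [p [q [a0 [a1 [a2 [c0 [c1 [c2 E]]]]]]]] := dec w.
    have p0 : p = 0.
      by move: Pw; rewrite /pure E !bilfE !(Bee, Bue, L1a, L3a, L5a, L2a, L4a, L6a) => H1; apply: (lcombm1 2%:R 1 two0 H1); ring.
    have q0 : q = 0.
      by move: wu; rewrite E !bilfE !(Beu, Buu, L1b, L3b, L5b, L2b, L4b, L6b) => H1; apply: (lcombm1 (2%:R * N u) 1 _ H1); rewrite //; ring.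
    by exists a0, a1, a2, c0, c1, c2; rewrite E p0 q0 !scale0r !add0r.
  pose F x y z := phi (s x) (s y) (s z) - phi x y z.
  have F3 : trilin F.
    by split=> *; rewrite /F /phi !sE ?omulE !bilfE; ring.
  have FW : forall x y z, W x -> W y -> W z -> F x y z = 0.
    apply: (alt3_zero two0 Pu F3 _ _ _ Lb); rewrite /F.
    - move=> x y z [Px xu] [Py yu] [Pz zu].
      by rewrite (phi_swap12 Px Py Pz) (phi_swap12 (sP _ Px) (sP _ Py) (sP _ Pz)); ring.
    - move=> x y z [Px xu] [Py yu] [Pz zu].
      by rewrite (phi_swap23 _ _ Px) (phi_swap23 _ _ (sP _ Px)); ring.
    - move=> x y z Hx Hy Hz; rewrite !su (phi_bal Pu Hx Hy Hz).
      by rewrite (phi_bal Pu (sW _ Hx) (sW _ Hy) (sW _ Hz)).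
    - have z2 : b (v ** e2) e2 = 0 by rewrite -{2}[e2]omul1x bilf_mulr L1a mul0r.
      by rewrite !sE /phi !omulE !bilfE z2; ring.
    - have z2 : b ((u ** v) ** e2) e2 = 0 by rewrite -{2}[e2]omul1x bilf_mulr L2a mul0r.
      by rewrite !sE /phi !omulE !bilfE z2; ring.
  have Fu y z : F u y z = 0 by rewrite /F s_u /phi -su sb subrr.
  have A12 x y z : pure x -> pure y -> pure z -> F x y z = - F y x z.
    move=> Px Py Pz; rewrite /F (phi_swap12 Px Py Pz).
    by rewrite (phi_swap12 (sP _ Px) (sP _ Py) (sP _ Pz)); ring.
  have A23 x y z : pure x -> F x y z = - F x z y.
    by move=> Px; rewrite /F (phi_swap23 _ _ Px) (phi_swap23 _ _ (sP _ Px)); ring.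
  apply: oaut_of_form => // x y z Px Py Pz; apply/eqP; rewrite -subr_eq0 -/(F x y z); apply/eqP.
  have pdec y' : pure y' -> exists q w, W w /\ y' = q *: u + w.
    move=> Py'; have [p [q [w [Hw E]]]] := W_dec two0 Pu Nu y'.
    exists q, w; split=> //; suff p0 : p = 0 by rewrite E p0 scale0r add0r.
    move: Py' (Hw) => + [Pw _]; rewrite E /pure !bilfE Bee Bue Pw => H1.
    by apply: (lcombm1 2%:R 1 two0 H1); ring.
  have [q3 [z' [Wz Ez]]] := pdec _ Pz; have [q1 [x' [Wx Ex]]] := pdec _ Px.
  have [q2 [y' [Wy Ey]]] := pdec _ Py; have [T1 T2 T3] := F3.
  have [Px' _] := Wx; have [Py' _] := Wy.
  rewrite Ex T1 Fu Ey T2 (A12 x' u) // Fu Ez T3 (A23 x' y' u) // (A12 x' u) // Fu FW //.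
  by ring.
apply: (@strongly_real_of k C (OAut (introT (asboolP _) so))) => x /=; first exact: ss.
by rewrite sts ss.
Qed.

Theorem unipotent_fixed_anisotropic : strongly_real t.
Proof.
have [|n2] := pselect (exists2 x, W x & nn (nn x) != 0); first exact: cyclic_case.
have {}n2 x : W x -> nn (nn x) = 0.
  by move=> Wx; apply/eqP; apply: contra_notT n2 => H; exists x.
have [|n1] := pselect (exists2 x, W x & nn x != 0); first exact: square_zero_case.
have {}n1 x : W x -> nn x = 0.
  by move=> Wx; apply/eqP; apply: contra_notT n1 => H; exists x.
have t1 x : t x = x.
  have [p [q [w [Ww ->]]]] := W_dec two0 Pu Nu x.
  by rewrite !(oautD, oautZ) oaut1 tu tE n1 // addr0.
apply: (@strongly_real_of k C 1%g) => x; rewrite !oaut_id //.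
by rewrite !t1.
Qed.
End FixedAnisotropic.
End UnipotentHermitian.

(** * Regular unipotent elements *)

Section AlternatingSequence.
Variables (k : fieldType) (a : nat -> nat -> nat -> k).
Hypothesis two0 : (2%:R : k) != 0.
Hypotheses (A12 : forall i j l, a i j l = - a j i l) (A23 : forall i j l, a i j l = - a i l j).
Hypothesis Z7 : forall i j l, (6 < l)%N -> a i j l = 0.
(** The expansion of [F (t x) (t y) (t z) = F x y z] with [t = 1 + n]. Modulo higher weight, it says
    that the three entries obtained by raising one index sum to zero. *)
Hypothesis R : forall i j l, a i.+1 j l + a i j.+1 l + a i j l.+1 + a i.+1 j.+1 l +
  a i.+1 j l.+1 + a i j.+1 l.+1 + a i.+1 j.+1 l.+1 = 0.

Let opp_inj (x : k) : x = - x -> x = 0.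
Proof. by move=> H; apply: (lcombm1 2%:R 1 two0 H); ring. Qed.
Let aii i l : a i i l = 0. Proof. exact/opp_inj/A12. Qed.
Let ajj i j : a i j j = 0. Proof. exact/opp_inj/A23. Qed.
Let a7 i j : a i j 7 = 0. Proof. exact: Z7. Qed.
Let E := (aii, ajj, a7, addr0, add0r).

Lemma seq_sorted w : (forall i j l, (i < j)%N -> (j < l)%N -> (l < 7)%N -> (w < i + j + l)%N ->
  a i j l = 0) -> forall i j l, (w < i + j + l)%N -> a i j l = 0.
Proof.
move=> H; have H1 i j l : (i < j)%N -> (j < l)%N -> (w < i + j + l)%N -> a i j l = 0.
  by move=> ij jl; case: (ltnP l 7) => [l7|l7 _]; [apply: H | apply: Z7].
have H2 i j l : (i < j)%N -> (w < i + j + l)%N -> a i j l = 0.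
  move=> ij wl; case: (ltngtP j l) => [jl|lj|<-]; [exact: H1 | | exact: ajj].
  rewrite A23; case: (ltngtP i l) => [il|li|<-]; last by rewrite aii oppr0.
    by rewrite H1 ?oppr0 //; lia.
  by rewrite A12 opprK H1 //; lia.
move=> i j l wl; case: (ltngtP i j) => [ij|ji|<-]; [exact: H2 | | exact: aii].
by rewrite A12 H2 ?oppr0 //; lia.
Qed.

Lemma seq_step w : (forall i j l, (w.+1 < i + j + l)%N -> a i j l = 0) ->
  (forall i j l, (i < j)%N -> (j < l)%N -> (l < 7)%N -> (i + j + l)%N = w.+1 -> a i j l = 0) ->
  forall i j l, (w < i + j + l)%N -> a i j l = 0.
Proof.
move=> H1 H2; apply: seq_sorted => i j l ij jl l7 wl.
by case: (ltngtP (i + j + l) w.+1) => [||e]; [lia | exact: H1 | exact: H2].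
Qed.

Lemma seq_high i j l : (9 < i + j + l)%N -> a i j l = 0.
Proof.
have z456 : a 4 5 6 = 0 by have := R 3 5 6; rewrite ?E.
have z356 : a 3 5 6 = 0 by have := R 2 5 6; rewrite ?E.
have z256 : a 2 5 6 = 0 by have := R 1 5 6; rewrite ?E.
have z346 : a 3 4 6 = 0 by have := R 2 4 6; rewrite ?(E, z256, z356).
have z156 : a 1 5 6 = 0 by have := R 0 5 6; rewrite ?E.
have z246 : a 2 4 6 = 0 by have := R 1 4 6; rewrite ?(E, z156, z256).
have z345 : a 3 4 5 = 0 by have := R 2 4 5; rewrite ?(E, z246, z256, z346, z356).
(* Weight 11 is the first at which the relations couple: three relations in three unknowns, with
   determinant 2. *)
have r136 : a 2 3 6 + a 1 4 6 = 0 by have := R 1 3 6; rewrite ?(E, z246).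
have r145 : a 2 4 5 + a 1 4 6 = 0 by have := R 1 4 5; rewrite ?(E, z156, z246, z256).
have r235 : a 2 4 5 + a 2 3 6 = 0 by have := R 2 3 5; rewrite ?(E, z345, z246, z346).
have z146 : a 1 4 6 = 0.
  apply: (mulfI two0); rewrite mulr0.
  have -> : 2%:R * a 1 4 6 = (a 2 3 6 + a 1 4 6) + (a 2 4 5 + a 1 4 6) - (a 2 4 5 + a 2 3 6).
    by ring.
  by rewrite r136 r145 r235 !addr0 subr0.
have z236 : a 2 3 6 = 0 by move: r136; rewrite z146 addr0.
have z245 : a 2 4 5 = 0 by move: r145; rewrite z146 addr0.
have z056 : a 0 5 6 = 0 by have := R 0 4 6; rewrite ?(E, z146, z156).
have z136 : a 1 3 6 = 0 by have := R 1 2 6; rewrite ?(E, z236).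
have z046 : a 0 4 6 = 0 by have := R 0 3 6; rewrite ?(E, z136, z146).
have z145 : a 1 4 5 = 0 by have := R 0 4 5; rewrite ?(E, z046, z146, z056, z156).
have z235 : a 2 3 5 = 0 by have := R 2 3 4; rewrite ?(E, z245, z345).
apply: seq_sorted => {}i {}j {}l ij jl l7 w. 
move: l7 jl ij w; case: l => [|[|[|[|[|[|[|l]]]]]]] //; case: j => [|[|[|[|[|[|j]]]]]] //;
  by case: i => [|[|[|[|[|i]]]]].
Qed.

(* The change of [a 0 1 3 + a 0 2 3] to first order when [v] is replaced by [v + c *: V 3]. *)
Lemma seq_linear : a 0 4 3 + a 0 5 3 + a 0 1 6 + a 0 2 6 = 3%:R * a 0 3 6.
Proof.
have Hi := seq_high.
have r026 : a 1 2 6 + a 0 3 6 = 0 by have := R 0 2 6; rewrite ?(E, Hi 1 3 6 isT).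
have r125 : a 1 3 5 + a 1 2 6 = 0 by have := R 1 2 5; rewrite ?(E, Hi 2 3 5 isT, Hi 1 3 6 isT, Hi 2 3 6 isT).
have r134 : a 2 3 4 + a 1 3 5 = 0.
  by have := R 1 3 4; rewrite ?(E, Hi 2 3 5 isT, Hi 1 4 5 isT, Hi 2 4 5 isT).
have r015 := R 0 1 5; have r024 := R 0 2 4; have r123 := R 1 2 3.
rewrite ?(E, Hi 1 3 6 isT, Hi 1 4 5 isT, Hi 1 4 6 isT, Hi 2 3 5 isT) in r015 r024 r123.
rewrite (A23 0 4 3) (A23 0 5 3).
have x126 : a 1 2 6 = - a 0 3 6 by apply: (lcomb1 1 r026); ring.
have x135 : a 1 3 5 = a 0 3 6 by apply: (lcomb2 1 (-1) r125 r026); ring.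
have x234 : a 2 3 4 = - a 0 3 6 by apply: (lcomb1 1 r134); rewrite x135; ring.
rewrite x126 x135 x234 in r015 r024 r123.
by apply: (lcomb1 (-1) r024); apply: (lcomb2 1 1 r015 r123); ring.
Qed.

(* The entries of weight [i + j + l] vanish one weight at a time, from above: odd weights by
   hypothesis, even weights by [R], with [a 0 1 3 + a 0 2 3] left over as a free parameter. *)
Lemma seq_zero : (forall w, (forall i j l, (w < i + j + l)%N -> a i j l = 0) -> odd w ->
    forall i j l, (i + j + l)%N = w -> a i j l = 0) ->
  a 0 1 3 + a 0 2 3 = 0 -> forall i j l, a i j l = 0.
Proof.
move=> Odd Q; have H9 := seq_high.
have H8 : forall i j l, (8 < i + j + l)%N -> a i j l = 0.
  by apply: (seq_step H9) => i j l _ _ _; apply: (Odd 9).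
have H7 : forall i j l, (7 < i + j + l)%N -> a i j l = 0.
  (* Weight 8 again ends in a system of three relations with determinant 2. *)
  have z026 : a 0 2 6 = 0 by have := R 0 1 6; rewrite ?(E, H8 1 2 6 isT).
  have r025 : a 1 2 5 + a 0 3 5 = 0.
    by have := R 0 2 5; rewrite ?(E, z026, H8 1 3 5 isT, H8 1 2 6 isT, H8 0 3 6 isT, H8 1 3 6 isT).
  have r034 : a 1 3 4 + a 0 3 5 = 0.
    by have := R 0 3 4; rewrite ?(E, H8 1 3 5 isT, H8 0 4 5 isT, H8 1 4 5 isT).
  have r124 : a 1 3 4 + a 1 2 5 = 0.
    by have := R 1 2 4; rewrite ?(E, H8 2 3 4 isT, H8 1 3 5 isT, H8 2 3 5 isT).
  have z134 : a 1 3 4 = 0.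
    apply: (mulfI two0); rewrite mulr0.
    have -> : 2%:R * a 1 3 4 = (a 1 3 4 + a 0 3 5) + (a 1 3 4 + a 1 2 5) - (a 1 2 5 + a 0 3 5).
      by ring.
    by rewrite r034 r124 r025 !addr0 subr0.
  move: r034 r124; rewrite z134 !add0r => z035 z125.
  apply: (seq_step H8) => i j l ij jl l7 w. 
move: l7 jl ij w; case: l => [|[|[|[|[|[|[|l]]]]]]] //; case: j => [|[|[|[|[|[|j]]]]]] //;
  by case: i => [|[|[|[|[|i]]]]].
have H6 : forall i j l, (6 < i + j + l)%N -> a i j l = 0.
  by apply: (seq_step H7) => i j l _ _ _; apply: (Odd 7).
(* [R 0 1 2] reads [a 0 1 3 + a 0 2 3 + a 1 2 3 = 0] exactly, so the hypothesis on the first two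
   terms removes the free parameter in weight 6. *)
have z123 : a 1 2 3 = 0 by have := R 0 1 2; rewrite ?E Q add0r.
have z024 : a 0 2 4 = 0.
  by have := R 0 2 3; rewrite ?(E, z123, H6 1 3 3 isT, H6 1 2 4 isT, H6 0 3 4 isT, H6 1 3 4 isT).
have z015 : a 0 1 5 = 0.
  by have := R 0 1 4; rewrite ?(E, z024, H6 1 2 4 isT, H6 0 2 5 isT, H6 1 2 5 isT).
have H5 : forall i j l, (5 < i + j + l)%N -> a i j l = 0.
  apply: (seq_step H6) => i j l ij jl l7 w. 
move: l7 jl ij w; case: l => [|[|[|[|[|[|[|l]]]]]]] //; case: j => [|[|[|[|[|[|j]]]]]] //;
  by case: i => [|[|[|[|[|i]]]]].
have H4 : forall i j l, (4 < i + j + l)%N -> a i j l = 0.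
  by apply: (seq_step H5) => i j l _ _ _; apply: (Odd 5).
have H3 : forall i j l, (3 < i + j + l)%N -> a i j l = 0.
  apply: (seq_step H4) => i j l ij jl l7 w.
  have : i = 0 /\ j = 1 /\ l = 3 by lia.
  by case=> -> [-> ->]; move: Q; rewrite (H4 0 2 3 isT) addr0.
have H2 : forall i j l, (2 < i + j + l)%N -> a i j l = 0.
  by apply: (seq_step H3) => i j l _ _ _; apply: (Odd 3).
have H0 : forall i j l, (i < j)%N -> (j < l)%N -> (l < 7)%N -> a i j l = 0.
  by move=> i j l ij jl _; apply: H2; lia.
move=> i j l; case: (ltngtP i j) => [ij|ji|<-]; last exact: aii.
  case: (posnP (i + j + l)) => [|w]; first by lia.
  by apply: (seq_sorted (w := 0)) w => *; apply: H0.
case: (posnP (i + j + l)) => [|w]; first by lia.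
by apply: (seq_sorted (w := 0)) w => *; apply: H0.
Qed.
End AlternatingSequence.

(** * Cyclic vectors of [t - 1] on the pure octonions *)

Section Cyclic.
Variables (k : fieldType) (C : octonionType k).
Hypothesis two0 : (2%:R : k) != 0.
Local Notation "x ** y" := (omul x y) (at level 40, left associativity).
Local Notation N := (@onorm k C).
Local Notation b := (@bilf k C).
Local Notation e := (@oone k C).
Implicit Types (x y z w v u : C).
Variable t : oaut C.
Local Notation n := (nn t).
Local Notation m := (nn (t^-1)%g).

Lemma iter_nnD i x y : iter i n (x + y) = iter i n x + iter i n y.
Proof. by elim: i => //= i ->; rewrite nnD. Qed.
Lemma iter_nnZ i c x : iter i n (c *: x) = c *: iter i n x.
Proof. by elim: i => //= i ->; rewrite nnZ. Qed.
Lemma iter_nn0 i : iter i n 0 = 0.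
Proof. by elim: i => //= i ->; rewrite nn0. Qed.
Lemma pure_nn x : pure x -> pure (n x).
Proof. by move=> Px; rewrite nnE /pure !bilfE oaut_pure // Px oppr0 addr0. Qed.
Lemma pure_iter i x : pure x -> pure (iter i n x).
Proof. by move=> Px; elim: i => //= i; apply: pure_nn. Qed.
Lemma nn_e : n e = 0. Proof. by rewrite nnE oaut1 subrr. Qed.

Lemma nn_adj_inv x y : b (n x) y = b x (m y).
Proof. by rewrite !nnE !bilfE oaut_bilfV. Qed.
Lemma nn_inv x : m x = - n ((t^-1)%g x).
Proof. by rewrite !nnE oautVK opprB. Qed.
Lemma nn_aut x : n ((t^-1)%g x) = (t^-1)%g (n x).
Proof. by rewrite !nnE oautB oautK oautVK. Qed.
Lemma nn_adj_step x y : b (n x) y = - b x (n y) - b (n x) (n y).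
Proof.
have := oaut_bilf t x y; rewrite !(tE t) !bilfE => H.
by apply: (lcomb1 1 H); ring.
Qed.

(** The adjoint of [n] is [t^-1 - 1], which is [- n] up to higher powers of [n]; on the last nonzero
    layer only the sign survives. *)
Lemma adj_top i x y : n (iter i n y) = 0 -> b (iter i n x) y = (-1) ^+ i * b x (iter i n y).
Proof.
elim: i x y => [|i IH] x y; first by rewrite mul1r.
move=> H; rewrite iterS nn_adj_step -iterS iterSr.
have H' : n (iter i n (n y)) = 0 by rewrite -iterSr.
rewrite !IH // -iterSr [b (n x) _]nn_adj_step H !bilf0r exprS; ring.
Qed.

Section Invariant.
Variable F : C -> C -> C -> k.
Hypotheses (F3 : trilin F) (Ft : forall x y z, F (t x) (t y) (t z) = F x y z).
Hypotheses (F12 : forall x y z, pure x -> pure y -> pure z -> F x y z = - F y x z)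
  (F23 : forall x y z, pure x -> pure y -> pure z -> F x y z = - F x z y).

Lemma trilinD : [/\ forall x x' y z, F (x + x') y z = F x y z + F x' y z,
  forall x y y' z, F x (y + y') z = F x y z + F x y' z &
  forall x y z z', F x y (z + z') = F x y z + F x y z'].
Proof.
have [H1 H2 H3] := F3.
split=> x y z w; [have := H1 1 x y z w | have := H2 1 x y z w | have := H3 1 x y z w];
  by rewrite scale1r mul1r.
Qed.
Lemma trilinZ : [/\ forall c x y z, F (c *: x) y z = c * F x y z,
  forall c x y z, F x (c *: y) z = c * F x y z &
  forall c x y z, F x y (c *: z) = c * F x y z].
Proof.
have [H1 H2 H3] := F3; have [D1 D2 D3] := trilinD.
have Z1 y z : F 0 y z = 0.
  by have := D1 0 0 y z; rewrite addr0 => H; apply: (lcomb1 (-1) H); ring.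
have Z2 x z : F x 0 z = 0.
  by have := D2 x 0 0 z; rewrite addr0 => H; apply: (lcomb1 (-1) H); ring.
have Z3 x y : F x y 0 = 0.
  by have := D3 x y 0 0; rewrite addr0 => H; apply: (lcomb1 (-1) H); ring.
split=> c x y z.
- by have := H1 c x 0 y z; rewrite addr0 Z1 addr0.
- by have := H2 c x y 0 z; rewrite addr0 Z2 addr0.
- by have := H3 c x y z 0; rewrite addr0 Z3 addr0.
Qed.

Lemma invariant_rel x y z : F (n x) y z + F x (n y) z + F x y (n z) + F (n x) (n y) z +
  F (n x) y (n z) + F x (n y) (n z) + F (n x) (n y) (n z) = 0.
Proof.
have [D1 D2 D3] := trilinD; have := Ft x y z; rewrite !(tE t) !(D1, D2, D3) => H.
by apply: (lcomb1 1 H); ring.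
Qed.
End Invariant.

Hypothesis n7 : forall x, iter 7 n x = 0.
Lemma iter7 i x : (6 < i)%N -> iter i n x = 0.
Proof. by move=> i7; rewrite -(subnK i7) iterD n7 iter_nn0. Qed.

Section Vector.
Variable v : C.
Hypotheses (Pv : pure v) (v6 : b v (iter 6 n v) != 0).
Local Notation V i := (iter i n v).

Lemma V_pure i : pure (V i). Proof. exact: pure_iter. Qed.
Lemma V_pair i j : (5 < i + j)%N -> b (V i) (V j) = (-1) ^+ i * b v (V (i + j)).
Proof.
by move=> ij; rewrite adj_top ?iterD // -iterD -iterS iter7 // ltnS.
Qed.
Lemma V_pair0 i j : (6 < i + j)%N -> b (V i) (V j) = 0.
Proof. by move=> ij; rewrite V_pair ?iter7 ?bilf0r ?mulr0 //; apply: ltnW. Qed.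

(** The Gram matrix of the chain is antitriangular with entries [b v (V 6)] up to sign on the
    antidiagonal; pairing with [V (6 - i)] isolates the [i]-th coefficient once the earlier ones
    vanish. *)
Lemma V_indep p (c : nat -> k) : p *: e + \sum_(i < 7) c i *: V i = 0 ->
  p = 0 /\ forall i, (i < 7)%N -> c i = 0.
Proof.
move=> H; have p0 : p = 0.
  have := congr1 (fun x => b x e) H; rewrite /= !bilfE bilf_suml big1 => [|i _].
    by rewrite bilfxx onorm1 addr0 mulr1 => /eqP; rewrite mulf_eq0 (negPf two0) orbF => /eqP.
  by rewrite bilfZl V_pure mulr0.
split=> // i; have [w] := ubnP i; elim: w => // w IH in i *; move=> iw i7.
have := congr1 (fun x => b x (V (6 - i))) H.
rewrite /= p0 scale0r add0r bilf0l bilf_suml (bigD1 (Ordinal i7)) //= big1 => [|j ji].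
  rewrite addr0 bilfZl V_pair ?subnKC // => /eqP.
  by rewrite !mulf_eq0 signr_eq0 (negPf v6) !orbF => /eqP.
case: (ltngtP j i) => [ji'|ij|E]; first by rewrite IH ?scale0r ?bilf0l // (leq_trans ji').
  by rewrite bilfZl V_pair0 ?mulr0 //; lia.
by case/eqP: ji; apply: val_inj.
Qed.

Let X := [tuple of e :: [seq V i | i <- iota 0 7]].
Lemma X_nth (i : 'I_8) : X`_i = if val i is j.+1 then V j else e.
Proof. by case: i => [[|[|[|[|[|[|[|[|//]]]]]]]] ?]. Qed.
Lemma V_free : free X.
Proof.
apply/freeP=> c H; have [|p0 c0] := @V_indep (c ord0) (fun i => c (inord i.+1)).
  rewrite -[RHS]H [RHS]big_ord_recl; congr (_ + _); apply: eq_bigr => i _.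
  rewrite X_nth /=; congr (c _ *: _); apply: val_inj; rewrite /= inordK //.
  by rewrite ltnS ltn_ord.
by case=> [[|i] i8]; [rewrite -[RHS]p0; congr c; exact: val_inj|
  rewrite -[RHS](c0 i) //; congr c; apply: val_inj; rewrite /= inordK].
Qed.

Lemma V_dec x : exists p (c : nat -> k), x = p *: e + \sum_(i < 7) c i *: V i.
Proof.
have : x \in <<X>>%VS.
  have -> : <<X>>%VS = fullv; last exact: memvf.
  by apply/eqP; rewrite eqEdim subvf odim; move: V_free; rewrite /free => /eqP ->.
move/coord_span => E; exists (coord X ord0 x), (fun i => coord X (inord i.+1) x).
rewrite {1}E [LHS]big_ord_recl; congr (_ + _); apply: eq_bigr => i _.
rewrite X_nth /=; congr (coord X _ _ *: _); apply: val_inj; rewrite /= inordK //.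
by rewrite ltnS ltn_ord.
Qed.

Lemma pure_V_ind (P : C -> Prop) : P 0 -> (forall c x y, P x -> P y -> P (c *: x + y)) ->
  (forall i, P (V i)) -> forall x, pure x -> P x.
Proof.
move=> P0 PL PV x Px; have [p [c E]] := V_dec x.
have SP : P (\sum_(i < 7) c i *: V i).
  elim/big_ind: _ => // [y z Py Pz|i _]; first by rewrite -[y]scale1r; apply: (PL).
  by rewrite -[_ *: _]addr0; apply: (PL).
move: Px; rewrite /pure E !bilfE bilf_suml big1 => [|i _]; last by rewrite bilfZl V_pure mulr0.
rewrite bilfxx onorm1 addr0 mulr1 => /eqP; rewrite mulf_eq0 (negPf two0) orbF => /eqP ->.
by rewrite scale0r add0r.
Qed.
Lemma V_ind (P : C -> Prop) : P 0 -> (forall c x y, P x -> P y -> P (c *: x + y)) ->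
  P e -> (forall i, P (V i)) -> forall x, P x.
Proof.
move=> P0 PL Pe PV x; pose p := 2%:R^-1 * b x e.
rewrite -[x](subrK (p *: e)) addrC; apply: (PL) => //; apply: pure_V_ind => //.
by rewrite /pure /p !bilfE bilfxx onorm1; field.
Qed.

Section Sequence.
Variable F : C -> C -> C -> k.
Hypotheses (F3 : trilin F) (Ft : forall x y z, F (t x) (t y) (t z) = F x y z).
Hypotheses (F12 : forall x y z, pure x -> pure y -> pure z -> F x y z = - F y x z)
  (F23 : forall x y z, pure x -> pure y -> pure z -> F x y z = - F x z y).
Let a i j l := F (V i) (V j) (V l).
Lemma V_seq : [/\ forall i j l, a i j l = - a j i l, forall i j l, a i j l = - a i l j,
  forall i j l, (6 < l)%N -> a i j l = 0 &
  forall i j l, a i.+1 j l + a i j.+1 l + a i j l.+1 + a i.+1 j.+1 l +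
  a i.+1 j l.+1 + a i j.+1 l.+1 + a i.+1 j.+1 l.+1 = 0].
Proof.
split=> i j l; first by apply: F12; apply: V_pure.
- by apply: F23; apply: V_pure.
- move=> l7; rewrite /a (iter7 v l7); have [_ _ H] := trilinZ F3.
  by have := H 0 (V i) (V j) 0; rewrite scale0r mul0r.
by rewrite /a !iterS; apply: invariant_rel.
Qed.
End Sequence.

Let a i j l := phi (V i) (V j) (V l).
Lemma phi_seq : [/\ forall i j l, a i j l = - a j i l, forall i j l, a i j l = - a i l j,
  forall i j l, (6 < l)%N -> a i j l = 0 &
  forall i j l, a i.+1 j l + a i j.+1 l + a i j l.+1 + a i.+1 j.+1 l +
  a i.+1 j l.+1 + a i j.+1 l.+1 + a i.+1 j.+1 l.+1 = 0].
Proof.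
apply: V_seq; [exact: phi_trilin | exact: oaut_phi | exact: phi_swap12 |].
by move=> x y z Px _ _; apply: phi_swap23.
Qed.

Lemma phi_V_high i j l : (9 < i + j + l)%N -> a i j l = 0.
Proof. by have [H1 H2 H3 H4] := phi_seq; apply: (seq_high two0 H1 H2 H3 H4). Qed.

(** By weight, [V 6 ** V 3] can pair nontrivially only with [V 0]. If this value vanished the
    product would be zero, although [V 3] is anisotropic and [V 6] is not zero. *)
Lemma phi036_neq0 : phi (V 0) (V 3) (V 6) != 0.
Proof.
apply/eqP => a036; case/eqP: v6; have -> : V 6 = 0; last by rewrite bilf0r.
apply: (@onorm_eq0_mulr k C _ (V 3)).
  apply: bilf_inj => w; rewrite bilf0l; move: w; apply: V_ind.
  - by rewrite bilf0r.
  - by move=> c x y Hx Hy; rewrite bilfPr Hx Hy mulr0 addr0.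
  - by rewrite bilf1M (pure_conj (V_pure _)) bilfNr V_pair0 ?oppr0.
  case=> [|i]; last by apply: (phi_V_high (i := 6) (j := 3)); lia.
  have [H1 H2 _ _] := phi_seq; have := H1 6 3 0; rewrite /a /phi => ->.
  by have := H2 3 6 0; rewrite /a /phi => ->; have := H1 3 0 6; rewrite /a /phi => ->;
    move: a036; rewrite /phi => ->; rewrite !oppr0.
have := bilfxx (V 3); rewrite V_pair // => H; apply: contraNneq v6 => N3.
move: H; rewrite N3 mulr0 => /eqP; rewrite mulf_eq0 signr_eq0 orFb; apply.
Qed.
End Vector.

Hypothesis three0 : (3%:R : k) != 0.

(** The form [b x (n^6 y)] is symmetric, so it is nonzero at some diagonal [v0]. Adding [c n^3 v0]
    changes the cubic expression by [3 c phi (V 0) (V 3) (V 6)]: terms of higher degree in [c]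
    vanish by weight or alternation, and the coefficient is invertible. *)
Lemma normalized_vector : (exists2 w, pure w & iter 6 n w != 0) ->
  exists v, [/\ pure v, b v (iter 6 n v) != 0 & phi v (t (n v)) (iter 3 n v) = 0].
Proof.
move=> [w Pw w6].
have sym x y : b x (iter 6 n y) = b y (iter 6 n x).
  have E6 : (-1) ^+ 6 = 1 :> k by ring.
  by rewrite [RHS]bilfC adj_top ?E6 ?mul1r //; apply: n7.
have [v0 Pv0 v06] : exists2 v, pure v & b v (iter 6 n v) != 0.
  apply: contrapT => H; case/eqP: w6.
  have H0 x : pure x -> b x (iter 6 n x) = 0.
    by move=> Px; apply/eqP; apply: contra_notT H => H; exists x.
  have H1 z : pure z -> b w (iter 6 n z) = 0.
    move=> Pz; have Pwz : pure (w + z) by rewrite /pure bilfDl Pw Pz addr0.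
    have := H0 _ Pwz; rewrite iter_nnD !bilfDl !bilfDr !H0 // [b z _]sym addr0 add0r => H1.
    by apply: (lcombm1 2%:R 1 two0 H1); ring.
  apply: bilf_inj => z; rewrite bilf0l bilfC.
  pose p := 2%:R^-1 * b z e; rewrite -[z](subrK (p *: e)) bilfDl bilfZl.
  rewrite [b e _]bilfC (pure_iter 6 Pw) mulr0 addr0 sym H1 //.
  by rewrite /pure /p !bilfE bilfxx onorm1; field.
have [H1 H2 H3 H4] := phi_seq Pv0; have hi := phi_V_high Pv0.
pose x3 := phi (iter 0 n v0) (iter 3 n v0) (iter 6 n v0).
have x30 : x3 != 0 by apply: phi036_neq0.
pose Q0 := phi (iter 0 n v0) (iter 1 n v0) (iter 3 n v0) + phi (iter 0 n v0) (iter 2 n v0) (iter 3 n v0).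
pose c := - Q0 / (3%:R * x3).
exists (v0 + c *: iter 3 n v0); split.
- by rewrite /pure !bilfE Pv0 (pure_iter 3 Pv0) mulr0 addr0.
- rewrite iter_nnD iter_nnZ -iterD (@iter7 9) // scaler0 addr0 !bilfE.
  by have := @V_pair0 v0 3 6 isT => ->; rewrite mulr0 addr0.
have lin := seq_linear two0 H1 H2 H3 H4.
have [D1 D2 D3] := trilinD (@phi_trilin k C); have [Z1 Z2 Z3] := trilinZ (@phi_trilin k C).
pose W i := iter i n v0; rewrite -/(W _).
have E1 : t (n (v0 + c *: W 3)) = W 1%N + W 2 + c *: (W 4 + W 5).
  rewrite (tE t) !(nnD, nnZ) -[n v0]/(W 1%N) -[n (W 1%N)]/(W 2) -[n (W 3)]/(W 4) -[n (W 4)]/(W 5).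
  by apply: bilf_inj => z; rewrite !bilfE; ring.
have E2 : iter 3 n (v0 + c *: W 3) = W 3 + c *: W 6 by rewrite iter_nnD iter_nnZ /W -iterD.
rewrite E1 E2 -[v0]/(W 0); clear E1 E2.
have aii i l : phi (W i) (W i) (W l) = 0.
  by have H := H1 i i l; apply: (lcombm1 2%:R 1 two0 H); rewrite /W; ring.
have aij i l : phi (W i) (W l) (W i) = 0 by rewrite H2 aii oppr0.
have {}hi i j l : (9 < i + j + l)%N -> phi (W i) (W j) (W l) = 0 by exact: hi.
rewrite !(D1, D2, D3, Z1, Z2, Z3) !aij.
rewrite (hi 3 1 6)%N // (hi 3 2 6)%N // (hi 0 4 6)%N // (hi 0 5 6)%N // (hi 3 4 6)%N // (hi 3 5 6)%N //.
have Ec : c * (3%:R * x3) = - Q0 by rewrite /c; field; rewrite x30 three0.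
by apply: (lcomb2 c 1 lin Ec); rewrite /x3 /Q0 /W; ring.
Qed.
End Cyclic.

(** * The inverting involution of a regular unipotent *)

Section RegularUnipotent.
Variables (k : fieldType) (C : octonionType k).
Hypothesis two0 : (2%:R : k) != 0.
Local Notation "x ** y" := (omul x y) (at level 40, left associativity).
Local Notation N := (@onorm k C).
Local Notation b := (@bilf k C).
Local Notation e := (@oone k C).
Implicit Types (x y z w v u : C).
Variables (t : oaut C) (v : C).
Local Notation T := (t^-1)%g.
Local Notation n := (nn t).
Local Notation m := (nn (t^-1)%g).
Local Notation V i := (iter i n v).
Local Notation U i := (iter i m v).
Hypothesis n7 : forall x, iter 7 n x = 0.
Hypotheses (Pv : pure v) (v6 : b v (iter 6 n v) != 0) (Qv : phi v (t (n v)) (iter 3 n v) = 0).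

Lemma nnN x : n (- x) = - n x.
Proof. by rewrite -scaleN1r nnZ scaleN1r. Qed.
Lemma mE x : m x = - n x + n (n (T x)).
Proof.
have E : T x = x - n (T x) by rewrite -nn_inv nnE addrC subrK.
by rewrite nn_inv {1}E nnD nnN; apply: bilf_inj => w; rewrite !bilfE; ring.
Qed.
Lemma nm x : n (m x) = m (n x).
Proof. by rewrite !nn_inv nnN -nn_aut. Qed.
Lemma iter_nm i x : iter i n (m x) = m (iter i n x).
Proof. by elim: i => //= i ->; rewrite nm. Qed.
Lemma iter_iter_nm i j x : iter i n (iter j m x) = iter j m (iter i n x).
Proof. by elim: j => //= j IH; rewrite iter_nm IH. Qed.
Lemma iter_inv i x : iter i n (T x) = T (iter i n x).
Proof. by elim: i => //= i ->; rewrite nn_aut. Qed.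

(* [U i = (-1)^i V i] modulo terms of higher order. *)
Lemma U_V i : exists2 y, pure y & U i = (-1) ^+ i *: (V i + iter i.+1 n y).
Proof.
elim: i => [|i [y Py E]].
  by exists 0; rewrite /= ?nn0 ?addr0 ?scale1r //; rewrite /pure bilf0l.
exists (y - T v - T (n y)).
  by rewrite /pure !bilfE Py !oaut_pure ?oppr0 ?addr0 //; apply: pure_nn.
rewrite iterS E nnZ exprS mulrC -scalerA scaleN1r; congr (_ *: _).
rewrite nnD !mE -!iter_inv !iter_nnD -!scaleN1r !iter_nnZ -!iterS -nn_aut -[iter i.+2 n (n _)]iterSr.
by apply: bilf_inj => w; rewrite !bilfE; ring.
Qed.

(** An involution inverting [t] intertwines [n] with [m], so it is determined by the image of [v].
    The sign is not free: the value at [V 0], [V 3], [V 6], of odd weight 9, would be negated if [v]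
    were sent to itself. *)
Lemma regular_inverter : exists s : 'End(C), s e = e /\ forall i, s (V i) = - U i.
Proof.
pose X := [tuple of e :: [seq V i | i <- iota 0 7]].
pose Y := [tuple of e :: [seq - U i | i <- iota 0 7]].
have [s Hs] := @basis_lfun k C 8 X Y (V_free two0 n7 Pv v6); exists s.
split; first by have := Hs (@Ordinal 8 0 isT).
move=> i; case: (ltnP 6 i) => [i7|i7].
  have [y _ ->] := U_V i.
  by rewrite !iter7 // ?addr0 ?scaler0 ?oppr0 ?linear0 //; apply: leqW.
have := Hs (@Ordinal 8 i.+1 i7); rewrite /X /Y /=.
by case: i i7 => [|[|[|[|[|[|[|//]]]]]]] _.
Qed.

Section Inverter.
Variable s : 'End(C).
Hypotheses (s_e : s e = e) (s_V : forall i, s (V i) = - U i).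
Let sD x y : s (x + y) = s x + s y. Proof. exact: linearD. Qed.
Let sZ c x : s (c *: x) = c *: s x. Proof. exact: linearZ. Qed.
Let sB x y : s (x - y) = s x - s y. Proof. exact: linearB. Qed.
Let Vind := V_ind two0 n7 Pv v6.

Lemma s_nn x : s (n x) = m (s x).
Proof.
move: x; apply: Vind.
- by rewrite nn0 linear0 nn0.
- by move=> c x y Hx Hy; rewrite nnD nnZ !sD !sZ Hx Hy nnD nnZ.
- by rewrite nn_e linear0 s_e nn_e.
by move=> i; rewrite -iterS !s_V iterS -scaleN1r -[in RHS]scaleN1r nnZ.
Qed.
Lemma s_aut x : s (t x) = T (s x).
Proof. by rewrite tE sD s_nn nnE addrC subrK. Qed.
Lemma t_s_t x : t (s (t x)) = s x. Proof. by rewrite s_aut oautVK. Qed.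
Lemma s_autV x : s (T x) = t (s x).
Proof. by rewrite -[x in RHS](oautVK t) t_s_t. Qed.
Lemma s_mm x : s (m x) = n (s x).
Proof. by rewrite !nnE sB s_autV. Qed.
Lemma s_iter i x : s (iter i m x) = iter i n (s x).
Proof. by elim: i => //= i <-; rewrite s_mm. Qed.
Lemma s_invol x : s (s x) = x.
Proof.
move: x; apply: Vind.
- by rewrite !linear0.
- by move=> c x y Hx Hy; rewrite !sD !sZ Hx Hy.
- by rewrite !s_e.
move=> i; have sN x : s (- x) = - s x by rewrite linearN.
by rewrite s_V sN s_iter -[v]/(V 0) s_V /= -scaleN1r -[- v]scaleN1r iter_nnZ scalerA mulrNN mulr1 scale1r.
Qed.

Lemma iter_adj i x y : b (iter i n x) y = b x (iter i m y).
Proof. by elim: i y => //= i IH y; rewrite nn_adj_inv IH -iterSr. Qed.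

(** On the chain, [m] is the adjoint of [n] and commutes with it, so
    [b (U i) (U j) = b (V i) (V j)]. *)
Lemma s_isom x y : b (s x) (s y) = b x y.
Proof.
have bU i : b (U i) e = 0 by exact: (pure_iter (t^-1)%g i Pv).
move: x y; apply: (Vind (P := fun x => forall y, b (s x) (s y) = b x y)).
- by move=> y; rewrite linear0 !bilf0l.
- by move=> c x y Hx Hy w; rewrite !sD !sZ !bilfPl Hx Hy.
- apply: Vind.
  + by rewrite linear0 !bilf0r.
  + by move=> c x y Hx Hy; rewrite !sD !sZ !bilfPr Hx Hy.
  + by rewrite s_e.
  by move=> i; rewrite s_V s_e bilfNr ![b e _]bilfC bU V_pure // oppr0.
move=> i; apply: Vind.
- by rewrite linear0 !bilf0r.
- by move=> c x y Hx Hy; rewrite !sD !sZ !bilfPr Hx Hy.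
- by rewrite s_V s_e bilfNl bU V_pure // oppr0.
move=> j; rewrite !s_V bilfNl bilfNr opprK.
by rewrite [LHS]bilfC -iter_adj iter_iter_nm [LHS]bilfC -iter_adj bilfC.
Qed.

Let pure_s x : pure x -> pure (s x).
Proof. by rewrite /pure -{2}s_e s_isom. Qed.
(** The defect of [s] on [phi]. It is alternating on pure vectors and invariant under [t], so its
    values on the chain fall under [seq_zero]. *)
Let D x y z := phi (s x) (s y) (s z) - phi x y z.
Let D3 : trilin D.
Proof. by split=> *; rewrite /D /phi !(sD, sZ) ?omulE !bilfE; ring. Qed.
Let D12 x y z : pure x -> pure y -> pure z -> D x y z = - D y x z.
Proof.
move=> Px Py Pz; rewrite /D (phi_swap12 Px Py Pz).
by rewrite (phi_swap12 (pure_s Px) (pure_s Py) (pure_s Pz)); ring.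
Qed.
Let D23 x y z : pure x -> pure y -> pure z -> D x y z = - D x z y.
Proof.
by move=> Px _ _; rewrite /D (phi_swap23 _ _ Px) (phi_swap23 _ _ (pure_s Px)); ring.
Qed.
Let Dt x y z : D (t x) (t y) (t z) = D x y z.
Proof. by rewrite /D !s_aut !oaut_phi. Qed.
Let a i j l := D (V i) (V j) (V l).

Let D_high (d : nat) : (forall i j l, (d < i + j + l)%N -> a i j l = 0) ->
  forall i j l, (d < i + j + l)%N -> forall x y z, pure x -> pure y -> pure z ->
  D (iter i n x) (iter j n y) (iter l n z) = 0.
Proof.
move=> H i j l ijl; have [L1 L2 L3] := D3; have [Z1 Z2 Z3] := trilinZ D3.
have D0 : [/\ forall y z, D 0 y z = 0, forall x z, D x 0 z = 0 & forall x y, D x y 0 = 0].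
  by split=> x y; rewrite -(scale0r 0) (Z1, Z2, Z3) mul0r.
have [D01 D02 D03] := D0.
move=> x y z Px Py Pz; move: x Px y Py z Pz.
apply: (pure_V_ind two0 n7 Pv v6) => [|c x x' Hx Hx'|i'].
- by move=> y _ z _; rewrite iter_nn0 D01.
- by move=> y Py z Pz; rewrite iter_nnD iter_nnZ L1 Hx ?Hx' // mulr0 addr0.
apply: (pure_V_ind two0 n7 Pv v6) => [|c y y' Hy Hy'|j'].
- by move=> z _; rewrite iter_nn0 D02.
- by move=> z Pz; rewrite iter_nnD iter_nnZ L2 Hy ?Hy' // mulr0 addr0.
apply: (pure_V_ind two0 n7 Pv v6) => [|c z z' Hz Hz'|l'].
- by rewrite iter_nn0 D03.
- by rewrite iter_nnD iter_nnZ L3 Hz Hz' mulr0 addr0.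
by rewrite -!iterD; apply: H; lia.
Qed.

(* [s] changes the sign of [D], but acts on the leading terms by [(-1) ^+ (i + j + l + 3)]. *)
Let D_odd (d : nat) : (forall i j l, (d < i + j + l)%N -> a i j l = 0) -> odd d ->
  forall i j l, (i + j + l)%N = d -> a i j l = 0.
Proof.
move=> H ow i j l ijl.
have E : D (U i) (U j) (U l) = a i j l.
  rewrite -[U i]opprK -[U j]opprK -[U l]opprK -!s_V.
  have [Z1 Z2 Z3] := trilinZ D3.
  rewrite -[- s (V i)]scaleN1r -[- s (V j)]scaleN1r -[- s (V l)]scaleN1r Z1 Z2 Z3.
  by rewrite /a /D !s_invol; ring.
have [y1 Py1 E1] := U_V i; have [y2 Py2 E2] := U_V j; have [y3 Py3 E3] := U_V l.
have [Z1 Z2 Z3] := trilinZ D3; have [L1 L2 L3] := trilinD D3.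
move: E; rewrite E1 E2 E3 Z1 Z2 Z3 !(L1, L2, L3).
have Dh := D_high H.
rewrite !(Dh _ _ _ _ v v y3, Dh _ _ _ _ v y2 v, Dh _ _ _ _ v y2 y3, Dh _ _ _ _ y1 v v,
  Dh _ _ _ _ y1 v y3, Dh _ _ _ _ y1 y2 v, Dh _ _ _ _ y1 y2 y3) // ?addr0; try lia.
rewrite -/(a i j l) !mulrA -!exprD ijl -signr_odd ow => E.
by apply: (lcombm1 2%:R (-1) two0 E); ring.
Qed.

Let D_zero i j l : a i j l = 0.
Proof.
have [H1 H2 H3 H4] := V_seq n7 Pv D3 Dt D12 D23.
apply: (seq_zero two0 H1 H2 H3 H4); first exact: D_odd.
have [Z1 Z2 Z3] := trilinZ D3; have [L1 L2 L3] := trilinD D3.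
have -> : D (V 0) (V 1) (V 3) + D (V 0) (V 2) (V 3) = D v (t (n v)) (V 3).
  by rewrite (tE t) L2.
rewrite /D Qv subr0.
pose p := T v; pose q := T p; pose r := T q.
have sv : s v = - v by rewrite -[v]/(V 0) s_V.
have E1 : s (t (n v)) = p - q.
  by rewrite s_aut -[n v]/(V 1) s_V oautN -[U 1]/(m v) nnE !oautB opprB.
have E2 : s (V 3) = - (r - 3%:R *: q + 3%:R *: p - v).
  rewrite s_V /= !nnE !oautB -/p -/q -/r; congr (- _).
  by apply: bilf_inj => w; rewrite !bilfE; ring.
(* This is [Qv] transported by [t^-3]. By alternation the terms with coefficient 3 cancel, both here
   and in the goal, and each reduces to [phi v (p - q) r] up to sign. *)
have Q3 : phi r (p - q) (v - 3%:R *: p + 3%:R *: q - r) = 0.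
  rewrite -Qv -[RHS](oaut_phi T) -[RHS](oaut_phi T) -[RHS](oaut_phi T); congr phi.
    by rewrite !nnE !oautB !oautK.
  rewrite -[iter 3 n v]/(n (n (n v))) !nnE !oautB !oautK -/p -/q -/r.
  by apply: bilf_inj => w; rewrite !bilfE; ring.
have [Pp Pq Pr] : [/\ pure p, pure q & pure r] by split; do ?apply: oaut_pure.
have P12 x y z := @phi_swap12 k C x y z; have P23 x y z := @phi_swap23 k C x y z.
have alt x y : pure x -> phi x y y = 0.
  by move=> Px; have H := P23 x y y Px; apply: (lcombm1 2%:R 1 two0 H); ring.
have alt' x y : pure x -> pure y -> phi x y x = 0.
  move=> Px Py; have H := P12 x x y Px Px Py; rewrite (P23 _ _ _ Px).
  by apply: (lcombm1 2%:R (-1) two0 H); ring.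
have [PZ1 PZ2 PZ3] := trilinZ (@phi_trilin k C); have [PL1 PL2 PL3] := trilinD (@phi_trilin k C).
have [PN1 PN2 PN3] : [/\ forall x y z : C, phi (- x) y z = - phi x y z,
    forall x y z : C, phi x (- y) z = - phi x y z & forall x y z : C, phi x y (- z) = - phi x y z].
  by split=> x y z; rewrite -scaleN1r (PZ1, PZ2, PZ3) mulN1r.
have rot x y : pure y -> phi r y x = - phi x y r by move=> Py; apply: phi_adj.
rewrite sv E1 E2; move: Q3.
rewrite !(PL1, PL2, PL3, PN1, PN2, PN3, PZ1, PZ2, PZ3).
rewrite !alt ?alt' // [phi v q p]P23 // [phi r q p]P23 // [phi r p v]rot // [phi r q v]rot // => H.
by apply: (lcomb1 (-1) H); ring.
Qed.

Lemma inverter_strongly_real : strongly_real t.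
Proof.
have so : is_oaut s.
  apply: (oaut_of_form two0 s_e s_isom) => x y z Px Py Pz.
  apply/eqP; rewrite -subr_eq0; apply/eqP.
  have [L1 L2 L3] := D3; have [Z1 Z2 Z3] := trilinZ D3.
  rewrite -/(D x y z); move: x Px y Py z Pz => /=.
  apply: (pure_V_ind two0 n7 Pv v6) => [y _ z _|c x x' Hx Hx' y Py z Pz|i].
  - by rewrite -(scale0r 0) Z1 mul0r.
  - by rewrite L1 Hx ?Hx' // mulr0 addr0.
  apply: (pure_V_ind two0 n7 Pv v6) => [z _|c y y' Hy Hy' z Pz|j].
  - by rewrite -(scale0r 0) Z2 mul0r.
  - by rewrite L2 Hy ?Hy' // mulr0 addr0.
  apply: (pure_V_ind two0 n7 Pv v6) => [|c z z' Hz Hz'|l].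
  - by rewrite -(scale0r 0) Z3 mul0r.
  - by rewrite L3 Hz Hz' mulr0 addr0.
  exact: D_zero.
apply: (@strongly_real_of k C (OAut (introT (asboolP _) so))) => x /=; first exact: s_invol.
by rewrite t_s_t s_invol.
Qed.
End Inverter.

Theorem cyclic_strongly_real : strongly_real t.
Proof. by have [s [s_e s_V]] := regular_inverter; apply: (inverter_strongly_real s_e s_V). Qed.
End RegularUnipotent.

Theorem regular_unipotent_strongly_real (k : fieldType) (C : octonionType k) (t : oaut C) :
  (2%:R : k) != 0 -> (3%:R : k) != 0 -> (forall x, iter 7 (nn t) x = 0) ->
  (exists2 w, pure w & iter 6 (nn t) w != 0) -> strongly_real t.
Proof.
move=> two0 three0 n7 H; have [v [Pv v6 Qv]] := normalized_vector two0 n7 three0 H.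
exact: (cyclic_strongly_real two0 n7 Pv v6 Qv).
Qed.

(** * Unipotent elements fixing a totally isotropic space *)

Section FixedIsotropicPlane.
Variables (k : fieldType) (C : octonionType k).
Hypotheses (two0 : (2%:R : k) != 0) (three0 : (3%:R : k) != 0).
Local Notation "x ** y" := (omul x y) (at level 40, left associativity).
Local Notation N := (@onorm k C).
Local Notation b := (@bilf k C).
Local Notation e := (@oone k C).
Variables (t : oaut C) (x y : C).
Hypotheses (tU : unipotent t) (Px : pure x) (Py : pure y) (tx : t x = x) (ty : t y = y).
Hypotheses (Nx : N x = 0) (Ny : N y = 0) (xy : b x y = 0) (xy0 : x ** y != 0).
Local Notation z := (x ** y).

Let yx : y ** x = - z.
Proof. by rewrite (pure_anti Py Px) bilfC xy scale0r subr0. Qed.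
Let xz : x ** z = 0. Proof. by rewrite pureKl // Nx oppr0 scale0r. Qed.
Let zy : z ** y = 0. Proof. by rewrite pureKr // Ny oppr0 scale0r. Qed.
Let zx : z ** x = 0.
Proof. by rewrite -[z]opprK -yx omulNl pureKr // Nx oppr0 scale0r oppr0. Qed.
Let xx : x ** x = 0. Proof. by rewrite pure_sq // Nx oppr0 scale0r. Qed.
Let yy : y ** y = 0. Proof. by rewrite pure_sq // Ny oppr0 scale0r. Qed.
Let Pz : pure z. Proof. by rewrite /pure bilf1M (pure_conj Py) bilfNr xy oppr0. Qed.
Let Nz : N z = 0. Proof. by rewrite onormM Nx mul0r. Qed.
Let zz : z ** z = 0. Proof. by rewrite pure_sq // Nz oppr0 scale0r. Qed.
Let tz : t z = z. Proof. by rewrite oautM tx ty. Qed.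

Let bxz : b x z = 0. Proof. by rewrite -{1}[x]omulx1 bilf_mull Nx mul0r. Qed.
Let byz : b y z = 0. Proof. by rewrite -{1}[y]omul1x bilf_mulr Ny mulr0. Qed.

Let indep p a c d : p *: e + a *: x + c *: y + d *: z = 0 -> [/\ p = 0, a = 0, c = 0 & d = 0].
Proof.
move=> H; have p0 : p = 0.
  have := congr1 (b e) H; rewrite !bilfE !(bilfC e) Px Py Pz bilfxx onorm1 => E.
  by apply: (lcombm1 2%:R 1 two0 E); ring.
move: H; rewrite p0 scale0r add0r => H.
have c0 : c = 0.
  have := congr1 (fun w => x ** w) H; rewrite !omulE xx xz !scaler0 add0r addr0.
  by move/eqP; rewrite scaler_eq0 (negPf xy0) orbF => /eqP.
have a0 : a = 0.
  have := congr1 (fun w => w ** y) H; rewrite !omulE yy zy !scaler0 !addr0.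
  by move/eqP; rewrite scaler_eq0 (negPf xy0) orbF => /eqP.
split=> //; move/eqP: H; rewrite a0 c0 !scale0r !add0r scaler_eq0 (negPf xy0) orbF.
by move/eqP.
Qed.

Let exyz_free : free [:: e; x; y; z].
Proof.
suff : free [tuple e; x; y; z] by [].
apply/freeP=> c; rewrite !big_ord_recl big_ord0 /= addr0 !addrA => /indep [h0 h1 h2 h3].
by case=> [[|[|[|[|//]]]] i4]; [rewrite -[RHS]h0 | rewrite -[RHS]h1 | rewrite -[RHS]h2
  | rewrite -[RHS]h3]; congr c; apply: val_inj.
Qed.

(** Take [v] dual to [z] and orthogonal to [e], [x], [y]. The plane of [z] and [v] is hyperbolic and
    generates a quaternion algebra with pure element [r] of norm -1/4. Either [r] is fixed, or a
    correction of [v] makes such an algebra stable. *)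
Theorem fixed_isotropic_plane : strongly_real t.
Proof.
have [v Hv] := dual_vec (fun i => (i == 3)%:R) exyz_free.
have ve : b v e = 0 by have := Hv 0%N isT.
have vx : b v x = 0 by have := Hv 1%N isT.
have vy : b v y = 0 by have := Hv 2%N isT.
have vz : b v z = 1 by have := Hv 3%N isT.
clear Hv; have Pv : pure v by [].
have zv : b z v = 1 by rewrite bilfC.
pose r := z ** v + 2%:R^-1 *: e.
have zve : b (z ** v) e = - 1 by rewrite bilf1M (pure_conj Pv) bilfNr zv.
have Pr : pure r by rewrite /pure /r !bilfE zve bilfxx onorm1; field.
have Nr : N r != 0.
  have -> : N r = - (2%:R^-1 * 2%:R^-1).
    by rewrite /r onormD onormM Nz onormZ onorm1 bilfZr zve; field.
  by rewrite oppr_eq0 mulf_neq0 ?invr_eq0.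
have rz : b r z = 0.
  by rewrite /r !bilfE [b e z]bilfC Pz -{2}[z]omulx1 bilf_mull Nz; ring.
have rx : b r x = 0.
  by rewrite /r !bilfE [b e x]bilfC Px bilf_adjl (pure_conj Pz) omulNl zx !bilfE; ring.
have ry : b r y = 0.
  by rewrite /r !bilfE [b e y]bilfC Py bilf_adjl (pure_conj Pz) omulNl zy !bilfE; ring.
have rE : r = z ** v + 2%:R^-1 *: e by [].
clearbody r; have bz : [/\ b x x = 0, b y y = 0 & b z z = 0] by rewrite !bilfxx Nx Ny Nz mulr0.
have [bxx byy bzz] := bz.
(* [t v - v] is orthogonal to the fixed vectors [e], [x], [y], [z], and the 4-dimensional complement
   of their span is spanned by [r], [z], [x], [y]. *)
have [al [be [a [c E]]]] : exists al be a c, nn t v = al *: r + be *: z + a *: x + c *: y.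
  apply: span4P; set S := <<_>>%VS; have -> : S = orthv <<[:: e; x; y; z]>>%VS.
    apply/eqP; rewrite eqEdim; apply/andP; split.
      apply/span_subvP=> w; rewrite !inE => Hw; apply: orth_spanP => u; rewrite !inE => Hu.
      by case/or4P: Hw => /eqP ->; case/or4P: Hu => /eqP -> //; rewrite ?Pr ?bxz ?byz // bilfC ?bxz ?byz.
    have := dim_orthv <<[:: e; x; y; z]>>%VS; move: (exyz_free); rewrite /free => /eqP -> /=.
    move/(canRL (addnK _)) => ->; rewrite subSS.
    have : free [:: r; z; x; y].
      suff : free [tuple r; z; x; y] by [].
      apply/freeP=> d; rewrite !big_ord_recl big_ord0 /= addr0 !addrA => H.
      have r0 : d ord0 = 0.
        have := congr1 (b r) H; rewrite !bilfE rz rx ry bilfxx => E.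
        by apply: (lcombm1 (2%:R * N r) 1 _ E); [rewrite mulf_neq0 | ring].
      move: H; rewrite r0 scale0r add0r => H.
      have [|h0 h1 h2 h3] := @indep 0 (d (lift ord0 (lift ord0 ord0)))
        (d (lift ord0 (lift ord0 (lift ord0 ord0)))) (d (lift ord0 ord0)).
        by rewrite scale0r add0r addrC addrA; exact: H.
      by case=> [[|[|[|[|//]]]] i4]; [rewrite -[RHS]r0 | rewrite -[RHS]h3 | rewrite -[RHS]h1
        | rewrite -[RHS]h2]; congr d; apply: val_inj.
    by rewrite /free -/S => /eqP ->.
  apply: orth_spanP => w; rewrite !inE nnE bilfDl bilfNl => Hw.
  have tw : t w = w by case/or4P: Hw => /eqP ->; rewrite ?oaut1.
  by rewrite -{1}tw oaut_bilf subrr.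
have zr : z ** r = 2%:R^-1 *: z by rewrite rE omulDr pureKl // Nz oppr0 scale0r add0r omulZr omulx1.
have zvx : (z ** v) ** x = 0.
  by rewrite (pure_linr _ Pv Px) zx omul0l vx oppr0 scale0r subr0.
have zvy : (z ** v) ** y = 0.
  by rewrite (pure_linr _ Pv Py) zy omul0l vy oppr0 scale0r subr0.
have rX : r ** x = 2%:R^-1 *: x by rewrite rE omulDl zvx add0r omulZl omul1x.
have rY : r ** y = 2%:R^-1 *: y by rewrite rE omulDl zvy add0r omulZl omul1x.
have z_vx : z ** (v ** x) = - x.
  by rewrite (pure_linl _ Pz Pv) zx omul0r oppr0 zv scale1r add0r.
have z_vy : z ** (v ** y) = - y.
  by rewrite (pure_linl _ Pz Pv) zy omul0r oppr0 zv scale1r add0r.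
have tv : t v = v + (al *: r + be *: z + a *: x + c *: y) by rewrite tE E.
have tr : t r = r + (al / 2%:R) *: z.
  rewrite {1}rE oautD oautZ oaut1 oautM tz tv !omulDr !omulZr zr zz zx zy !scaler0 !addr0.
  by rewrite scalerA addrAC -rE.
have [al0|al0] := eqVneq al 0.
  apply: (unipotent_fixed_anisotropic two0 tU _ Pr Nr).
  by rewrite tr al0 mul0r scale0r addr0.
have al3 : 3%:R * al != 0 by rewrite mulf_neq0.
(* [c1] and [d1] are chosen to make the span of [e, z, v', z ** v'] stable under [t]. *)
pose c1 := - 2%:R * a / (3%:R * al); pose d1 := - 2%:R * c / (3%:R * al).
have c1E : 3%:R * al * c1 = - 2%:R * a by rewrite /c1; field; rewrite al0 three0.
have d1E : 3%:R * al * d1 = - 2%:R * c by rewrite /d1; field; rewrite al0 three0.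
clearbody c1 d1; pose v' := v + c1 *: (v ** x) + d1 *: (v ** y).
have v'E : v' = v + c1 *: (v ** x) + d1 *: (v ** y) by [].
clearbody v'.
have Pv' : pure v'.
  by rewrite /pure v'E !bilfE !bilf1M !pure_conj // !bilfNr vx vy ve; ring.
have zv' : b z v' = 1.
  rewrite v'E !bilfE zv ![b z (v ** _)]bilfC !bilf_adjr !pure_conj // !omulNr zx zy.
  by rewrite !bilfE; ring.
have disc : 4%:R * N z * N v' - b z v' ^+ 2 != 0.
  by rewrite Nz zv' mulr0 mul0r expr1n sub0r oppr_eq0 oner_eq0.
have z_v' : z ** v' = r - 2%:R^-1 *: e - c1 *: x - d1 *: y.
  rewrite v'E !omulDr !omulZr z_vx z_vy rE.
  by apply: bilf_inj => w; rewrite !bilfE; ring.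
apply: (stable_quaternion_strongly_real two0 (quat_comp Pz Pv' disc) (quat_dim Pz Pv' disc)).
apply: (quat_stable Pz Pv' disc); first by rewrite tz mem_quat1.
have -> : t v' = (al / 2%:R) *: e + (be - c1 * c + d1 * a) *: z + 1 *: v' + al *: (z ** v').
  rewrite z_v' {1}v'E !oautD !oautZ !oautM tx ty tv !omulDl !omulZl rX rY zx zy xx yy yx.
  apply: bilf_inj => w; rewrite v'E !bilfE.
  have H : b x w * (3%:R * al * c1) + b y w * (3%:R * al * d1) =
    b x w * (- 2%:R * a) + b y w * (- 2%:R * c) by rewrite c1E d1E.
  by apply: (lcombm1 2%:R 1 two0 H); field.
exact: mem_span4.
Qed.
End FixedIsotropicPlane.

(** * The space of fixed pure octonions of a unipotent *)

Section UnipotentReduction.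
Variables (k : fieldType) (C : octonionType k).
Hypothesis two0 : (2%:R : k) != 0.
Local Notation "x ** y" := (omul x y) (at level 40, left associativity).
Local Notation N := (@onorm k C).
Local Notation b := (@bilf k C).
Local Notation e := (@oone k C).
Implicit Types (x y z w v u : C).
Variable t : oaut C.
Hypothesis tU : unipotent t.
Local Notation n := (nn t).
Let P := orthv <[e]>%VS.
Let F := (lker (fsh t 1) :&: P)%VS.

Let dimP : \dim P = 7%N. Proof. exact: dim_pure. Qed.
Let nE x : n x = fsh t 1 x. Proof. by rewrite nnE fshE scale1r. Qed.
Let iter_nE i x : iter i n x = iter i (fsh t 1) x.
Proof. by elim: i => //= i ->; rewrite nE. Qed.
Let n_nil : exists i, forall x, iter i n x = 0.
Proof.
have [i H] := tU; exists i => x; rewrite -[RHS](H x); elim: i {H} => //= i ->.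
by rewrite nnE.
Qed.

Lemma fixed_spaceP x : (x \in F) <-> t x = x /\ pure x.
Proof.
rewrite memv_cap memv_ker fshE scale1r subr_eq0.
by split=> [/andP [/eqP tx /pureP Px]|[-> /pureP ->]]; rewrite ?eqxx.
Qed.

Lemma unipotent_nil7 x : iter 7 n x = 0.
Proof.
have HP y : y \in P -> iter 7 n y = 0.
  move=> Py; have [i H] := n_nil; rewrite iter_nE.
  have := @nil_dim k C (fsh t 1) P i; rewrite dimP => -> // z Pz; last by rewrite -iter_nE.
  by rewrite -nE; apply/pureP/pure_nn/pureP.
pose p := 2%:R^-1 * b x e; rewrite -[x](subrK (p *: e)) iter_nnD iter_nnZ HP.
  by rewrite iterSr nn_e iter_nn0 scaler0 addr0.
by apply/pureP; rewrite /pure /p !bilfE bilfxx onorm1; field.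
Qed.

(** [n x] would be an eigenvector of the nilpotent [n] for the nonzero eigenvalue -2. *)
Lemma square_fixed x : t (t x) = x -> t x = x.
Proof.
move=> ttx; have [i H] := n_nil; have E : n (n x) = - 2%:R *: n x.
  by rewrite !nnE !oautB ttx; apply: bilf_inj => w; rewrite !bilfE; ring.
have E' : iter i n (n x) = (- 2%:R) ^+ i *: n x.
  elim: i {H} => [|i IH]; first by rewrite scale1r.
  by rewrite iterS IH nnZ E scalerA exprSr.
move: E'; rewrite H => /esym/eqP; rewrite scaler_eq0 expf_eq0 oppr_eq0 (negPf two0) andbF /=.
by rewrite nnE subr_eq0 => /eqP.
Qed.

(* Otherwise the skew form [b x (t y - t^-1 y)] is degenerate on a complement of [F] in [P]. *)
Lemma fixed_space_odd : odd (\dim F).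
Proof.
apply: contraT => evF; have sFP : (F <= P)%VS by exact: capvSr.
have oQ : odd (\dim (P :\: F)%VS).
  have := dimv_cap_compl P F; rewrite (capv_idPr sFP) dimP => H.
  by rewrite -(addKn (\dim F) (\dim _)) H oddB ?(negPf evF) // -H leq_addr.
have [||q [qQ q0 Hq]] := @skew_odd k C two0 (fun x => t x - (t^-1)%g x) _ _ _ oQ.
- by move=> a x y; rewrite !oautD !oautZ; apply: bilf_inj => w; rewrite !bilfE; ring.
- move=> x y; rewrite !bilfE [b ((t^-1)%g x) y]bilfC -(oaut_bilfV t y x) [b (t y) x]bilfC.
  by rewrite (oaut_bilfV t x y); ring.
have Pq : q \in P := subvP (diffvSl P F) _ qQ.
(* The form also vanishes against every fixed vector, so [q] lies in its radical on the whole
   algebra. *)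
have Sq w : b w (t q - (t^-1)%g q) = 0.
  have Sfix w' : t w' = w' -> b w' (t q - (t^-1)%g q) = 0.
    by move=> tw; rewrite !bilfE -{1}tw oaut_bilf -(oaut_bilfV t w' q) tw subrr.
  pose p := 2%:R^-1 * b w e; rewrite -[w](subrK (p *: e)) bilfDl bilfZl (Sfix e) ?oaut1 // mulr0 addr0.
  have : w - p *: e \in P by apply/pureP; rewrite /pure /p !bilfE bilfxx onorm1; field.
  rewrite -(addv_diff_cap P F) => /memv_addP [w1 w1Q [w2 w2F ->]].
  rewrite bilfDl Hq // add0r Sfix //; move: w2F; rewrite memv_cap => /andP [_ /fixed_spaceP []] //.
have tq : t q = q.
  apply: square_fixed; have E : t q = (t^-1)%g q.
    by apply/eqP; rewrite -subr_eq0; apply/eqP/bilf_inj => w; rewrite bilf0l bilfC.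
  by rewrite E oautVK.
have : q \in (F :&: (P :\: F))%VS.
  by rewrite memv_cap qQ andbT; apply/fixed_spaceP; split=> //; apply/pureP.
by rewrite capvC capv_diff memv0 (negPf q0).
Qed.

(** On pure octonions, the kernel of [n^j] grows by at most [\dim F] at each step, so the kernel of
    [n^6] has dimension at most 6, while the space has dimension 7. *)
Lemma regular_of_small (dF : (\dim F <= 1)%N) : exists2 w, pure w & iter 6 n w != 0.
Proof.
pose K j := (lker (lpow (fsh t 1) j) :&: P)%VS.
have KP j x : (x \in K j) <-> iter j n x = 0 /\ pure x.
  rewrite memv_cap memv_ker lpowE -iter_nE.
  by split=> [/andP [/eqP tx /pureP Px]|[-> /pureP ->]]; rewrite ?eqxx.
have dK j : (\dim (K j) <= j)%N.
  elim: j => [|j IH].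
    rewrite leqn0 dimv_eq0 -subv0; apply/subvP=> x /KP [/= -> _]; exact: mem0v.
  rewrite -(limg_ker_dim (fsh t 1) (K j.+1)) -add1n; apply: leq_add.
    apply: leq_trans dF; apply: dimvS; apply/subvP=> x; rewrite memv_cap => /andP [/KP [_ Px] tx].
    by rewrite memv_cap tx; apply/pureP.
  apply: leq_trans IH; apply: dimvS; apply/subvP=> _ /memv_imgP [x /KP [xj Px] ->].
  by apply/KP; rewrite -nE -iterSr; split=> //; apply: pure_nn.
apply: contrapT => H; have : (P <= K 6)%VS.
  apply/subvP=> x /pureP Px; apply/KP; split=> //.
  by apply/eqP; apply: contra_notT H => H; exists x.
by move/dimvS; rewrite dimP => /leq_trans/(_ (dK 6)).
Qed.

Hypotheses (Fiso : forall x, x \in F -> N x = 0)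
  (FF : forall x y, x \in F -> y \in F -> x ** y = 0).

(** By parity a larger [F] has dimension at least 3. Some isotropic [w = x ** c] outside [F] is
    orthogonal to [F], giving a totally isotropic pure space [G] of dimension at least 4. Then [G]
    and [e] lie in the orthogonal of [G], too much for dimension 8. *)
Lemma fixed_space_line : (\dim F <= 1)%N.
Proof.
rewrite leqNgt; apply/negP => dF1.
have dF : (2 < \dim F)%N by have := fixed_space_odd; case: (\dim F) dF1 => [|[|[|]]].
have Fp x : x \in F -> pure x by case/fixed_spaceP.
have Fb x y : x \in F -> y \in F -> b x y = 0.
  by move=> xF yF; have := onormD x y; rewrite !Fiso ?memvD // !add0r.
have eF : e \notin F.
  by apply/negP => /Fp; rewrite /pure bilfxx onorm1 mulr1; apply/eqP.
pose x := vpick F; have xF : x \in F by apply: memv_pick.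
have x0 : x != 0 by rewrite vpick0 -dimv_eq0 -lt0n ltnW.
have [y yF yx] : exists2 y, y \in F & y \notin <[x]>%VS.
  by apply/subvPn; apply: contraTN dF1 => /dimvS; rewrite dim_vline x0 -leqNgt.
have fr : free [:: e; y; x].
  rewrite free_cons free_cons seq1_free span_seq1 x0 yx !andbT; apply: contra eF; apply: subvP.
  by apply/span_subvP=> u; rewrite !inE => /orP [] /eqP ->.
have [c Hc] := dual_vec (fun i => (i == 1)%:R) fr.
have Pc : pure c by have := Hc 0%N isT.
have cy : b c y = 1 by have := Hc 1%N isT.
have cx : b c x = 0 by have := Hc 2%N isT.
have [Px Py] := (Fp _ xF, Fp _ yF).
pose w := x ** c; have Pw : pure w.
  by rewrite /w /pure bilf1M (pure_conj Pc) bilfNr bilfC cx oppr0.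
have [wF|wF] := boolP (w \in F).
  (* Polarization gives [(x ** c) ** y = - (x ** y) ** c - b c y *: x]; both products vanish when
     [w] is in [F], while [b c y = 1]. *)
  case/eqP: x0; have := pure_linr x Pc Py; rewrite -/w (FF wF yF) (FF xF yF) omul0l cy scale1r oppr0 add0r.
  by move/esym/eqP; rewrite oppr_eq0 => /eqP.
have Nw : N w = 0 by rewrite onormM Fiso // mul0r.
have wf f : f \in F -> b w f = 0.
  by move=> fF; rewrite bilf_adjl (pure_conj Px) omulNl FF // oppr0 bilf0r.
pose G := (F + <[w]>)%VS.
have GP u : u \in G -> exists f a, [/\ f \in F, pure f & u = f + a *: w].
  by move=> /memv_addP [f fF [_ /vlineP [a ->] ->]]; exists f, a; split=> //; apply: Fp.
have dG : (3 < \dim G)%N.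
  have w0 : w != 0 by apply: contraNneq wF => ->; apply: mem0v.
  rewrite dimv_disjoint_sum ?dim_vline ?w0 ?addn1 //.
  apply/eqP; rewrite -subv0; apply/subvP=> u; rewrite memv_cap => /andP [aF /vlineP [a E]].
  move: aF; rewrite E; have [->|a0] := eqVneq a 0; first by rewrite scale0r !mem0v.
  by move=> aF; case/negP: wF; have := memvZ a^-1 aF; rewrite scalerA mulVf // scale1r.
have sub : (G + <[e]> <= orthv G)%VS.
  apply/subvP=> _ /memv_addP [_ /GP [f [a [fF Pf ->]]] [_ /vlineP [d ->] ->]].
  apply/orthvP=> _ /GP [f' [a' [fF' Pf' ->]]].
  rewrite !bilfE Fb // bilfxx Nw (wf f') // [b f w]bilfC (wf f) // ![b e _]bilfC Pf' Pw; ring.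
have dGe : \dim (G + <[e]>) = (\dim G).+1.
  rewrite dimv_disjoint_sum ?dim_vline ?(oone_neq0 C) ?addn1 //.
  apply/eqP; rewrite -subv0; apply/subvP=> u; rewrite memv_cap => /andP [/GP [f [a [fF Pf E]]] /vlineP [d E']].
  have : b (d *: e) e = 0 by rewrite -E' E !bilfE Pf Pw mulr0 addr0.
  rewrite bilfZl bilfxx onorm1 mulr1 => /eqP; rewrite mulf_eq0 (negPf two0) orbF => /eqP d0.
  by rewrite E' d0 scale0r memv0.
have H8 : (\dim (orthv G) + \dim G = 8)%N := dim_orthv G.
by move/dimvS: sub; rewrite dGe; move: H8 dG; clear; lia.
Qed.
End UnipotentReduction.

Theorem unipotent_strongly_real (k : fieldType) (C : octonionType k) (t : oaut C) :
  (2%:R : k) != 0 -> (3%:R : k) != 0 -> unipotent t -> strongly_real t.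
Proof.
move=> two0 three0 tU.
have [[u [tu Pu Nu]]|H1] := pselect (exists u, [/\ t u = u, pure u & onorm u != 0]).
  exact: (unipotent_fixed_anisotropic two0 tU tu Pu Nu).
have N0 x : t x = x -> pure x -> onorm x = 0.
  by move=> tx Px; apply/eqP; apply: contra_notT H1 => H; exists x.
have [[x [y [[tx Px] [ty Py] xy]]]|H2] := pselect (exists x y : C,
    [/\ t x = x /\ pure x, t y = y /\ pure y & omul x y != 0]).
  apply: (fixed_isotropic_plane two0 three0 tU Px Py tx ty _ _ _ xy); rewrite ?N0 //.
  have := onormD x y; rewrite !N0 ?add0r // ?oautD ?tx ?ty //.
  by rewrite /pure bilfDl Px Py addr0.
apply: regular_unipotent_strongly_real => //; first exact: unipotent_nil7.
apply: (@regular_of_small _ _ two0); apply: fixed_space_line => // x.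
  by move/fixed_spaceP => [tx Px]; apply: N0.
move=> y /fixed_spaceP [tx Px] /fixed_spaceP [ty Py].
by apply/eqP; apply: contra_notT H2 => H; exists x, y.
Qed.

Theorem theoremA1p4 (k : fieldType) (char_not2 : 2%N \notin [pchar k]%R)
    (C : octonionType k) :
  (forall t0 : oaut C, ~ unipotent t0 -> (real_elt t0 <-> strongly_real t0))
  /\ (3%N \notin [pchar k]%R ->
      forall u : oaut C, unipotent u -> strongly_real u).
Proof.
have two0 : (2%:R : k) != 0 by move: char_not2; rewrite inE.
split=> [t tU|]; first exact: nonunipotent_real_iff.
rewrite inE /= => three0 u; exact: unipotent_strongly_real.
Qed.
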